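(* Let $D\subset\mathbb P^n$ be a smooth irreducible divisor of degree $\deg D=\delta$. If $\delta\ge 3$, then $$H^0(\mathbb P^n,\mathcal J_{k,m}T^*_{\mathbb P^n}\langle D\rangle)=0$$ for all integers $m\ge 1$ and $1\le k\le n-1$.
   Context: $\mathcal J_{k,m}T^*_{\mathbb P^n}\langle D\rangle$ is the locally free sheaf (vector bundle) of (not necessarily invariant) logarithmic jet differentials of order $k$ and weighted degree $m$ on $(\mathbb P^n,D)$: its local sections are the operators on germs of holomorphic curves $f\colon(\mathbb C,0)\to\mathbb P^n\setminus D$ that are polynomials, with holomorphic functions as coefficients, in the derivatives of orders $1,\dots,k$ of the components $f_1,\dots,f_n$ of $f$ and of $\log s(f)$, where $s$ is a local equation of $D$, and that are weighted homogeneous of degree $m$, a derivative of order $j$ having weight $j$. In local coordinates $(z_1,\dots,z_n)$ with $D=\{z_1=0\}$ these are polynomials in $(\log f_1)^{(j)},f_2^{(j)},\dots,f_n^{(j)}$, $1\le j\le k$; away from $D$, polynomials in $f_1^{(j)},\dots,f_n^{(j)}$. *)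

(* Defs.v *)
From HB Require Import structures.
From mathcomp Require Import all_boot all_order all_algebra.
From mathcomp Require Import all_classical all_reals all_analysis.
From mathcomp Require Import complex.
From mathcomp Require Import -(notations) mpoly.
Set Implicit Arguments.
Unset Strict Implicit.
Unset Printing Implicit Defensive.
Import Order.TTheory GRing.Theory Num.Theory.
Import numFieldNormedType.Exports.
Local Open Scope classical_set_scope.
Local Open Scope ring_scope.

(* The field of complex numbers, packed: R[i] carries in the library the module
   structure over R, whereas here it must be normed over itself. *)
Definition complex_field (R : realType) : numClosedFieldType := complex R.

Section LogJetDifferentials.
Variables (C : numClosedFieldType) (n : nat).

(* Points of P^n are the lines through the origin of C^(n+1). *)
Definition projective_space := {L : {vspace 'rV[C]_n.+1} | \dim L == 1%N}.
Local Notation Pn := projective_space.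

(* Homogeneous coordinates of p: those of a chosen nonzero vector of the line.
   Everything below depends on them only through ratios or through the
   vanishing of homogeneous forms. *)
Definition hcoord (p : Pn) (l : 'I_n.+1) : C := vpick (val p) 0 l.

Definition in_chart (i : 'I_n.+1) (p : Pn) : Prop := hcoord p i != 0.

(* The standard coordinates x_l / x_i, l <> i, identifying in_chart i
   with C^n. *)
Definition chart (i : 'I_n.+1) (p : Pn) : 'rV[C]_n :=
  \row_j (hcoord p (lift i j) / hcoord p i).

(* A function C -> P^n standing for its germ at 0. *)
Definition holomorphic_germ (f : C -> Pn) : Prop :=
  exists i : 'I_n.+1,
    (\forall t \near (0 : C), in_chart i (f t)) /\
    (\forall t \near (0 : C), differentiable (chart i \o f) t).

Section Divisor.
Variable F : mpoly n.+1 C.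

Definition divisor (p : Pn) : Prop := meval (hcoord p) F = 0.

Definition irreducible_mpoly : Prop :=
  F \isn't a GRing.unit /\
  forall G H : mpoly n.+1 C,
    F = G * H -> G \is a GRing.unit \/ H \is a GRing.unit.

(* The projective Jacobian criterion for the scheme F = 0. *)
Definition smooth_form : Prop :=
  forall p : Pn, divisor p ->
    exists l : 'I_n.+1, meval (hcoord p) (mderiv l F) != 0.

(* The divisor F = 0 is smooth, irreducible, of degree delta. *)
Definition smooth_irreducible_divisor (delta : nat) : Prop :=
  [/\ F \is ishomog1 delta mdeg,
      irreducible_mpoly & smooth_form].

Definition holomorphic_germ_off_divisor (f : C -> Pn) : Prop :=
  holomorphic_germ f /\ \forall t \near (0 : C), ~ divisor (f t).

(* The equation F / x_i ^ deg F of the divisor in the i-th chart. *)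
Definition local_equation (i : 'I_n.+1) (p : Pn) : C :=
  meval (fun l => hcoord p l / hcoord p i) F.

(* The derivative of order j.+1 of log s(f) (index None), where s is the local
   equation, or of the l-th component of f in the chart (index Some l).  No
   branch of the logarithm is needed: the derivative of log g is g^`() / g.
   These n.+1 functions are related.  Near the divisor, one component with
   nonzero partial derivative of s is redundant; away from it, log s is. *)
Definition log_jet (i : 'I_n.+1) (f : C -> Pn) (j : nat) (v : option 'I_n)
    (t : C) : C :=
  match v with
  | None =>
      let g := local_equation i \o f : C -> C in
      derive1n j (fun u => derive1 g u / g u) t
  | Some l => derive1n j.+1 (fun u => chart i (f u) 0 l) t
  end.

Section Order.
Variables k m : nat.

(* Exponents of the monomials in the variables log_jet i f j v, j < k.  In
   weighted degree m no exponent exceeds m, since all weights are positive. *)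
Definition exponents := {ffun 'I_k * option 'I_n -> 'I_m.+1}.

Definition weight (e : exponents) : nat :=
  (\sum_(jv : 'I_k * option 'I_n) jv.1.+1 * e jv)%N.

(* Operators on germs of curves; Q f stands for its germ at 0. *)
Definition curve_operator := (C -> Pn) -> (C -> C).

(* Near the point of the i-th chart with coordinates z, the operator Q is a
   local section of J_{k,m} T^*<D>. *)
Definition log_jet_differential_near (Q : curve_operator)
    (i : 'I_n.+1) (z : 'rV[C]_n) : Prop :=
  exists (V : set 'rV[C]_n) (a : exponents -> 'rV[C]_n -> C),
    [/\ open V, V z,
        (forall e x, V x -> differentiable (a e) x) &
        forall f : C -> Pn, holomorphic_germ_off_divisor f ->
          in_chart i (f 0) -> V (chart i (f 0)) ->
          \forall t \near (0 : C),
            Q f t = \sum_(e : exponents | weight e == m)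
              a e (chart i (f t)) *
              \prod_(jv : 'I_k * option 'I_n) log_jet i f jv.1 jv.2 t ^+ e jv].

(* The global sections, i.e. the elements of H^0(P^n, J_{k,m} T^*<D>). *)
Definition global_log_jet_differential (Q : curve_operator) : Prop :=
  forall (i : 'I_n.+1) (z : 'rV[C]_n), log_jet_differential_near Q i z.

End Order.

Definition zero_operator (Q : curve_operator) : Prop :=
  forall f : C -> Pn, holomorphic_germ_off_divisor f ->
    \forall t \near (0 : C), Q f t = 0.

End Divisor.
End LogJetDifferentials.

(* Main.v *)
(** A curve in P^n lifts to C^(n+1), and off the divisor F = 0 the lift can be
normalized so that its k-jet x + xi_1 t + ... + xi_k t^k satisfies
F(x + xi_1 t + ...) = F(x) modulo t^(k+1).  On the space Y of such jets with
x <> 0, which includes points over F = 0, a log jet differential becomes a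
holomorphic function G, because s = F / x_i^delta makes the derivatives of log s
those of - delta log x_i.  It satisfies G(c x, c xi) = G(x, xi) and
G(x, c xi_1, ..., c^k xi_k) = c^m G(x, xi).

Let (x, xi) maximize |G| on the compact set |x| = 1, sum |xi_j|^(2E/j) = 1 with
E = m k!.  Since k < n, the k equations defining Y have, to first order, a solution
v orthogonal to x which moves x and fixes xi; by smoothness of F it extends to
a holomorphic disc x + t v, xi + O(t^2) in Y.  By homogeneity, maximality bounds
|G|^(2 k!) along the disc by a constant times
sum |xi_j + O(t^2)|^(2E/j) / (1 + |t|^2 |v|^2)^(E/j), which after multiplication by the
square modulus of a holomorphic function is at most 1 - c |t|^2: this contradicts
the maximum principle unless G = 0.

The coefficients of a log jet differential are only assumed complex
differentiable, so the maximum principle, and the differentiability of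
the derivative of a holomorphic function, are derived from Goursat's
bisection argument, applied to the closed form Im (h dz / z) in polar coordinates. *)

Require Import Defs.
From mathcomp Require Import all_boot all_order all_algebra.
From mathcomp Require Import all_classical all_reals all_analysis.
From mathcomp Require Import complex.
From mathcomp Require Import ring lra zify.
From mathcomp Require Import -(notations) mpoly.
Set Implicit Arguments.
Unset Strict Implicit.
Unset Printing Implicit Defensive.
Import Order.TTheory GRing.Theory Num.Theory.
Import numFieldNormedType.Exports.
Local Open Scope classical_set_scope.
Local Open Scope ring_scope.

(** * Goursat's theorem for closed forms on a rectangle *)

Section SegmentIntegral.
Variable R : realType.
Implicit Types (f g : R -> R) (a b c M : R).

(** Jets over the divisor cannot be left out of Y, since the normalized jets form a compact set only
    together with them. There G cannot be read off from the operator, which sees only curves off the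
    divisor; it is computed from the coefficients in a chart. That two charts agree follows by
    moving the jet off the divisor in a transversal family and passing to the limit.

    The count is k + 1 linear conditions on v, one for each Taylor coefficient 1, ..., k of F and
    one for orthogonality, against n + 1 unknowns. The coefficient of order 0 stays free, so the
    disc may cross the divisor.

    The exponents meet three needs: E/j is an integer, so that xi_j^(E/j) is holomorphic along the
    disc; the energy has weighted degree 2E; and E = m k! matches it with the power 2 k! of G, of
    degree m. Along the disc the energy is 1 + 2 Re(t^2 B) + O(|t|^4) with B holomorphic. The middle
    term is of the same order as the gain |t|^2 |v|^2 in the denominator and has no sign; the factor
    |1 - t^2 B|^2 removes it up to O(|t|^4). *)

Definition seg_integral a b f : R := \int[@lebesgue_measure R]_(x in `[a, b]) f x.

Definition continuous_seg a b f := {within `[a, b], continuous f}.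

Lemma continuous_segW a b a' b' f : a <= a' -> b' <= b ->
  continuous_seg a b f -> continuous_seg a' b' f.
Proof.
move=> aa' b'b; apply: continuous_subspaceW => x /=; rewrite !in_itv/=.
by move=> /andP[a'x xb']; rewrite (le_trans aa' a'x) (le_trans xb' b'b).
Qed.

Lemma continuous_seg_integrable a b f : continuous_seg a b f ->
  (@lebesgue_measure R).-integrable `[a, b] (EFin \o f).
Proof. by apply: continuous_compact_integrable; exact: segment_compact. Qed.

Lemma seg_integral_split c a b f : a <= c -> c <= b -> continuous_seg a b f ->
  seg_integral a b f = seg_integral a c f + seg_integral c b f.
Proof.
move=> ac cb cf.
have fi := continuous_seg_integrable cf.
have := @Rintegral_itvB R f (BLeft a) (BRight b) c fi.
rewrite !bnd_simp => /(_ ac cb) E.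
rewrite /seg_integral -[X in _ = _ + X]Rintegral_itv_obnd_cbnd; first by rewrite -E; lra.
apply: integrableS fi => //; apply: subset_itvr.
by rewrite bnd_simp.
Qed.

Lemma seg_integralB a b f g : continuous_seg a b f -> continuous_seg a b g ->
  seg_integral a b (fun x => f x - g x) = seg_integral a b f - seg_integral a b g.
Proof. by move=> cf cg; rewrite /seg_integral RintegralB//; exact: continuous_seg_integrable. Qed.

Lemma seg_integral_cst a b M : a <= b -> seg_integral a b (fun=> M) = M * (b - a).
Proof.
move=> ab; rewrite /seg_integral Rintegral_cst//; congr (_ * _).
have := @lebesgue_measure_itv R `[a, b]; rewrite /= lte_fin => ->.
case: ltP => [_|ba]//=.
have ba2 : a = b by apply: le_anti; rewrite ab ba.
by rewrite ba2 subrr.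
Qed.

Lemma seg_integral_le a b f g : continuous_seg a b f -> continuous_seg a b g ->
  (forall x, a <= x <= b -> f x <= g x) -> seg_integral a b f <= seg_integral a b g.
Proof.
move=> cf cg fg.
by apply: (le_Rintegral _ (continuous_seg_integrable cf) (continuous_seg_integrable cg)).
Qed.

Lemma continuous_seg_cst a b M : continuous_seg a b (fun=> M).
Proof. by apply: continuous_subspaceT => x; exact: cvg_cst. Qed.

Lemma continuous_segB a b f g : continuous_seg a b f -> continuous_seg a b g ->
  continuous_seg a b (fun x => f x - g x).
Proof. by move=> cf cg x; apply: cvgB; [exact: cf|exact: cg]. Qed.

Lemma seg_integral_near a b f K M : a <= b -> continuous_seg a b f ->
  (forall x, a <= x <= b -> `|f x - K| <= M) ->
  `|seg_integral a b f - K * (b - a)| <= M * (b - a).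
Proof.
move=> ab cf fK; rewrite ler_distl.
have E : forall L, L * (b - a) = seg_integral a b (fun=> L).
  by move=> L; rewrite seg_integral_cst.
rewrite -mulrBl -mulrDl !E; apply/andP; split; apply: seg_integral_le => //;
  try exact: continuous_seg_cst.
  by move=> x /fK; rewrite ler_distl => /andP[].
by move=> x /fK; rewrite ler_distl => /andP[].
Qed.

End SegmentIntegral.

(** * Bisection for closed forms with merely differentiable coefficients *)

Section Goursat.
Variable R : realType.
Variables (A B : R -> R -> R) (a0 b0 c0 d0 : R).
Hypothesis contA : forall y, c0 <= y <= d0 -> continuous_seg a0 b0 (A ^~ y).
Hypothesis contB : forall x, a0 <= x <= b0 -> continuous_seg c0 d0 (B x).

(** The counterclockwise boundary integral of A dx + B dy. *)
Definition circulation (a b c d : R) :=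
  seg_integral a b (fun x => A x c - A x d) + seg_integral c d (fun y => B b y - B a y).

(** The coefficient [m] shared by both expansions says that the y-derivative of [A] equals the
    x-derivative of [B]. The condition is pointwise: no continuity of the partial derivatives is
    assumed. *)
Hypothesis closed_form : forall x y, a0 <= x <= b0 -> c0 <= y <= d0 ->
  exists l m n : R, forall e, 0 < e -> exists2 r : R, 0 < r &
    forall x' y', a0 <= x' <= b0 -> c0 <= y' <= d0 ->
      `|x' - x| < r -> `|y' - y| < r ->
      `|A x' y' - A x y - (l * (x' - x) + m * (y' - y))| <= e * (`|x' - x| + `|y' - y|) /\
      `|B x' y' - B x y - (m * (x' - x) + n * (y' - y))| <= e * (`|x' - x| + `|y' - y|).

Lemma circulation_splitx a b c d e : a0 <= a -> a <= e -> e <= b -> b <= b0 ->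
  c0 <= c -> c <= d -> d <= d0 ->
  circulation a b c d = circulation a e c d + circulation e b c d.
Proof.
move=> aa ae eb bb cc cd dd; rewrite /circulation.
have cA y : c <= y <= d -> continuous_seg a b (A ^~ y).
  by move=> yy; apply: (continuous_segW aa bb); apply: contA; lra.
have cB x : a <= x <= b -> continuous_seg c d (B x).
  by move=> yy; apply: (continuous_segW cc dd); apply: contB; lra.
rewrite (seg_integral_split ae eb); last by apply: continuous_segB; apply: cA; lra.
rewrite !seg_integralB; try (by apply: cB; lra).
  lra.
all: by apply: (continuous_segW _ _ (cA _ _)); lra.
Qed.

Lemma circulation_splity a b c d e : a0 <= a -> a <= b -> b <= b0 ->
  c0 <= c -> c <= e -> e <= d -> d <= d0 ->
  circulation a b c d = circulation a b c e + circulation a b e d.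
Proof.
move=> aa ab bb cc ce ed dd; rewrite /circulation.
have cA y : c <= y <= d -> continuous_seg a b (A ^~ y).
  by move=> yy; apply: (continuous_segW aa bb); apply: contA; lra.
have cB x : a <= x <= b -> continuous_seg c d (B x).
  by move=> yy; apply: (continuous_segW cc dd); apply: contB; lra.
rewrite (@seg_integral_split _ e c d)//; last by apply: continuous_segB; apply: cB; lra.
rewrite !seg_integralB; try (by apply: cA; lra).
  lra.
all: by apply: (continuous_segW _ _ (cB _ _)); lra.
Qed.

(** The affine parts contribute [m * (c - d) * (b - a)] and [m * (b - a) * (d - c)], which cancel
    because the cross derivatives agree. Only the remainders are left. *)
Lemma circulation_small x y e : a0 <= x <= b0 -> c0 <= y <= d0 -> 0 < e ->
  exists2 r : R, 0 < r & forall a b c d, a0 <= a -> b <= b0 -> c0 <= c -> d <= d0 ->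
    a <= x <= b -> c <= y <= d -> b - a < r -> d - c < r ->
    `|circulation a b c d| <= e * (b - a + (d - c)) ^+ 2.
Proof.
move=> xab ycd e0; have [l [m [n H]]] := closed_form xab ycd.
(* Each integrand is a difference of two values of the same function, hence two errors of size
   [e / 2 * s]. *)
have e2 : 0 < e / 2 by lra.
have [r r0 {}H] := H _ e2; exists r => // a b c d aa bb cc dd xx yy bar dcr.
set s := b - a + (d - c).
have near x' y' : a <= x' <= b -> c <= y' <= d ->
   `|A x' y' - A x y - (l * (x' - x) + m * (y' - y))| <= e / 2 * s /\
   `|B x' y' - B x y - (m * (x' - x) + n * (y' - y))| <= e / 2 * s.
  move=> xx' yy'.
  have x'r : `|x' - x| <= b - a by rewrite ler_distl; apply/andP; lra.
  have y'r : `|y' - y| <= d - c by rewrite ler_distl; apply/andP; lra.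
  have [| | | |HA HB] := H x' y'; try lra.
  by split; [apply: le_trans HA _|apply: le_trans HB _];
    apply: ler_wpM2l; [lra|rewrite /s; lra|lra|rewrite /s; lra].
have ab : a <= b by lra.
have cd : c <= d by lra.
have I1 : `|seg_integral a b (fun x => A x c - A x d) - (m * (c - d)) * (b - a)|
    <= e * s * (b - a).
  apply: seg_integral_near => //.
    by apply: continuous_segB; apply: (continuous_segW aa bb); apply: contA; lra.
  move=> x' xx'; have [H1 _] := near x' c xx' ltac:(lra).
  have [H2 _] := near x' d xx' ltac:(lra).
  by move: H1 H2; rewrite !ler_norml => /andP[? ?] /andP[? ?]; apply/andP; lra.
have I2 : `|seg_integral c d (fun y => B b y - B a y) - (m * (b - a)) * (d - c)|
    <= e * s * (d - c).
  apply: seg_integral_near => //.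
    by apply: continuous_segB; apply: (continuous_segW cc dd); apply: contB; lra.
  move=> y' yy'; have [_ H1] := near b y' ltac:(lra) yy'.
  have [_ H2] := near a y' ltac:(lra) yy'.
  by move: H1 H2; rewrite !ler_norml => /andP[? ?] /andP[? ?]; apply/andP; lra.
rewrite /circulation expr2 mulrA -/s {2}/s.
move: I1 I2; rewrite !ler_norml => /andP[? ?] /andP[? ?]; apply/andP; lra.
Qed.

(** Keeping the bounds inside the type turns bisection into a map of this type to itself, which
    [iter] can repeat. *)
Record subrectangle := Subrectangle { rl : R; rr : R; rb : R; rt : R;
  rlr : a0 <= rl /\ rl <= rr /\ rr <= b0;
  rbt : c0 <= rb /\ rb <= rt /\ rt <= d0 }.

Let circ (q : subrectangle) := circulation (rl q) (rr q) (rb q) (rt q).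

Lemma quarter_rectangle (q : subrectangle) : exists q' : subrectangle,
  [/\ rl q <= rl q', rr q' <= rr q, rb q <= rb q', rt q' <= rt q &
   [/\ rr q' - rl q' = (rr q - rl q) / 2, rt q' - rb q' = (rt q - rb q) / 2 &
     `|circ q| <= 4 * `|circ q'|] ].
Proof.
case: q => a b c d [aa [ab bb]] [cc [cd dd]]; rewrite /circ /=.
pose p := (a + b) / 2; pose q := (c + d) / 2.
have ap : a <= p by rewrite /p; lra.
have pb : p <= b by rewrite /p; lra.
have cq : c <= q by rewrite /q; lra.
have qd : q <= d by rewrite /q; lra.
have E : circulation a b c d = circulation a p c q + circulation a p q d +
    (circulation p b c q + circulation p b q d).
  by rewrite (@circulation_splitx a b c d p)// !(@circulation_splity _ _ c d q)//; lra.
have H1 : a0 <= a /\ a <= p /\ p <= b0 by lra.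
have H2 : a0 <= p /\ p <= b /\ b <= b0 by lra.
have H3 : c0 <= c /\ c <= q /\ q <= d0 by lra.
have H4 : c0 <= q /\ q <= d /\ d <= d0 by lra.
set s := circulation a b c d in E *.
have [K|K] := leP `|s| (4 * `|circulation a p c q|).
  by exists (Subrectangle H1 H3); split=> //=; split=> //; rewrite /p /q; lra.
have [K'|K'] := leP `|s| (4 * `|circulation a p q d|).
  by exists (Subrectangle H1 H4); split=> //=; split=> //; rewrite /p /q; lra.
have [K2|K2] := leP `|s| (4 * `|circulation p b c q|).
  by exists (Subrectangle H2 H3); split=> //=; split=> //; rewrite /p /q; lra.
have [K3|K3] := leP `|s| (4 * `|circulation p b q d|).
  by exists (Subrectangle H2 H4); split=> //=; split=> //; rewrite /p /q; lra.
have := ler_normD (circulation a p c q + circulation a p q d)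
  (circulation p b c q + circulation p b q d).
have := ler_normD (circulation a p c q) (circulation a p q d).
have := ler_normD (circulation p b c q) (circulation p b q d).
rewrite -E => ? ? ?; lra.
Qed.

Lemma nested_segments (u v : nat -> R) : (forall n, u n <= u n.+1) ->
  (forall n, v n.+1 <= v n) -> (forall n, u n <= v n) ->
  exists x, forall n, u n <= x <= v n.
Proof.
move=> ui vd uv.
have um : {homo u : m n / (m <= n)%N >-> m <= n} by exact/nondecreasing_seqP.
have vm m n : (m <= n)%N -> v n <= v m.
  by elim: n => [|n IH]; rewrite leq_eqVlt => /predU1P[->//|]//; rewrite ltnS => /IH; exact: le_trans.
have uvmn m n : u m <= v n.
  by apply: le_trans (le_trans (uv (maxn m n)) _); [apply/um/leq_maxl|apply/vm/leq_maxr].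
exists (sup (range u)) => n; apply/andP; split.
  apply: ub_le_sup; last by exists n.
  by exists (v 0%N) => _ [m _ <-].
apply: ge_sup; first by exists (u 0%N), 0%N.
by move=> _ [m _ <-].
Qed.

Theorem goursat : a0 <= b0 -> c0 <= d0 -> circulation a0 b0 c0 d0 = 0.
Proof.
move=> ab cd; apply/eqP; rewrite -normr_le0 leNgt; apply/negP => G0.
have [f fP] := choice quarter_rectangle.
have H1 : a0 <= a0 /\ a0 <= b0 /\ b0 <= b0 by [].
have H2 : c0 <= c0 /\ c0 <= d0 /\ d0 <= d0 by [].
pose q n := iter n f (Subrectangle H1 H2).
have [x xP] := @nested_segments (rl \o q) (rr \o q)
  (fun n => let: And5 h _ _ _ _ := fP (q n) in h)
  (fun n => let: And5 _ h _ _ _ := fP (q n) in h)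
  (fun n => (rlr (q n)).2.1).
have [y yP] := @nested_segments (rb \o q) (rt \o q)
  (fun n => let: And5 _ _ h _ _ := fP (q n) in h)
  (fun n => let: And5 _ _ _ h _ := fP (q n) in h)
  (fun n => (rbt (q n)).2.1).
have sz n : rr (q n) - rl (q n) = (b0 - a0) / 2 ^+ n /\
  rt (q n) - rb (q n) = (d0 - c0) / 2 ^+ n.
  elim: n => [|n [IH1 IH2]]; first by rewrite expr0 !divr1.
  have [_ _ _ _ [h1 h2 _]] := fP (q n).
  by rewrite /= h1 h2 IH1 IH2 exprS invfM; split; lra.

have big n : `|circ (q 0%N)| <= 4 ^+ n * `|circ (q n)|.
  elim: n => [|n IH]; first by rewrite expr0 mul1r.
  have [_ _ _ _ [_ _ h3]] := fP (q n).
  apply: le_trans IH _; rewrite exprSr -mulrA; apply: ler_wpM2l => //.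
set g := `|circulation a0 b0 c0 d0| in G0.
set s := b0 - a0 + (d0 - c0).
have s0 : 0 <= s by rewrite /s; lra.
(* The factor 4^n of bisection cancels the decrease of the squared size, leaving [g <= e * s ^+ 2].
   This [e] makes the right side at most [g / 2]; the [+ 1] covers the degenerate rectangle. *)
pose e := g / 2 / (s ^+ 2 + 1).
have s20 : 0 <= s ^+ 2 by rewrite exprn_ge0.
have e0 : 0 < e by rewrite /e divr_gt0//; lra.
have [r r0 rP] := @circulation_small x y e (xP 0%N) (yP 0%N) e0.
have [n nr] : exists n, s / 2 ^+ n < r.
  have : (fun n => s / 2 ^+ n) @ \oo --> (0 : R).
    by have := @cvg_geometric R s (2^-1); under eq_fun do rewrite /= -exprVn; apply;
      rewrite gtr0_norm; lra.
  by move=> /cvgr_lt /(_ _ r0)[n _ h]; exists n; apply: h => /=.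
have p2 : 0 < (2 : R) ^+ n by rewrite exprn_gt0.
have [s1 s2] := sz n.
have K : `|circ (q n)| <= e * (s / 2 ^+ n) ^+ 2.
  have := rP (rl (q n)) (rr (q n)) (rb (q n)) (rt (q n)) (rlr _).1 (rlr _).2.2 (rbt _).1
    (rbt _).2.2 (xP n) (yP n).
  rewrite s1 s2 -mulrDl; apply.
    by apply: le_lt_trans nr; rewrite ler_pM2r ?invr_gt0//; rewrite /s; lra.
  by apply: le_lt_trans nr; rewrite ler_pM2r ?invr_gt0//; rewrite /s; lra.
have := le_trans (big n) (ler_wpM2l (exprn_ge0 n (ler0n R 4)) K).
have -> : 4 ^+ n * (e * (s / 2 ^+ n) ^+ 2) = e * s ^+ 2.
  have -> : (4 : R) ^+ n = 2 ^+ n * 2 ^+ n by rewrite -exprMn; congr (_ ^+ _); ring.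
  by field; lra.
have -> : e * s ^+ 2 = g / 2 * (s ^+ 2 / (s ^+ 2 + 1)) by rewrite /e; field; lra.
have : s ^+ 2 / (s ^+ 2 + 1) <= 1 by rewrite ler_pdivrMr; lra.
have : 0 <= s ^+ 2 / (s ^+ 2 + 1) by apply: divr_ge0; lra.
set z := _ / _ => z0 z1; change (g <= g / 2 * z -> False) => h.
by have := ler_wpM2l (ltW G0) z1; lra.
Qed.

End Goursat.

(** * Holomorphic functions of one variable *)

Section ComplexModulus.
Variable R : realType.
Local Notation C := (complex_field R).
Implicit Types (z w : C) (x y : R).

Definition rc x : C := Complex x 0.
Definition re z : R := complex.Re z.
Definition im z : R := complex.Im z.
(** The norm of [complex_field R] takes values in the field itself; its real part allows estimates
    in [R], where [lra] applies. *)
Definition nrm z : R := re `|z|.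

Lemma rcD x y : rc (x + y) = rc x + rc y.
Proof. exact: (rmorphD (real_complex R)). Qed.
Lemma rcB x y : rc (x - y) = rc x - rc y.
Proof. exact: (rmorphB (real_complex R)). Qed.
Lemma rcM x y : rc (x * y) = rc x * rc y.
Proof. exact: (rmorphM (real_complex R)). Qed.
Lemma rcX x n : rc (x ^+ n) = rc x ^+ n.
Proof. exact: (rmorphXn (real_complex R)). Qed.
Lemma rcV x : rc x^-1 = (rc x)^-1.
Proof. exact: (fmorphV (real_complex R)). Qed.
Lemma rc0 : rc 0 = 0. Proof. by []. Qed.
Lemma rc1 : rc 1 = 1. Proof. by []. Qed.
Lemma rc_sum I (r : seq I) (P : pred I) (f : I -> R) :
  rc (\sum_(i <- r | P i) f i) = \sum_(i <- r | P i) rc (f i).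
Proof. exact: (rmorph_sum (real_complex R)). Qed.
Lemma rc_inj : injective rc. Proof. by move=> x y []. Qed.
Lemma rc_le x y : (rc x <= rc y) = (x <= y). Proof. exact: lecR. Qed.
Lemma rc_lt x y : (rc x < rc y) = (x < y). Proof. exact: ltcR. Qed.
Lemma norm_rc z : `|z| = rc (nrm z).
Proof. by rewrite /nrm normc_def. Qed.

Lemma gt0_rc z : 0 < z -> exists2 x, 0 < x & z = rc x.
Proof.
case: z => a b; rewrite ltcE /= => /andP[/eqP -> a0]; by exists a.
Qed.

Lemma reD z w : re (z + w) = re z + re w. Proof. by case: z; case: w. Qed.
Lemma imD z w : im (z + w) = im z + im w. Proof. by case: z; case: w. Qed.
Lemma reN z : re (- z) = - re z. Proof. by case: z. Qed.
Lemma imN z : im (- z) = - im z. Proof. by case: z. Qed.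
Lemma reB z w : re (z - w) = re z - re w. Proof. by rewrite reD reN. Qed.
Lemma imB z w : im (z - w) = im z - im w. Proof. by rewrite imD imN. Qed.
Lemma reM z w : re (z * w) = re z * re w - im z * im w. Proof. by case: z; case: w. Qed.
Lemma imM z w : im (z * w) = re z * im w + im z * re w. Proof. by case: z; case: w. Qed.
Lemma re_im_eq z w : re z = re w -> im z = im w -> z = w.
Proof. by case: z => a b; case: w => c d /= -> ->. Qed.
Lemma complex_re_im z : z = rc (re z) + Complex 0 1 * rc (im z).
Proof. by apply: re_im_eq; rewrite ?reD ?reM ?imD ?imM /=; ring. Qed.

Lemma nrm_ge0 z : 0 <= nrm z.
Proof. by rewrite -rc_le -norm_rc normr_ge0. Qed.
Lemma nrmM z w : nrm (z * w) = nrm z * nrm w.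
Proof. by apply: rc_inj; rewrite rcM -!norm_rc normrM. Qed.
Lemma nrmX z n : nrm (z ^+ n) = nrm z ^+ n.
Proof. by apply: rc_inj; rewrite rcX -!norm_rc normrX. Qed.
Lemma nrmV z : nrm z^-1 = (nrm z)^-1.
Proof. by apply: rc_inj; rewrite rcV -!norm_rc normfV. Qed.
Lemma nrmD z w : nrm (z + w) <= nrm z + nrm w.
Proof. by rewrite -rc_le rcD -!norm_rc ler_normD. Qed.
Lemma nrmN z : nrm (- z) = nrm z.
Proof. by apply: rc_inj; rewrite -!norm_rc normrN. Qed.
Lemma nrmB z w : nrm (z - w) <= nrm z + nrm w.
Proof. by rewrite -[nrm w]nrmN nrmD. Qed.
Lemma nrmC z w : nrm (z - w) = nrm (w - z).
Proof. by rewrite -nrmN opprB. Qed.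
Lemma nrm_triangle u z w : nrm (z - w) <= nrm (z - u) + nrm (u - w).
Proof. by apply: le_trans (nrmD _ _); rewrite addrA subrK. Qed.
Lemma nrm_rc x : nrm (rc x) = `|x|.
Proof. by apply: rc_inj; rewrite -norm_rc normc_def /= expr0n addr0 sqrtr_sqr. Qed.
Lemma nrm0 : nrm 0 = 0. Proof. by rewrite -rc0 nrm_rc normr0. Qed.
Lemma nrm1 : nrm 1 = 1. Proof. by rewrite -rc1 nrm_rc normr1. Qed.
Lemma nrm_eq0 z : (nrm z == 0) = (z == 0).
Proof. by rewrite -(inj_eq rc_inj) -norm_rc normr_eq0. Qed.
Lemma nrm_gt0 z : (0 < nrm z) = (z != 0).
Proof. by rewrite lt_def nrm_eq0 nrm_ge0 andbT. Qed.
Lemma sqr_nrm z : nrm z ^+ 2 = re z ^+ 2 + im z ^+ 2.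
Proof. by rewrite /nrm normc_def /= sqr_sqrtr// addr_ge0 ?sqr_ge0. Qed.
Lemma nrm_re z : `|re z| <= nrm z.
Proof. by rewrite -rc_le -norm_rc normc_ge_Re. Qed.
Lemma nrm_im z : `|im z| <= nrm z.
Proof.
rewrite -(ler_pXn2r (n := 2))// ?nnegrE ?normr_ge0 ?nrm_ge0// sqr_nrm real_normK ?num_real//.
by rewrite lerDr sqr_ge0.
Qed.
Lemma nrm_i : nrm (Complex 0 1) = 1.
Proof. by rewrite /nrm normc_def /= expr0n /= expr1n add0r sqrtr1. Qed.
Lemma nrm_le_reim z : nrm z <= `|re z| + `|im z|.
Proof.
rewrite {1}(complex_re_im z); apply: le_trans (nrmD _ _) _.
by rewrite nrmM nrm_i mul1r !nrm_rc.
Qed.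

Lemma nbhs_nrmP z (P : set C) :
  nbhs z P <-> exists2 r : R, 0 < r & forall w, nrm (w - z) < r -> P w.
Proof.
split => [/nbhs_ballP[e /= e0 zP]|[r r0 rP]]; last apply/nbhs_ballP.
  have [r r0 er] := gt0_rc e0; exists r => // w wr; apply: zP.
  by rewrite /ball /= er distrC norm_rc rc_lt.
exists (rc r); first by rewrite /= rc_lt.
by move=> w; rewrite /ball /= distrC norm_rc rc_lt; exact: rP.
Qed.

Lemma cvg_nrmP T (F : set_system T) {FF : Filter F} (f : T -> C) l :
  f x @[x --> F] --> l <-> forall e : R, 0 < e -> \forall x \near F, nrm (f x - l) < e.
Proof.
split => [fl e e0|H].
  have /fl : nbhs l [set w | nrm (w - l) < e] by apply/nbhs_nrmP; exists e.
  by [].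
by move=> P /nbhs_nrmP[r r0 rP]; near=> x; apply: rP; near: x; exact: H.
Unshelve. all: by end_near. Qed.

(** The form without a quotient includes [h = 0], so increments that may vanish can be substituted
    for [h]. *)
Lemma derivable_nrmP (f : C -> C) z d :
  (derivable f z 1 /\ derive1 f z = d) <->
  forall e : R, 0 < e -> exists2 r : R, 0 < r &
    forall h, nrm h < r -> nrm (f (z + h) - f z - d * h) <= e * nrm h.
Proof.
have -> : derivable f z 1 = cvg ((fun h : C => h^-1 *: (f (h + z) - f z)) @ 0^').
  by rewrite /derivable; under eq_fun do rewrite /= [_%:A]mulr1.
have E : (cvg ((fun h : C => h^-1 *: (f (h + z) - f z)) @ 0^') /\ derive1 f z = d) <->
   (fun h : C => h^-1 *: (f (h + z) - f z)) @ 0^' --> d.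
  split => [[c <-]//|c]; split; first by apply/cvg_ex; exists d.
  by rewrite /derive1; apply: cvg_lim.
rewrite E; split => [|H]; first move=> /cvg_nrmP H e e0.
  have := H e e0; rewrite /dnbhs /within /= => /nbhs_nrmP[r r0 rP].
  exists r => // h hr; have [->|h0] := eqVneq h 0.
    by rewrite addr0 mulr0 subrr subr0 nrm0 mulr0.
  have := rP h; rewrite subr0 => /(_ hr h0) K.
  have -> : f (z + h) - f z - d * h = (h^-1 *: (f (h + z) - f z) - d) * h.
    rewrite mulrBl; congr (_ - _); rewrite /GRing.scale /= mulrAC mulVf// mul1r.
    by rewrite addrC addrC (addrC h).
  by rewrite nrmM ler_wpM2r ?nrm_ge0// ltW.
apply/cvg_nrmP => e e0; have e2 : 0 < e / 2 by lra.
have [r r0 rP] := H _ e2; rewrite /dnbhs /within /=; apply/nbhs_nrmP; exists r => // h.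
rewrite subr0 => hr h0.
have -> : h^-1 *: (f (h + z) - f z) - d = h^-1 * (f (z + h) - f z - d * h).
  by rewrite mulrBr mulrCA mulVf// mulr1 (addrC h).
rewrite nrmM nrmV ltr_pdivrMl ?nrm_gt0//; apply: le_lt_trans (rP _ hr) _.
by rewrite mulrC ltr_pM2l ?nrm_gt0//; lra.
Qed.

Lemma continuous_nrmP (f : C -> C) z : {for z, continuous f} <->
  forall e : R, 0 < e -> exists2 r : R, 0 < r &
    forall w, nrm (w - z) < r -> nrm (f w - f z) < e.
Proof.
have E := @cvg_nrmP C (nbhs z) (nbhs_filter z) f (f z); split => [/E.1 H e e0|H].
  by apply/nbhs_nrmP; exact: H.
by apply/E => e e0; apply/nbhs_nrmP; exact: H.
Qed.

End ComplexModulus.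

(** * Polar coordinates and the mean value property *)

Section PolarCoordinates.
Variable R : realType.
Local Notation C := (complex_field R).
Implicit Types (z w : C) (x y : R) (f g : R -> R -> C).

Definition unit_circle y : C := Complex (cos y) (sin y).

Lemma nrm_unit_circle y : nrm (unit_circle y) = 1.
Proof. by rewrite /nrm normc_def /= cos2Dsin2 sqrtr1. Qed.

Lemma unit_circle_periodic : unit_circle (2 * pi) = unit_circle 0.
Proof.
have -> : 2 * pi = (pi : R) *+ 2 by rewrite mulr2n; ring.
by rewrite /unit_circle cos2pi sin2pi cos0 sin0.
Qed.

(* Total differentiability at (x, y), with partial derivatives l and m. *)
Definition diff2 f x y (l m : C) := forall e : R, 0 < e -> exists2 r : R, 0 < r &
  forall dx dy, `|dx| + `|dy| < r ->
    nrm (f (x + dx) (y + dy) - f x y - (l * rc dx + m * rc dy)) <= e * (`|dx| + `|dy|).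

Lemma diff2_lipschitz f x y l m : diff2 f x y l m ->
  exists2 K : R, 0 < K & exists2 r : R, 0 < r & forall dx dy, `|dx| + `|dy| < r ->
    nrm (f (x + dx) (y + dy) - f x y) <= K * (`|dx| + `|dy|).
Proof.
move=> /(_ 1 ltr01) [r r0 H]; exists (1 + nrm l + nrm m).
  by have := nrm_ge0 l; have := nrm_ge0 m; lra.
exists r => // dx dy /H K.
set d := f _ _ - _ in K *; have -> : d = d - (l * rc dx + m * rc dy) + (l * rc dx + m * rc dy).
  by rewrite subrK.
apply: le_trans (nrmD _ _) _.
have := nrmD (l * rc dx) (m * rc dy); rewrite !nrmM !nrm_rc => K2.
have l1 : nrm l * `|dx| <= nrm l * (`|dx| + `|dy|).
  by rewrite ler_wpM2l ?nrm_ge0// lerDl.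
have l2 : nrm m * `|dy| <= nrm m * (`|dx| + `|dy|).
  by rewrite ler_wpM2l ?nrm_ge0// lerDr.
lra.
Qed.

Lemma diff2_cont f x y l m : diff2 f x y l m -> forall e : R, 0 < e ->
  exists2 r : R, 0 < r & forall dx dy, `|dx| + `|dy| < r ->
    nrm (f (x + dx) (y + dy) - f x y) < e.
Proof.
move=> /diff2_lipschitz[K K0 [r r0 H]] e e0; exists (Num.min r (e / K)).
  by rewrite lt_min r0 divr_gt0.
move=> dx dy; rewrite lt_min => /andP[/H h s]; apply: le_lt_trans h _.
by rewrite mulrC -ltr_pdivlMr.
Qed.

Lemma diff2_cst c x y : diff2 (fun _ _ => c) x y 0 0.
Proof.
move=> e e0; exists 1 => // dx dy _; rewrite subrr !mul0r addr0 subr0 nrm0.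
by rewrite mulr_ge0 ?addr_ge0// ltW.
Qed.

Lemma diff2_eq f g x y l m l' m' : diff2 f x y l m ->
  (forall a b, f a b = g a b) -> l = l' -> m = m' -> diff2 g x y l' m'.
Proof.
move=> H fg <- <- e e0; have [r r0 {}H] := H e e0.
by exists r => // dx dy; rewrite -!fg; exact: H.
Qed.

Lemma diff2D f g x y l m l' m' : diff2 f x y l m -> diff2 g x y l' m' ->
  diff2 (fun a b => f a b + g a b) x y (l + l') (m + m').
Proof.
move=> Hf Hg e e0; have e2 : 0 < e / 2 by lra.
have [r r0 {}Hf] := Hf _ e2; have [s s0 {}Hg] := Hg _ e2.
exists (Num.min r s); first by rewrite lt_min r0.
move=> dx dy; rewrite lt_min => /andP[/Hf h1 /Hg h2].
set a := _ - (_ + _) in h1; set b := _ - (_ + _) in h2.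
rewrite (_ : _ - _ = a + b); last by rewrite /a /b; ring.
by apply: le_trans (nrmD _ _) _; lra.
Qed.

Lemma diff2M f g x y l m l' m' : diff2 f x y l m -> diff2 g x y l' m' ->
  diff2 (fun a b => f a b * g a b) x y (l * g x y + f x y * l') (m * g x y + f x y * m').
Proof.
move=> Hf Hg e e0.
have [K K0 [t t0 Lf]] := diff2_lipschitz Hf.
pose N := nrm (f x y) + nrm (g x y) + 1.
have f0 := nrm_ge0 (f x y); have g0 := nrm_ge0 (g x y).
have N0 : 0 < N by rewrite /N; lra.
have eN : 0 < e / 3 / N by rewrite divr_gt0//; lra.
have [r r0 {}Hf] := Hf _ eN.
have eK : 0 < e / 3 / K by rewrite divr_gt0//; lra.
have [u u0 Cg] := diff2_cont Hg eK.
have [s s0 {}Hg] := Hg _ eN.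
exists (Num.min (Num.min r s) (Num.min t u)); first by rewrite !lt_min r0 s0 t0.
move=> dx dy; rewrite !lt_min => /andP[/andP[/Hf h1 /Hg h2] /andP[/Lf h3 /Cg h4]].
set a := _ - (_ + _) in h1; set b := _ - (_ + _) in h2.
set c := _ - _ in h3; set d := _ - _ in h4.
(* Two linearization errors weighted by the values, and the product of the increments, in which [c]
   is Lipschitz and [d] is small. Each receives a third of [e]. *)
rewrite (_ : _ - _ = a * g x y + f x y * b + c * d); last by rewrite /a /b /c /d; ring.
set D := `|dx| + `|dy| in h1 h2 h3 *; have D0 : 0 <= D by rewrite addr_ge0.
apply: le_trans (nrmD _ _) _; rewrite nrmM.
have k3 : nrm c * nrm d <= e / 3 * D.
  have -> : e / 3 * D = K * D * (e / 3 / K) by field; lra.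
  by apply: ler_pM; rewrite ?nrm_ge0// ltW.
have k : e / 3 / N * D * N = e / 3 * D by field; lra.
have k0 : 0 <= e / 3 / N * D by rewrite mulr_ge0// ltW.
have k1 : nrm a * nrm (g x y) + nrm (f x y) * nrm b <= e / 3 * D.
  set T := _ * D in h1 h2 k k0; rewrite -k.
  have -> : T * N = T * nrm (f x y) + T * nrm (g x y) + T by rewrite {1}/N; ring.
  have := ler_wpM2r g0 h1; have := ler_wpM2r f0 h2.
  by rewrite [nrm (f x y) * _]mulrC => ? ?; lra.
have := nrmD (a * g x y) (f x y * b); rewrite !nrmM => k4.
by have := mulr_ge0 (ltW e0) D0; lra.
Qed.

Lemma diff2_comp (h : C -> C) f x y l m d :
  derivable h (f x y) 1 /\ derive1 h (f x y) = d -> diff2 f x y l m ->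
  diff2 (fun a b => h (f a b)) x y (d * l) (d * m).
Proof.
move=> /derivable_nrmP Hh Hf e e0.
have [K K0 [t t0 Lf]] := diff2_lipschitz Hf.
have d0 := nrm_ge0 d.
have ed : 0 < e / 2 / (nrm d + 1) by rewrite divr_gt0//; lra.
have eK : 0 < e / 2 / K by rewrite divr_gt0//; lra.
have [r r0 {}Hh] := Hh _ eK.
have [u u0 Cf] := diff2_cont Hf r0.
have [s s0 {}Hf] := Hf _ ed.
exists (Num.min s (Num.min t u)); first by rewrite !lt_min s0 t0.
move=> dx dy; rewrite !lt_min => /andP[/Hf h2 /andP[/Lf h3 /Cf/Hh]].
set a := _ - (_ + _) in h2; set c := _ - f x y in h3 *.
have -> : f x y + c = f (x + dx) (y + dy) by rewrite /c; ring.
set b := _ - _ * c => h4.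
rewrite (_ : _ - _ = b + d * a); last by rewrite /a /b /c; ring.
set D := `|dx| + `|dy| in h2 h3 *; have D0 : 0 <= D by rewrite addr_ge0.
apply: le_trans (nrmD _ _) _; rewrite nrmM.
have k1 : e / 2 / K * nrm c <= e / 2 * D.
  rewrite -[e / 2 * D](_ : e / 2 / K * (K * D) = _); last by field; lra.
  by rewrite ler_wpM2l// ltW.
have k2 : nrm d * nrm a <= e / 2 * D.
  have := ler_wpM2l d0 h2; set q := e / 2 / (nrm d + 1) => k2.
  have : q * (nrm d + 1) = e / 2 by rewrite /q; field; lra.
  have := mulr_ge0 (ltW ed) D0; rewrite -/q => ? E; rewrite -E; lra.
lra.
Qed.

Lemma is_derive_eps (f : R -> R) x d : is_derive x (1 : R) f d ->
  forall e : R, 0 < e -> exists2 r : R, 0 < r & forall h, `|h| < r ->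
    `|f (x + h) - f x - d * h| <= e * `|h|.
Proof.
move=> [df dfE] e e0.
have : (fun h : R => h^-1 *: ((f \o shift x) (h *: (1 : R)) - f x)) @ 0^' --> d.
  by rewrite -dfE; exact: df.
move=> /cvgrPdist_le /(_ _ e0); rewrite /dnbhs /within /= => -[r /= r0 H].
exists r => // h hr; have [->|h0] := eqVneq h 0.
  by rewrite addr0 mulr0 subrr subr0 normr0 mulr0.
have := H h; rewrite /ball/= sub0r normrN => /(_ hr h0).
rewrite /= [_%:A]mulr1 (addrC h x) => K.
have -> : f (x + h) - f x - d * h = - ((d - h^-1 *: (f (x + h) - f x)) * h).
  by rewrite mulrBl /GRing.scale /= mulrAC mulVf// mul1r opprB.
by rewrite normrN normrM ler_wpM2r.
Qed.

Lemma diff2_x (f : R -> R) x y d : is_derive x (1 : R) f d ->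
  diff2 (fun a _ => rc (f a)) x y (rc d) 0.
Proof.
move=> H e e0; have [r r0 {}H] := is_derive_eps H e0; exists r => // dx dy xy.
have dy0 := normr_ge0 dy.
have := H dx ltac:(lra); rewrite mul0r addr0 -rcM -!rcB nrm_rc => K.
by apply: le_trans K _; rewrite ler_wpM2l ?lerDl// ltW.
Qed.

Lemma diff2_y (f : R -> R) x y d : is_derive y (1 : R) f d ->
  diff2 (fun _ b => rc (f b)) x y 0 (rc d).
Proof.
move=> H e e0; have [r r0 {}H] := is_derive_eps H e0; exists r => // dx dy xy.
have dy0 := normr_ge0 dx.
have := H dy ltac:(lra); rewrite mul0r add0r -rcM -!rcB nrm_rc => K.
by apply: le_trans K _; rewrite ler_wpM2l ?lerDr// ltW.
Qed.

Lemma diff2_polar x y : diff2 (fun a b => rc a * unit_circle b) x y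
  (unit_circle y) (rc x * (Complex 0 1 * unit_circle y)).
Proof.
have E a : unit_circle a = rc (cos a) + Complex 0 1 * rc (sin a) by exact: complex_re_im (unit_circle a).
have H : diff2 (fun _ b => unit_circle b) x y 0 (Complex 0 1 * unit_circle y).
  have := diff2D (@diff2_y (@cos R) x y _ (is_derive_cos y))
    (diff2M (diff2_cst (Complex 0 1) x y) (@diff2_y (@sin R) x y _ (is_derive_sin y))).
  move=> H; apply: (diff2_eq H) => [a b||].
  - by rewrite E.
  - by apply: re_im_eq; rewrite ?reD ?imD ?reM ?imM /=; ring.
  - by apply: re_im_eq; rewrite ?reD ?imD ?reM ?imM /=; ring.
have := diff2M (diff2_x y (is_derive_id x (1 : R))) H.
by rewrite rc1 mul1r mulr0 mul0r addr0 add0r.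
Qed.

(** One complex number [d] governs both partial derivatives: these are the Cauchy-Riemann equations
    in polar form, the [y]-derivative being i x times the [x]-derivative. *)
Lemma diff2_polar_comp (h : C -> C) x y : derivable h (rc x * unit_circle y) 1 ->
  exists d : C, diff2 (fun a b => h (rc a * unit_circle b)) x y
  (d * unit_circle y) (d * (rc x * (Complex 0 1 * unit_circle y))).
Proof.
move=> dh; exists (derive1 h (rc x * unit_circle y)).
exact: (@diff2_comp h (fun a b => rc a * unit_circle b) _ _ _ _ _ (conj dh erefl) (diff2_polar x y)).
Qed.

Lemma diff2_re_closed (A B : R -> R -> R) f g x y l m n p q :
  (forall a b, A a b = im (f a b)) -> (forall a b, B a b = re (g a b)) ->
  diff2 f x y l m -> diff2 g x y p q -> im m = n -> re p = n ->
  exists l m n : R, forall e, 0 < e -> exists2 r : R, 0 < r &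
    forall x' y', `|x' - x| < r -> `|y' - y| < r ->
      `|A x' y' - A x y - (l * (x' - x) + m * (y' - y))| <= e * (`|x' - x| + `|y' - y|) /\
      `|B x' y' - B x y - (m * (x' - x) + n * (y' - y))| <= e * (`|x' - x| + `|y' - y|).
Proof.
move=> Af Bg Hf Hg mn pn; exists (im l), n, (re q) => e e0.
have [r r0 {}Hf] := Hf e e0; have [s s0 {}Hg] := Hg e e0.
exists (Num.min (r / 2) (s / 2)); first by rewrite lt_min; apply/andP; split; lra.
move=> x' y'; rewrite !lt_min => /andP[xr xs] /andP[yr ys].
have [Ex Ey] : x + (x' - x) = x' /\ y + (y' - y) = y' by split; ring.
have := Hf (x' - x) (y' - y) ltac:(lra); have := Hg (x' - x) (y' - y) ltac:(lra).
rewrite Ex Ey => h1 h2; split.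
  apply: le_trans h2; apply: le_trans (nrm_im _); rewrite !imB imD !imM /= !Af mn.
  by rewrite !mulr0 !add0r.
apply: le_trans h1; apply: le_trans (nrm_re _); rewrite !reB reD !reM /= !Bg pn.
by rewrite !mulr0 !subr0.
Qed.

Lemma diff2_continuous_x f x y l m : diff2 f x y l m -> {for x, continuous (f ^~ y)}.
Proof.
move=> H; apply/(@cvg_nrmP R R (nbhs x) _ (f ^~ y)) => e e0.
have [r r0 {}H] := diff2_cont H e0; exists r => //= x' xx'.
have := H (x' - x) 0; rewrite normr0 !addr0 subrKC; apply.
by rewrite distrC.
Qed.

Lemma diff2_continuous_y f x y l m : diff2 f x y l m -> {for y, continuous (f x)}.
Proof.
move=> H; apply/(@cvg_nrmP R R (nbhs y) _ (f x)) => e e0.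
have [r r0 {}H] := diff2_cont H e0; exists r => //= x' xx'.
have := H 0 (x' - y); rewrite normr0 add0r !addr0 subrKC; apply.
by rewrite distrC.
Qed.

Lemma continuous_re (f : R -> C) x : {for x, continuous f} -> {for x, continuous (fun t => re (f t))}.
Proof.
move=> /(@cvg_nrmP R R (nbhs x) _ f (f x)) H; apply/cvgrPdist_lt => e e0.
apply: filterS (H _ e0) => y; apply: le_lt_trans; rewrite distrC /= -reB.
exact: nrm_re.
Qed.

Lemma continuous_im (f : R -> C) x : {for x, continuous f} -> {for x, continuous (fun t => im (f t))}.
Proof.
move=> /(@cvg_nrmP R R (nbhs x) _ f (f x)) H; apply/cvgrPdist_lt => e e0.
apply: filterS (H _ e0) => y; apply: le_lt_trans; rewrite distrC /= -imB.
exact: nrm_im.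
Qed.

Lemma continuous_at_seg a b (f : R -> R) :
  (forall x, a <= x <= b -> {for x, continuous f}) -> continuous_seg a b f.
Proof.
move=> H; apply: continuous_in_subspaceT => x; rewrite inE /= in_itv /=; exact: H.
Qed.

Definition circle_mean (u : R -> R) := seg_integral 0 (2 * pi) u / (2 * pi).

Section MeanValue.
Variables (h : C -> C) (rho : R).
Hypothesis dh : forall z, 0 < nrm z < rho -> derivable h z 1.

Let polar x y := rc x * unit_circle y.

Lemma nrm_polar x y : 0 <= x -> nrm (polar x y) = x.
Proof. by move=> x0; rewrite nrmM nrm_unit_circle mulr1 nrm_rc ger0_norm. Qed.

(** With z = x e^(iy) one has dz/z = dx/x + i dy, so Im (h dz/z) = Im(h)/x dx + Re(h) dy. The form
    is closed on the rectangle [[s, r]] times [[0, 2 * pi]], and the circulation is the difference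
    of the two means up to the factor 2 pi. *)
Lemma circle_mean_const s r : 0 < s -> s <= r -> r < rho ->
  circle_mean (fun y => re (h (polar r y))) = circle_mean (fun y => re (h (polar s y))).
Proof.
move=> s0 sr rrho.
have p0 : 0 < (pi : R) by exact: pi_gt0.
pose hx a b := h (polar a b) * rc (a^-1).
have dpol x y : s <= x <= r -> exists d : C,
    diff2 (fun a b => h (polar a b)) x y (d * unit_circle y) (d * (rc x * (Complex 0 1 * unit_circle y))) /\
    diff2 hx x y ((d * unit_circle y) / rc x + h (polar x y) * rc (- x ^- 2)) (Complex 0 1 * d * unit_circle y).
  move=> xsr; have x0 : x != 0 by apply: lt0r_neq0; lra.
  have /diff2_polar_comp[d Hd] : derivable h (rc x * unit_circle y) 1.
    by apply: dh; rewrite nrm_polar; lra.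
  exists d; split=> //; have dV : is_derive x (1 : R) (fun x : R => x^-1) (- x ^- 2).
    by have := @is_deriveV R id x 1 1 x0 (is_derive_id x (1 : R)); rewrite [_ *: _]mulr1.
  have := diff2M Hd (diff2_x y dV).
  rewrite mulr0 addr0 rcV => H.
  have E : d * (rc x * (Complex 0 1 * unit_circle y)) / rc x = Complex 0 1 * d * unit_circle y.
    have rx0 : rc x != 0 by rewrite -(inj_eq (@rc_inj R)) in x0.
    by field.
  by rewrite -E.
pose A a b := im (hx a b); pose B a b := re (h (polar a b)).
have cA y : 0 <= y <= 2 * pi -> continuous_seg s r (A ^~ y).
  move=> _; apply: continuous_at_seg => x /(dpol x y)[d [_ H]].
  exact: (continuous_im (diff2_continuous_x H)).
have cB x : s <= x <= r -> continuous_seg 0 (2 * pi) (B x).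
  move=> xsr; apply: continuous_at_seg => y _; have [d [H _]] := dpol x y xsr.
  exact: (continuous_re (diff2_continuous_y H)).
have := @goursat R A B s r 0 (2 * pi) cA cB; rewrite /circulation.
(* The sides y = 0 and y = 2 pi lie over the same segment of the plane and cancel. *)
have -> : (fun x => A x 0 - A x (2 * pi)) = fun=> 0.
  by apply/funext => x; rewrite /A /hx /polar unit_circle_periodic subrr.
rewrite seg_integral_cst// mul0r add0r seg_integralB; try (by apply: cB; lra).
move=> G; rewrite /circle_mean; congr (_ * _); apply/eqP; rewrite -subr_eq0; apply/eqP; apply: G; [|lra|lra].
move=> x y xsr _; have [d [H1 H2]] := dpol x y xsr.
have [||l [m [n H]]] := @diff2_re_closed A B hx (fun a b => h (polar a b)) x y _ _
  (re (d * unit_circle y)) _ _ (fun _ _ => erefl) (fun _ _ => erefl) H2 H1.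
- by rewrite -mulrA imM /=; ring.
- by [].
exists l, m, n => e e0; have [t t0 {}H] := H e e0; exists t => // x' y' _ _; exact: H.
Qed.

Lemma continuous_seg_polar r : 0 < r -> r < rho ->
  continuous_seg 0 (2 * pi) (fun y => re (h (polar r y))).
Proof.
move=> r0 rr; apply: continuous_at_seg => y _.
have /diff2_polar_comp[d Hd] : derivable h (rc r * unit_circle y) 1.
  by apply: dh; rewrite nrm_polar; lra.
exact: (continuous_re (diff2_continuous_y Hd)).
Qed.

(* Integrating the closed form Im (h dz / z) over a thin annulus shows that the
   mean over |z| = r does not depend on r; no differentiability at 0 is needed. *)
Theorem mean_value r : {for 0, continuous h} -> 0 < r -> r < rho ->
  circle_mean (fun y => re (h (rc r * unit_circle y))) = re (h 0).
Proof.
move=> /continuous_nrmP h0 r0 rr.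
have p0 : 0 < (pi : R) by exact: pi_gt0.
apply/eqP; rewrite -subr_eq0 -normr_le0 leNgt; apply/negP => e0.
set e := `|_| in e0; have e2 : 0 < e / 2 by lra.
have [t t0 H] := h0 _ e2.
(* On this smaller circle [h] stays within [e / 2] of [h 0], while the mean, which is unchanged,
   would be at distance [e]. *)
pose s := Num.min r (t / 2).
have s0 : 0 < s by rewrite lt_min r0/=; lra.
have sr : s <= r by rewrite ge_min lexx.
have st : s < t by rewrite gt_min; apply/orP; right; lra.
suff : e <= e / 2 by lra.
rewrite {1}/e (circle_mean_const s0 sr rr).
set m := circle_mean _; have -> : m - re (h 0) =
    (seg_integral 0 (2 * pi) (fun y => re (h (polar s y))) - re (h 0) * (2 * pi - 0)) / (2 * pi).
  rewrite /m /circle_mean subr0 mulrBl mulfK//.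
  by apply: lt0r_neq0; lra.
rewrite normrM normfV (gtr0_norm (x := 2 * pi)); last lra.
rewrite ler_pdivrMr; last lra.
rewrite -[2 * pi in leRHS]subr0; apply: seg_integral_near; first lra.
  by apply: continuous_seg_polar => //; lra.
move=> y _; rewrite -reB; apply: le_trans (nrm_re _) _; apply/ltW/H.
by rewrite subr0 nrm_polar// ltW.
Qed.

End MeanValue.
End PolarCoordinates.

(** * Circle means, a Cauchy formula for the derivative, a mean value inequality *)

Section HolomorphicDerivative.
Variable R : realType.
Local Notation C := (complex_field R).
Local Notation e_ := (@unit_circle R).
Implicit Types (z w d : C) (f h : C -> C) (phi psi : R -> C).

Lemma circle_mean_le (u v : R -> R) : (forall y, {for y, continuous u}) ->
  (forall y, {for y, continuous v}) -> (forall y, 0 <= y <= 2 * pi -> u y <= v y) ->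
  circle_mean u <= circle_mean v.
Proof.
move=> cu cv uv; have p0 : 0 < (pi : R) by exact: pi_gt0.
rewrite /circle_mean ler_pM2r ?invr_gt0; last lra.
by apply: seg_integral_le => //; apply: continuous_at_seg.
Qed.

Lemma circle_mean_cst (c : R) : circle_mean (fun=> c) = c.
Proof.
have p0 : 0 < (pi : R) by exact: pi_gt0.
rewrite /circle_mean seg_integral_cst; last lra.
by rewrite subr0 mulfK//; apply: lt0r_neq0; lra.
Qed.

Lemma circle_meanB (u v : R -> R) : (forall y, {for y, continuous u}) ->
  (forall y, {for y, continuous v}) ->
  circle_mean (fun y => u y - v y) = circle_mean u - circle_mean v.
Proof.
move=> cu cv; rewrite /circle_mean -mulrBl -seg_integralB//.
  by apply: continuous_at_seg.
by apply: continuous_at_seg.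
Qed.

Lemma circle_meanZ (u : R -> R) (c : R) : (forall y, {for y, continuous u}) ->
  circle_mean (fun y => u y * c) = circle_mean u * c.
Proof.
move=> cu; rewrite /circle_mean mulrAC; congr (_ / _).
rewrite /seg_integral RintegralZr//; apply: continuous_seg_integrable.
exact: continuous_at_seg.
Qed.

Definition complex_mean phi : C :=
  Complex (circle_mean (fun y => re (phi y))) (circle_mean (fun y => im (phi y))).

Definition ccont phi := forall y, {for y, continuous phi}.

Lemma ccontB phi psi : ccont phi -> ccont psi -> ccont (fun y => phi y - psi y).
Proof. by move=> c1 c2 y; apply: continuousB; [exact: c1|exact: c2]. Qed.

Lemma ccontM phi psi : ccont phi -> ccont psi -> ccont (fun y => phi y * psi y).
Proof. by move=> c1 c2 y; apply: continuousM; [exact: c1|exact: c2]. Qed.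

Lemma complex_meanB phi psi : ccont phi -> ccont psi ->
  complex_mean (fun y => phi y - psi y) = complex_mean phi - complex_mean psi.
Proof.
move=> c1 c2; apply: re_im_eq; rewrite ?reB ?imB /=.
  have <- := circle_meanB (fun y => continuous_re (c1 y)) (fun y => continuous_re (c2 y)).
  by congr circle_mean; apply/funext => y; rewrite reB.
have <- := circle_meanB (fun y => continuous_im (c1 y)) (fun y => continuous_im (c2 y)).
by congr circle_mean; apply/funext => y; rewrite imB.
Qed.

Lemma complex_meanZ phi c : ccont phi ->
  complex_mean (fun y => phi y * c) = complex_mean phi * c.
Proof.
move=> c1; have cr y := continuous_re (c1 y); have ci y := continuous_im (c1 y).
have cZ (u : R -> R) (t : R) : (forall y, {for y, continuous u}) ->
    forall y, {for y, continuous (fun y => u y * t)}.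
  by move=> cu y; apply: continuousM; [exact: cu|exact: cst_continuous].
apply: re_im_eq; rewrite ?reM ?imM /=.
  rewrite -(circle_meanZ (re c) cr) -(circle_meanZ (im c) ci).
  rewrite -(circle_meanB (cZ _ _ cr) (cZ _ _ ci)).
  by congr circle_mean; apply/funext => y; rewrite reM.
rewrite -(circle_meanZ (im c) cr) -[X in _ + X]opprK -mulrN -(circle_meanZ (- re c) ci).
rewrite -(circle_meanB (cZ _ _ cr) (cZ _ _ ci)).
by congr circle_mean; apply/funext => y; rewrite imM; ring.
Qed.

(** The factor 2 is the price of bounding the real and imaginary parts separately. *)
Lemma nrm_complex_mean phi M : ccont phi ->
  (forall y, 0 <= y <= 2 * pi -> nrm (phi y) <= M) ->
  nrm (complex_mean phi) <= 2 * M.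
Proof.
move=> c1 H; apply: le_trans (nrm_le_reim _) _.
have bnd (u : R -> R) : (forall y, {for y, continuous u}) ->
    (forall y, 0 <= y <= 2 * pi -> `|u y| <= M) -> `|circle_mean u| <= M.
  move=> cu uM; rewrite ler_norml -[- M]circle_mean_cst -[M in _ && (_ <= M)]circle_mean_cst.
  apply/andP; split; apply: circle_mean_le => y; try exact: cst_continuous; try exact: cu.
    by move=> /uM; rewrite ler_norml => /andP[].
  by move=> /uM; rewrite ler_norml => /andP[].
have k1 : `|circle_mean (fun y => re (phi y))| <= M.
  by apply: bnd => y; [exact: continuous_re|move=> /H; exact: le_trans (nrm_re _)].
have k2 : `|circle_mean (fun y => im (phi y))| <= M.
  by apply: bnd => y; [exact: continuous_im|move=> /H; exact: le_trans (nrm_im _)].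
by rewrite /=; lra.
Qed.

Lemma unit_circle_neq0 y : e_ y != 0.
Proof. by rewrite -nrm_gt0 nrm_unit_circle. Qed.

Lemma derivable_shift f w z : derivable f (w + z) 1 -> derivable (fun u => f (w + u)) z 1.
Proof.
move=> df; have /derivable_nrmP H := conj df (erefl (derive1 f (w + z))).
apply: (proj1 ((@derivable_nrmP R (fun u => f (w + u)) z (derive1 f (w + z))).2 _)) => e e0.
by have [r r0 {}H] := H e e0; exists r => // h /H; rewrite !addrA.
Qed.

Lemma derivable_continuous f z : derivable f z 1 -> {for z, continuous f}.
Proof. by move=> /derivable1_diffP/differentiable_continuous. Qed.

Lemma ccont_circle f w (r : R) : (forall z, nrm (z - w) = r -> {for z, continuous f}) -> 0 <= r ->
  ccont (fun y => f (w + rc r * e_ y)).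
Proof.
move=> cf r0 y.
have cP : {for y, continuous (fun y => w + rc r * e_ y)}.
  apply: continuousD; first exact: cst_continuous.
  exact: (diff2_continuous_y (diff2_polar r y)).
apply: (continuous_comp cP); apply: cf.
by rewrite addrAC subrr add0r nrmM nrm_rc nrm_unit_circle mulr1 ger0_norm.
Qed.

Lemma ccont_inv_polar (r : R) : 0 < r -> ccont (fun y => (rc r * e_ y)^-1).
Proof.
move=> r0; have -> : (fun y => (rc r * e_ y)^-1) = (fun y => (0 + rc r * e_ y)^-1).
  by apply/funext => y; rewrite add0r.
apply: (@ccont_circle (fun z => z^-1)); last exact: ltW.
move=> z; rewrite subr0 => zr; apply: continuousV; last exact: cvg_id.
by rewrite -nrm_gt0 zr.
Qed.

Lemma mean_value_complex h (rho r : R) : (forall z, 0 < nrm z < rho -> derivable h z 1) ->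
  {for 0, continuous h} -> 0 < r -> r < rho ->
  complex_mean (fun y => h (rc r * e_ y)) = h 0.
Proof.
move=> dh h0 r0 rr; apply: re_im_eq; first exact: mean_value dh _ h0 r0 rr.
have imE z : im z = re (- (Complex 0 1 : C) * z) by rewrite reM reN imN /=; ring.
pose i : C := - (Complex 0 1 : C).
pose g : C -> C := fun z => i * h z.
have dg z : 0 < nrm z < rho -> derivable g z 1.
  by move=> zr; apply: derivableM; [exact: derivable_cst|exact: dh].
have g0 : {for 0, continuous g}.
  by apply: continuousM; [exact: cst_continuous|exact: h0].
have := mean_value dg g0 r0 rr; rewrite /g -imE => E.
rewrite -[RHS]E.
by congr circle_mean; apply/funext => y; exact: imE.
Qed.

(** Mean value property of the difference quotient at [w], extended by [derive1 f w]. At the centre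
    this extension is known only to be continuous, which is all that the mean value property asks
    there. *)
Lemma cauchy_derivative f w (rho r : R) : (forall z, nrm (z - w) < rho -> derivable f z 1) ->
  0 < r -> r < rho ->
  derive1 f w = complex_mean (fun y => (f (w + rc r * e_ y) - f w) / (rc r * e_ y)).
Proof.
move=> df r0 rr; pose h z := if z == 0 then derive1 f w else (f (w + z) - f w) / z.
have -> : derive1 f w = h 0 by rewrite /h eqxx.
have P0 y : rc r * e_ y != 0.
  by rewrite mulf_neq0 ?unit_circle_neq0// -nrm_gt0 nrm_rc normr_gt0 gt_eqF.
rewrite -(@mean_value_complex h rho r) //.
- by congr complex_mean; apply/funext => y; rewrite /h (negbTE (P0 y)).
- move=> z /andP[z0 zr].
  apply: (@near_eq_derivable _ _ _ (fun z => (f (w + z) - f w) * z^-1)).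
    apply/nbhs_nrmP; exists (nrm z) => // u uz; rewrite /h; case: eqVneq => // u0.
    by move: uz; rewrite u0 sub0r nrmN ltxx.
  apply: derivableM.
    apply: derivableB; last exact: derivable_cst.
    by apply: derivable_shift; apply: df; rewrite addrAC subrr add0r.
  by apply: derivableV; [rewrite -nrm_gt0|exact: derivable_id].
- apply/continuous_nrmP => e e0; have e2 : 0 < e / 2 by lra.
  have /derivable_nrmP/(_ _ e2)[t t0 H] : derivable f w 1 /\ derive1 f w = derive1 f w.
    by split => //; apply: df; rewrite subrr nrm0; lra.
  exists t => // u; rewrite subr0 /h eqxx => ut.
  case: eqVneq => [_|u0]; first by rewrite subrr nrm0.
  have -> : (f (w + u) - f w) / u - derive1 f w = (f (w + u) - f w - derive1 f w * u) / u.
    by field.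
  rewrite nrmM nrmV ltr_pdivrMr ?nrm_gt0//.
  have u1 : 0 < nrm u by rewrite nrm_gt0.
  by apply: le_lt_trans (H _ ut) _; rewrite ltr_pM2r//; lra.
Qed.

Lemma eps_is_derive (u : R -> R) (x d : R) :
  (forall e : R, 0 < e -> exists2 r : R, 0 < r & forall t, `|t| < r ->
    `|u (x + t) - u x - d * t| <= e * `|t|) -> is_derive x (1 : R) u d.
Proof.
move=> H.
suff K : (fun t : R => t^-1 *: ((u \o shift x) (t *: (1 : R)) - u x)) @ 0^' --> d.
  by apply: DeriveDef; [apply/cvg_ex; exists d|exact: cvg_lim].
apply/cvgrPdist_le => e e0; have [r r0 {}H] := H e e0.
rewrite /dnbhs /within /=; exists r => // t; rewrite /ball/= sub0r normrN => tr t0.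
rewrite [_%:A]mulr1 (addrC t).
have -> : d - t^-1 *: (u (x + t) - u x) = - ((u (x + t) - u x - d * t) / t).
  by rewrite /GRing.scale /=; field.
by rewrite normrN normrM normfV ler_pdivrMr ?normr_gt0// H.
Qed.

(** The real mean value theorem along the segment from [p] to [p + v], applied to the real and the
    imaginary part of f(z) - c z; hence the factor 2. *)
Lemma strict_derivative f z0 c (delta eps : R) : (forall z, nrm (z - z0) < delta ->
    derivable f z 1 /\ nrm (derive1 f z - c) <= eps) ->
  forall p v, nrm (p - z0) < delta -> nrm (p + v - z0) < delta ->
    nrm (f (p + v) - f p - c * v) <= 2 * (eps * nrm v).
Proof.
move=> H p v pd qd.
have seg s : 0 <= s <= 1 -> nrm (p + rc s * v - z0) < delta.
  move=> s01; have -> : p + rc s * v - z0 = rc (1 - s) * (p - z0) + rc s * (p + v - z0).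
    by rewrite rcB rc1; ring.
  apply: le_lt_trans (nrmD _ _) _; rewrite !nrmM !nrm_rc !ger0_norm; try lra.
  have [->|s0] := eqVneq s 0; first by rewrite subr0 mul1r mul0r addr0.
  have sp : 0 < s by rewrite lt_def s0; lra.
  have k1 : s * nrm (p + v - z0) < s * delta by rewrite ltr_pM2l.
  have k2 : (1 - s) * nrm (p - z0) <= (1 - s) * delta by apply: ler_wpM2l; [lra|exact: ltW].
  lra.
pose g s := f (p + rc s * v) - c * (rc s * v).
have dg s : 0 <= s <= 1 -> forall e : R, 0 < e -> exists2 r : R, 0 < r & forall t, `|t| < r ->
    nrm (g (s + t) - g s - (derive1 f (p + rc s * v) - c) * v * rc t) <= e * `|t|.
  move=> s01 e e0; have [df _] := H _ (seg s s01).
  have v1 : 0 < nrm v + 1 by have := nrm_ge0 v; lra.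
  have ev : 0 < e / (nrm v + 1) by rewrite divr_gt0.
  have /derivable_nrmP/(_ _ ev)[r r0 K] := conj df (erefl (derive1 f (p + rc s * v))).
  exists (r / (nrm v + 1)); first by rewrite divr_gt0.
  move=> t; rewrite ltr_pdivlMr// => tr.
  have tv : nrm (rc t * v) <= `|t| * (nrm v + 1).
    by rewrite nrmM nrm_rc; apply: ler_wpM2l => //; lra.
  have := K _ (le_lt_trans tv tr) => K2.
  rewrite (_ : _ - _ = f (p + rc s * v + rc t * v) - f (p + rc s * v) -
     derive1 f (p + rc s * v) * (rc t * v)); last first.
    by rewrite /g rcD mulrDl addrA; ring.
  apply: le_trans K2 _.
  have -> : e * `|t| = e / (nrm v + 1) * (`|t| * (nrm v + 1)) by field; lra.
  by apply: ler_wpM2l => //; exact: ltW.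
have part (q : C -> R) : (forall a b, q (a - b) = q a - q b) ->
   (forall a (t : R), q (a * rc t) = q a * t) -> (forall a, `|q a| <= nrm a) ->
   `|q (g 1 - g 0)| <= eps * nrm v.
  move=> qB qZ qn.
  have dq (s : R) : 0 <= s <= 1 -> is_derive s (1 : R) (fun s : R => q (g s)) (q ((derive1 f (p + rc s * v) - c) * v)).
    move=> s01; apply: eps_is_derive => e e0; have [r r0 K] := dg s s01 e e0.
    exists r => // t /K; apply: le_trans; rewrite -qZ -!qB; exact: qn.
  have [| |s s01 E] := @MVT R (fun s : R => q (g s)) (fun s : R => q ((derive1 f (p + rc s * v) - c) * v)) 0 1 ltr01.
  - by move=> s; rewrite in_itv/= => /andP[? ?]; apply: dq; lra.
  - apply: continuous_in_subspaceT => s; rewrite inE/= in_itv/= => s01.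
    have [/derivable1_diffP/differentiable_continuous] := dq s s01.
    by [].
  rewrite qB E subr0 mulr1; apply: le_trans (qn _) _; rewrite nrmM.
  move: s01; rewrite in_itv/= => /andP[? ?].
  by apply: ler_wpM2r; [exact: nrm_ge0|apply: (H _ (seg s _)).2; lra].
rewrite (_ : _ - _ = g 1 - g 0); last first.
  by rewrite /g rc0 rc1 !mul1r mul0r addr0 mulr0 subr0; ring.
apply: le_trans (nrm_le_reim _) _.
have k1 : `|re (g 1 - g 0)| <= eps * nrm v.
  apply: part; [exact: reB| |exact: nrm_re].
  by move=> a t; rewrite reM /= mulr0 subr0.
have k2 : `|im (g 1 - g 0)| <= eps * nrm v.
  apply: part; [exact: imB| |exact: nrm_im].
  by move=> a t; rewrite imM /= mulr0 add0r.
lra.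
Qed.

End HolomorphicDerivative.

(** * Holomorphy of the derivative and the maximum principle *)

Section HolomorphicTheorems.
Variable R : realType.
Local Notation C := (complex_field R).
Local Notation e_ := (@unit_circle R).
Implicit Types (z w d : C) (f h : C -> C).

(** Compactness of the parameter interval makes a locally uniform property uniform on the circle. *)
Lemma circle_uniform (P : C -> C -> Prop) w (r : R) : 0 <= r ->
  (forall z, nrm (z - w) = r -> exists2 delta : R, 0 < delta &
     forall z' d, nrm (z' - z) < delta -> nrm d < delta -> P d z') ->
  exists2 delta : R, 0 < delta & forall d, nrm d < delta ->
    forall y, 0 <= y <= 2 * pi -> P d (w + rc r * e_ y).
Proof.
move=> r0 H.
have /compact_near_coveringP/(_ C (nbhs (0 : C)) (fun d y => P d (w + rc r * e_ y)) _) :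
  compact `[0 : R, 2 * pi] by exact: segment_compact.
move=> /(_ _)[y _|delta /= delta0 K]; last first.
  have [t t0 E] := gt0_rc delta0.
  exists t => // d dt y yy; have yK : `[0 : R, 2 * pi]%classic y by rewrite /= in_itv.
  apply: (K d _ y yK); rewrite /ball_ /= sub0r normrN norm_rc E rc_lt.
  exact: dt.
have [|delta delta0 K] := H (w + rc r * e_ y).
  by rewrite addrAC subrr add0r nrmM nrm_rc nrm_unit_circle mulr1 ger0_norm.
have /(@cvg_nrmP R R (nbhs y) _) /(_ _ delta0) N1 : {for y, continuous (fun y => w + rc r * e_ y)}.
  apply: (@ccont_circle R id) => // z _; exact: cvg_id.
have N2 : \forall d \near (0 : C), nrm d < delta.
  by apply/nbhs_nrmP; exists delta => // d; rewrite subr0.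
exists ([set y' | nrm (w + rc r * e_ y' - (w + rc r * e_ y)) < delta], [set d | nrm d < delta]).
  by split.
by move=> [y' d] /= [h1 h2]; exact: K.
Qed.

Let nrm_shift_slope (a b c d e : C) :
  nrm (a - b - e * d) <= nrm (a - b - c * d) + nrm (e - c) * nrm d.
Proof.
rewrite (_ : a - b - e * d = a - b - c * d - (e - c) * d); last by ring.
by rewrite -nrmM; exact: nrmB.
Qed.

Let diff_quotients (a b a' b' c c' d p : C) : p != 0 ->
  (a' - b') / p - (a - b) / p - (c - c') / p * d =
  ((a' - a - c * d) - (b' - b - c' * d)) / p.
Proof. by move=> p0; field. Qed.

Section Derivative.
Variables (f : C -> C) (w : C) (r : R).
Hypothesis r0 : 0 < r.
(** Centres [z] range over the disc of radius [2 * r], and the formula for the derivative at [z]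
    uses [f] on the disc of radius [2 * r] about [z]. *)
Hypothesis df : forall z, nrm (z - w) < 4 * r -> derivable f z 1.

Let P y := rc r * e_ y.

Let nrmP_ y : nrm (P y) = r.
Proof. by rewrite nrmM nrm_rc nrm_unit_circle mulr1 ger0_norm// ltW. Qed.

Let cauchy z : nrm (z - w) < 2 * r ->
  derive1 f z = complex_mean (fun y => (f (z + P y) - f z) / P y).
Proof.
move=> zr; apply: (@cauchy_derivative R f z (2 * r) r); [|exact: r0|have := r0; lra].
by move=> u uz; apply: df; have := nrm_triangle z u w; lra.
Qed.

Let cquot z : nrm (z - w) < 2 * r -> ccont (fun y => (f (z + P y) - f z) / P y).
Proof.
move=> zr; apply: ccontM; last exact: ccont_inv_polar.
apply: ccontB; last by move=> y; exact: cst_continuous.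
apply: ccont_circle; last exact: ltW.
move=> u ur; apply: derivable_continuous; apply: df.
have := nrm_triangle z u w; have := r0; lra.
Qed.

Lemma derive1_continuous z : nrm (z - w) < 2 * r -> {for z, continuous (derive1 f)}.
Proof.
move=> zr; have rp := r0; apply/continuous_nrmP => e e0.
have e8 : 0 < e * r / 8 by rewrite divr_gt0// mulr_gt0.
have cf u : nrm (u - w) < 4 * r -> {for u, continuous f}.
  by move=> ur; apply: derivable_continuous; exact: df.
have [||d1 d10 H1] := @circle_uniform (fun d u => nrm (f (u + d) - f u) < e * r / 4) z r.
- exact: ltW.
- move=> u uz; have : nrm (u - w) < 4 * r by have := nrm_triangle z u w; lra.
  move=> /cf/continuous_nrmP/(_ _ e8)[t t0 K]; exists (t / 2); first lra.
  move=> u' d uu dt; have k1 := K u' ltac:(lra).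
  have k2 : nrm (f (u' + d) - f u) < e * r / 8.
    by apply: K; rewrite addrAC; apply: le_lt_trans (nrmD _ _) _; lra.
  have := nrm_triangle (f u) (f (u' + d)) (f u'); rewrite (nrmC (f u) (f u')); lra.
have /cf/continuous_nrmP/(_ _ e8)[d2 d20 H2] : nrm (z - w) < 4 * r by lra.
exists (Num.min (Num.min d1 d2) (2 * r - nrm (z - w))); first by rewrite !lt_min d10 d20/=; lra.
move=> z'; rewrite !lt_min => /andP[/andP[h1 h2] h3].
have z'r : nrm (z' - w) < 2 * r by have := nrm_triangle z z' w; lra.
rewrite (cauchy z'r) (cauchy zr) -(complex_meanB (cquot z'r) (cquot zr)).
(* The errors [e * r / 4] on the circle and [e * r / 8] at the centre, divided by the radius; the
   mean doubles them. *)
apply: (@le_lt_trans _ _ (2 * (3 / 8 * e))); last lra.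
apply: nrm_complex_mean => [|y yy]; first by apply: ccontB; exact: cquot.
rewrite -mulrBl nrmM nrmV nrmP_ ler_pdivrMr//.
have := H1 _ h1 y yy; have := H2 _ h2.
rewrite (_ : z + rc r * e_ y + (z' - z) = z' + P y); last by rewrite /P; ring.
rewrite (_ : f (z' + P y) - f z' - (f (z + P y) - f z) =
   f (z' + P y) - f (z + P y) - (f z' - f z)); last by ring.
move=> k1 k2; apply: le_trans (nrmB _ _) _; rewrite /P in k1 k2 *; lra.
Qed.

(** The candidate [Psi] is the Cauchy formula differentiated under the mean. The error is controlled
    by strict differentiability of [f], which holds because [derive1 f] is already continuous, and
    which compactness makes uniform on the circle. *)
Lemma derive1_derivable z : nrm (z - w) < r -> derivable (derive1 f) z 1.
Proof.
move=> zr; have rp := r0; pose Psi := complex_mean (fun y => (derive1 f (z + P y) - derive1 f z) / P y).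
apply: (proj1 ((@derivable_nrmP R (derive1 f) z Psi).2 _)) => e e0.
have e8 : 0 < e * r / 8 by rewrite divr_gt0// mulr_gt0.
have cf u : nrm (u - w) < 2 * r -> {for u, continuous (derive1 f)} by exact: derive1_continuous.
have strict u : nrm (u - w) < 2 * r -> exists2 t : R, 0 < t &
   forall u' d, nrm (u' - u) < t -> nrm d < t ->
     nrm (f (u' + d) - f u' - derive1 f u' * d) <= e * r / 4 * nrm d.
  (* Three such contributions occur: two from [strict_derivative] and one from replacing the slope
     at [u] by the slope at [u']. *)
  move=> ur; have e24 : 0 < e * r / 24 by lra.
  have /continuous_nrmP/(_ _ e24)[t t0 K] := cf u ur.
  pose t' := Num.min t (2 * r - nrm (u - w)).
  have t'0 : 0 < t' by rewrite lt_min t0/=; lra.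
  have t't : t' <= t by rewrite ge_min lexx.
  have t'w : t' <= 2 * r - nrm (u - w) by rewrite ge_min lexx orbT.
  have t'K v : nrm (v - u) < t' -> derivable f v 1 /\ nrm (derive1 f v - derive1 f u) <= e * r / 24.
    move=> vt; split; last by apply/ltW/K; lra.
    by apply: df; have := nrm_triangle u v w; lra.
  exists (t' / 2); first lra.
  move=> u' d uu dt; have := strict_derivative t'K (p := u') (v := d) ltac:(lra).
  rewrite {1}addrAC => /(_ (le_lt_trans (nrmD _ _) _)) K1.
  have {}K1 := K1 ltac:(lra).
  have [_ K2] := t'K u' ltac:(lra).
  apply: le_trans (nrm_shift_slope _ _ (derive1 f u) _ _) _.
  have := ler_wpM2r (nrm_ge0 d) K2; have := nrm_ge0 d => d0.
  have := mulr_ge0 (ltW e24) d0; lra.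
have [||d1 d10 H1] := @circle_uniform
    (fun d u => nrm (f (u + d) - f u - derive1 f u * d) <= e * r / 4 * nrm d) z r.
- exact: ltW.
- by move=> u uz; apply: strict; have := nrm_triangle z u w; lra.
have [d2 d20 H2] := strict z ltac:(lra).
exists (Num.min (Num.min d1 d2) r); first by rewrite !lt_min d10 d20.
move=> d; rewrite !lt_min => /andP[/andP[h1 h2] h3].
have z'r : nrm (z + d - w) < 2 * r by rewrite addrAC; apply: le_lt_trans (nrmD _ _) _; lra.
have cPsi : ccont (fun y => (derive1 f (z + P y) - derive1 f z) / P y).
  apply: ccontM; last exact: ccont_inv_polar.
  apply: ccontB; last by move=> y; exact: cst_continuous.
  apply: ccont_circle; last exact: ltW.
  by move=> u ur; apply: cf; have := nrm_triangle z u w; lra.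
have zr2 : nrm (z - w) < 2 * r by lra.
have cPsid : ccont (fun y => (derive1 f (z + P y) - derive1 f z) / P y * d).
  by apply: (ccontM cPsi) => y; exact: cst_continuous.
have cB := ccontB (cquot z'r) (cquot zr2).
have E1 := complex_meanB (cquot z'r) (cquot zr2).
have E3 := complex_meanB cB cPsid; rewrite E1 (complex_meanZ d cPsi) in E3.
rewrite (cauchy z'r) (cauchy zr2) -[X in nrm X]E3.
apply: (@le_trans _ _ (2 * (e / 2 * nrm d))); last lra.
apply: nrm_complex_mean => [|y yy].
  exact: ccontB.
have k1 := H1 _ h1 y yy; have k2 := H2 z d; rewrite subrr nrm0 in k2.
have {}k2 := k2 d20 h2.
have P0 : P y != 0 by rewrite -nrm_gt0 nrmP_.
rewrite (addrAC z d) diff_quotients//.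
rewrite nrmM nrmV nrmP_ ler_pdivrMr//.
apply: le_trans (nrmB _ _) _; apply: le_trans (lerD k1 k2) _.
have G (x : R) : e * r / 4 * x + e * r / 4 * x = e / 2 * x * r by field.
by rewrite (G (nrm d)).
Qed.

End Derivative.

Definition hol0 f := \forall z \near (0 : C), derivable f z 1.

Theorem hol0_derive1 f : hol0 f -> hol0 (derive1 f).
Proof.
move=> /nbhs_nrmP[t t0 H]; apply/nbhs_nrmP; exists (t / 4); first lra.
move=> z zt; apply: (@derive1_derivable f 0 (t / 4)) => //; first lra.
by move=> u; rewrite mulrC divfK// => ut; exact: H.
Qed.

(** A bound on the real part at the centre suffices, as the application has [h 0 = 1]. *)
Lemma maximum_principle h (rho r q : R) : (forall z, nrm z < rho -> derivable h z 1) ->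
  0 < r -> r < rho -> (forall z, nrm z = r -> nrm (h z) <= q) -> re (h 0) <= q.
Proof.
move=> dh r0 rr hq.
have ch z : nrm z < rho -> {for z, continuous h}.
  by move=> zr; apply: derivable_continuous; exact: dh.
rewrite -(@mean_value R h rho _ r)//; last 2 first.
- by move=> z /andP[_]; exact: dh.
- by apply: ch; rewrite nrm0; lra.
have cP : ccont (fun y => h (rc r * e_ y)).
  have -> : (fun y => h (rc r * e_ y)) = (fun y => h (0 + rc r * e_ y)).
    by apply/funext => y; rewrite add0r.
  by apply: ccont_circle => [z|]; [rewrite subr0 => zr; apply: ch; lra|exact: ltW].
rewrite -[q]circle_mean_cst; apply: circle_mean_le => y; try exact: cst_continuous.
  exact: (continuous_re (cP y)).
move=> _; apply: le_trans (ler_norm _) (le_trans (nrm_re _) _); apply: hq.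
by rewrite nrmM nrm_rc nrm_unit_circle mulr1 ger0_norm// ltW.
Qed.

End HolomorphicTheorems.

(** * Germs, jets and Taylor polynomials *)

Section FamilyInduction.
Variables (n : nat) (K : nzRingType) (A : comNzRingType) (T : Type).

(** [P] is a property of whole functions, such as being holomorphic near 0. With [T] of the form
    [bool * C] or [bool] it also expresses a relation between two functions, such as equality of
    jets. *)
Lemma mmap_family_ind (P : (T -> A) -> Prop) (f : K -> A) (h : 'I_n -> T -> A) (p : mpoly n K) :
  (forall c, P (fun=> f c)) -> P (fun=> 0) -> P (fun=> 1) ->
  (forall u v, P u -> P v -> P (fun t => u t + v t)) ->
  (forall u v, P u -> P v -> P (fun t => u t * v t)) ->
  (forall i, P (h i)) -> P (fun t => mmap f (h ^~ t) p).
Proof.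
move=> Pc P0 P1 PD PM Ph; rewrite /mmap; elim: (msupp p) => [|m s IH].
  by rewrite [X in P X](_ : _ = fun=> 0)//; apply/funext => t; rewrite big_nil.
rewrite [X in P X](_ : _ = fun t => f (mcoeff m p) * mmap1 (h ^~ t) m +
  \sum_(m <- s) f (mcoeff m p) * mmap1 (h ^~ t) m); last first.
  by apply/funext => t; rewrite big_cons.
apply: (PD _ _ _ IH); apply: (PM _ _ (Pc _)); rewrite /mmap1.
elim: (index_enum _) => [|i r IHr].
  by rewrite [X in P X](_ : _ = fun=> 1)//; apply/funext => t; rewrite big_nil.
rewrite [X in P X](_ : _ = fun t => h i t ^+ m i * \prod_(i <- r) h i t ^+ m i); last first.
  by apply/funext => t; rewrite big_cons.
apply: (PM _ _ _ IHr); elim: (m i) => [|e IHe]; first exact: P1.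
rewrite [X in P X](_ : _ = fun t => h i t * h i t ^+ e); last first.
  by apply/funext => t; rewrite exprS.
exact: PM.
Qed.

Lemma family_sum_ind I (r : seq I) (Q : pred I) (P : (T -> A) -> Prop) (F : I -> T -> A) :
  P (fun=> 0) -> (forall u v, P u -> P v -> P (fun t => u t + v t)) ->
  (forall i, P (F i)) -> P (fun t => \sum_(i <- r | Q i) F i t).
Proof.
move=> P0 PD PF; elim: r => [|i r IH].
  by rewrite [X in P X](_ : _ = fun=> 0)//; apply/funext => t; rewrite big_nil.
case Qi : (Q i); last first.
  by rewrite [X in P X](_ : _ = fun t => \sum_(i <- r | Q i) F i t)//; apply/funext => t; rewrite big_cons Qi.
rewrite [X in P X](_ : _ = fun t => F i t + \sum_(i <- r | Q i) F i t); first exact: PD.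
by apply/funext => t; rewrite big_cons Qi.
Qed.

Lemma family_exp_ind (P : (T -> A) -> Prop) (u : T -> A) k :
  P (fun=> 1) -> (forall u v, P u -> P v -> P (fun t => u t * v t)) ->
  P u -> P (fun t => u t ^+ k).
Proof.
move=> P1 PM Pu; elim: k => [|k IH]; first exact: P1.
rewrite [X in P X](_ : _ = fun t => u t * u t ^+ k); first exact: PM.
by apply/funext => t; rewrite exprS.
Qed.

Lemma family_prod_ind I (r : seq I) (Q : pred I) (P : (T -> A) -> Prop) (F : I -> T -> A) :
  P (fun=> 1) -> (forall u v, P u -> P v -> P (fun t => u t * v t)) ->
  (forall i, P (F i)) -> P (fun t => \prod_(i <- r | Q i) F i t).
Proof.
move=> P0 PD PF; elim: r => [|i r IH].
  by rewrite [X in P X](_ : _ = fun=> 1)//; apply/funext => t; rewrite big_nil.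
case Qi : (Q i); last first.
  by rewrite [X in P X](_ : _ = fun t => \prod_(i <- r | Q i) F i t)//; apply/funext => t; rewrite big_cons Qi.
rewrite [X in P X](_ : _ = fun t => F i t * \prod_(i <- r | Q i) F i t); first exact: PD.
by apply/funext => t; rewrite big_cons Qi.
Qed.

End FamilyInduction.

Lemma quotient_rule_identity (K : fieldType) (a b c d : K) j : d != 0 ->
  b / d ^+ j.+1 + c * (- (a * d ^+ j *+ j.+1) * ((d ^+ j.+1)^-1 * (d ^+ j.+1)^-1)) =
  (b * d - c * a *+ j.+1) / d ^+ j.+2.
Proof.
move=> d0; rewrite -[a * _ *+ _]mulr_natr -[c * a *+ _]mulr_natr !exprS.
have := expf_neq0 j d0; move: (d ^+ j) (j.+1%:R : K) => e N e0.
by field; rewrite d0 e0.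
Qed.

(** * Germs at 0 and equality of jets *)

Section HolomorphicGerms.
Variable R : realType.
Local Notation C := (complex_field R).
Implicit Types (z w c : C) (f g u v : C -> C).

Lemma near0_near (P : C -> Prop) : (\forall t \near (0 : C), P t) ->
  \forall t \near (0 : C), \forall s \near t, P s.
Proof.
move=> /nbhs_nrmP[r r0 H]; apply/nbhs_nrmP; exists r => // t; rewrite subr0 => tr.
apply/nbhs_nrmP; exists (r - nrm t); first lra.
by move=> s st; apply: H; have := nrm_triangle t s 0; rewrite !subr0; lra.
Qed.

Lemma near0W (P : C -> Prop) : (forall t, P t) -> \forall t \near (0 : C), P t.
Proof. by move=> H; apply: (@filterE _ _ (nbhs_filter (0 : C))). Qed.

Lemma near0S (P Q : C -> Prop) : (forall t, P t -> Q t) ->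
  (\forall t \near (0 : C), P t) -> \forall t \near (0 : C), Q t.
Proof. by move=> H; apply: (@filterS _ _ (nbhs_filter (0 : C))). Qed.

Lemma near0S2 (P Q S : C -> Prop) : (forall t, P t -> Q t -> S t) ->
  (\forall t \near (0 : C), P t) -> (\forall t \near (0 : C), Q t) ->
  \forall t \near (0 : C), S t.
Proof. by move=> H; apply: (@filterS2 _ _ (nbhs_filter (0 : C))). Qed.

Lemma hol0_at f : hol0 f -> derivable f 0 1.
Proof. exact: nbhs_singleton. Qed.

Lemma hol0_near f g : (\forall t \near (0 : C), f t = g t) -> hol0 f -> hol0 g.
Proof.
move=> /near0_near; apply: near0S2 => t fg df.
exact: near_eq_derivable fg df.
Qed.

Definition dC f : C -> C := derive1 f.

(** The recursion differentiates the argument, so that inductions pass from a germ to its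
    derivative, as in [jet_eqS]. *)
Fixpoint dCn j f : C -> C := if j is j'.+1 then dCn j' (dC f) else f.

Lemma derive1n_dCn j f t : derive1n j f t = dCn j f t.
Proof.
elim: j f => [|j IH] f; first reflexivity.
transitivity (derive1n j (derive1 f) t); last exact: (IH (dC f)).
by rewrite /derive1n iterSr.
Qed.

Lemma dCnSr j f : dCn j.+1 f = dC (dCn j f).
Proof.
elim: j f => [|j IH] f; first reflexivity.
exact (IH (dC f)).
Qed.

Lemma dC_near f g : (\forall t \near (0 : C), f t = g t) ->
  \forall t \near (0 : C), dC f t = dC g t.
Proof.
move=> /near0_near; apply: near0S => t fg; rewrite /dC !derive1E.
exact: near_eq_derive.
Qed.

Lemma dCn_near f g j : (\forall t \near (0 : C), f t = g t) ->
  \forall t \near (0 : C), dCn j f t = dCn j g t.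
Proof.
move=> fg; elim: j => [|j IH]; first exact: fg.
by rewrite !dCnSr; exact: dC_near.
Qed.

Lemma hol0_cst c : hol0 (fun=> c).
Proof. by apply: near0W => t; exact: derivable_cst. Qed.

Lemma hol0_id : hol0 (fun t : C => t).
Proof. by apply: near0W => t; exact: derivable_id. Qed.

Lemma hol0D f g : hol0 f -> hol0 g -> hol0 (fun t => f t + g t).
Proof. by apply: near0S2 => t df dg; exact: (derivableD df dg). Qed.

Lemma hol0B f g : hol0 f -> hol0 g -> hol0 (fun t => f t - g t).
Proof.
by apply: near0S2 => t df dg; exact: (derivableB df dg). Qed.

Lemma hol0M f g : hol0 f -> hol0 g -> hol0 (fun t => f t * g t).
Proof.
by apply: near0S2 => t df dg; exact: (derivableM df dg). Qed.

Lemma hol0_continuous f : hol0 f -> {for 0, continuous f}.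
Proof. by move=> /hol0_at; exact: derivable_continuous. Qed.

Lemma hol0_neq0 f : hol0 f -> f 0 != 0 -> \forall t \near (0 : C), f t != 0.
Proof.
move=> /hol0_continuous/continuous_nrmP cf; rewrite -nrm_gt0 => f0.
have [r r0 H] := cf _ f0; apply/nbhs_nrmP; exists r => // t /H.
by case: eqVneq => // ->; rewrite sub0r nrmN ltxx.
Qed.

Lemma hol0V f : hol0 f -> f 0 != 0 -> hol0 (fun t => (f t)^-1).
Proof.
move=> hf f0; have nf := hol0_neq0 hf f0.
move: hf nf; rewrite /hol0.
apply: (@near0S2 (fun t => derivable f t 1) (fun t => f t != 0)).
move=> t df ft.
exact: (derivableV ft df).
Qed.

Lemma hol0X f m : hol0 f -> hol0 (fun t => f t ^+ m).
Proof.
move=> hf.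
exact: (@family_exp_ind C C (@hol0 R) f m (hol0_cst 1) hol0M hf).
Qed.

Lemma hol0_sum I (r : seq I) (P : pred I) (F : I -> C -> C) :
  (forall i, hol0 (F i)) -> hol0 (fun t => \sum_(i <- r | P i) F i t).
Proof. exact: (@family_sum_ind C C I r P (@hol0 R) F (hol0_cst 0) hol0D). Qed.

Lemma hol0_prod I (r : seq I) (P : pred I) (F : I -> C -> C) :
  (forall i, hol0 (F i)) -> hol0 (fun t => \prod_(i <- r | P i) F i t).
Proof. exact: (@family_prod_ind C C I r P (@hol0 R) F (hol0_cst 1) hol0M). Qed.

Lemma derivable_horner (p : {poly C}) z : derivable (horner p) z 1 /\ derive1 (horner p) z = (p^`()).[z].
Proof.
elim/poly_ind: p => [|p c [IH1 IH2]].
  have -> : horner 0 = fun _ : C => 0 by apply/funext => t; rewrite horner0.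
  by split; [exact: derivable_cst|rewrite derivC horner0 derive1_cst].
have E : horner (p * 'X + c%:P) = horner p * id + cst c.
  by apply/funext => t; rewrite hornerMXaddC.
have di : derivable (id : C -> C) z 1 by exact: derivable_id.
have dX : derivable (horner p * id) z 1 by exact: (derivableM IH1 di).
have dc : derivable (cst c : C -> C) z 1 by exact: derivable_cst.
rewrite E; split; first exact: (derivableD dX dc).
rewrite derive1E (deriveD dX dc) (deriveM IH1 di).
rewrite derive_cst derive_id addr0 -derive1E IH2.
rewrite derivMXaddC hornerD hornerMX /GRing.scale /=.
by rewrite mulr1 mulrC.
Qed.

Lemma hol0_horner (p : {poly C}) : hol0 (horner p).
Proof. by apply: near0W => t; exact: (derivable_horner p t).1. Qed.

Lemma near_dCD u v : hol0 u -> hol0 v -> \forall t \near (0 : C),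
  dC u t + dC v t = dC (fun t => u t + v t) t.
Proof.
apply: near0S2 => t du dv; rewrite /dC !derive1E; symmetry; exact: deriveD du dv.
Qed.

Lemma near_dCM u v : hol0 u -> hol0 v -> \forall t \near (0 : C),
  dC u t * v t + u t * dC v t = dC (fun t => u t * v t) t.
Proof.
apply: near0S2 => t du dv.
have := deriveM du dv; rewrite -!derive1E => E.
by rewrite /dC [RHS]E addrC; congr (_ + _); exact: mulrC.
Qed.

Lemma near_dCV u : hol0 u -> u 0 != 0 -> \forall t \near (0 : C),
  - (dC u t) * ((u t)^-1 * (u t)^-1) = dC (fun t => (u t)^-1) t.
Proof.
move=> hu u0; move: hu (hol0_neq0 hu u0); apply: near0S2 => t du ut.
have := deriveV ut du; rewrite -!derive1E => E; rewrite /dC [RHS]E.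
by rewrite /GRing.scale /= -invfM -expr2 mulNr mulrC mulNr.
Qed.

Lemma hol0_dC f : hol0 f -> hol0 (dC f).
Proof. exact: hol0_derive1. Qed.

Lemma dC_horner (p : {poly C}) z : dC (horner p) z = (p^`()).[z].
Proof. exact: (derivable_horner p z).2. Qed.

Opaque hol0 dC.

Lemma dCn_horner (p : {poly C}) j : dCn j (horner p) = horner (p^`(j)).
Proof.
elim: j => [|j IH]; first by rewrite derivn0.
by rewrite dCnSr IH; apply/funext => t; rewrite dC_horner derivnS.
Qed.

Lemma hol0_meval m (p : mpoly m C) (y : 'I_m -> C -> C) :
  (forall i, hol0 (y i)) -> hol0 (fun t => meval (y ^~ t) p).
Proof.
move=> hy; exact: (@mmap_family_ind m C C C (@hol0 R) idfun y p hol0_cst (hol0_cst 0) (hol0_cst 1) hol0D hol0M hy).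
Qed.

Definition jet_eq k u v := [/\ hol0 u, hol0 v &
  forall j, (j <= k)%N -> dCn j u 0 = dCn j v 0].

Lemma jet_eq0 u v : hol0 u -> hol0 v -> u 0 = v 0 -> jet_eq 0 u v.
Proof.
by move=> hu hv uv; split; [exact: hu|exact: hv|] => j; rewrite leqn0 => /eqP ->.
Qed.

Lemma jet_eqS k u v : jet_eq k.+1 u v <->
  [/\ hol0 u, hol0 v, u 0 = v 0 & jet_eq k (dC u) (dC v)].
Proof.
split=> [[hu hv H]|[hu hv uv [_ _ H]]].
  split; [exact: hu|exact: hv|exact: (H 0%N)|].
  by split=> [||j jk]; [exact: hol0_dC|exact: hol0_dC|exact: (H j.+1)].
by split; [exact: hu|exact: hv|] => -[|j] jk; [exact: uv|exact: H].
Qed.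

Lemma jet_eq_near k u v u' v' : (\forall t \near (0 : C), u t = u' t) ->
  (\forall t \near (0 : C), v t = v' t) -> jet_eq k u v -> jet_eq k u' v'.
Proof.
move=> uu vv [hu hv H]; split; [exact: hol0_near uu hu|exact: hol0_near vv hv|].
move=> j /H; have := nbhs_singleton (dCn_near j uu).
by have := nbhs_singleton (dCn_near j vv) => /= -> ->.
Qed.

Lemma jet_eq_refl k u : hol0 u -> jet_eq k u u.
Proof. by move=> hu; split. Qed.

Lemma jet_eq_trans k u v u' : jet_eq k u v -> jet_eq k v u' -> jet_eq k u u'.
Proof.
move=> [hu hv H] [_ hw H']; split; [exact: hu|exact: hw|] => j jk.
by rewrite (H j jk) (H' j jk).
Qed.

Lemma jet_eqW k j u v : (j <= k)%N -> jet_eq k u v -> jet_eq j u v.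
Proof.
move=> jk [hu hv H]; split; [exact: hu|exact: hv|] => i ij.
exact: (H i (leq_trans ij jk)).
Qed.

Lemma jet_eqD k u v u' v' : jet_eq k u u' -> jet_eq k v v' ->
  jet_eq k (fun t => u t + v t) (fun t => u' t + v' t).
Proof.
elim: k u v u' v' => [|k IH] u v u' v'.
  move=> [hu hu' Hu] [hv hv' Hv]; apply: jet_eq0; try exact: hol0D.
  by have := Hu 0%N (leqnn _); have := Hv 0%N (leqnn _) => /= -> ->.
move=> /jet_eqS[hu hu' u0 ju] /jet_eqS[hv hv' v0 jv]; apply/jet_eqS.
split; [exact: hol0D|exact: hol0D|by rewrite u0 v0|].
apply: jet_eq_near (IH _ _ _ _ ju jv); exact: near_dCD.
Qed.

(** Induction on the order with the product rule for one derivative; the higher Leibniz formula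
    never appears. *)
Lemma jet_eqM k u v u' v' : jet_eq k u u' -> jet_eq k v v' ->
  jet_eq k (fun t => u t * v t) (fun t => u' t * v' t).
Proof.
elim: k u v u' v' => [|k IH] u v u' v'.
  move=> [hu hu' Hu] [hv hv' Hv]; apply: jet_eq0; try exact: hol0M.
  by have := Hu 0%N (leqnn _); have := Hv 0%N (leqnn _) => /= -> ->.
move=> Hu Hv; have [hu hu' u0 ju] := (jet_eqS _ _ _).1 Hu.
have [hv hv' v0 jv] := (jet_eqS _ _ _).1 Hv; apply/jet_eqS.
split; [exact: hol0M|exact: hol0M|by rewrite u0 v0|].
have Hu' := jet_eqW (leqnSn k) Hu; have Hv' := jet_eqW (leqnSn k) Hv.
apply: jet_eq_near (jet_eqD (IH _ _ _ _ ju Hv') (IH _ _ _ _ Hu' jv)); exact: near_dCM.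
Qed.

Lemma jet_eqV k u u' : u 0 != 0 -> jet_eq k u u' ->
  jet_eq k (fun t => (u t)^-1) (fun t => (u' t)^-1).
Proof.
move=> u0; elim: k => [|k IH] H.
  have [hu hu' Hu] := H; have E : u 0 = u' 0 by exact: (Hu 0%N).
  by apply: jet_eq0; [apply: hol0V|apply: hol0V => //; rewrite -E|rewrite E].
have [hu hu' E ju] := (jet_eqS _ _ _).1 H; apply/jet_eqS.
have u'0 : u' 0 != 0 by rewrite -E.
split; [exact: hol0V|exact: hol0V|by rewrite E|].
have {}IH := IH (jet_eqW (leqnSn k) H).
have jN : jet_eq k (fun t => - dC u t) (fun t => - dC u' t).
  apply: jet_eq_near (jet_eqM (jet_eq_refl k (hol0_cst (-1))) ju); apply: near0W => t; exact: mulN1r.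
by apply: jet_eq_near (jet_eqM jN (jet_eqM IH IH)); exact: near_dCV.
Qed.

Lemma jet_eq_meval k m (p : mpoly m C) (y y' : 'I_m -> C -> C) :
  (forall i, jet_eq k (y i) (y' i)) ->
  jet_eq k (fun t => meval (y ^~ t) p) (fun t => meval (y' ^~ t) p).
Proof.
move=> hy; pose P (u : bool * C -> C) := jet_eq k (fun t => u (true, t)) (fun t => u (false, t)).
apply: (@mmap_family_ind m C C (bool * C)%type P idfun
  (fun i bt => if bt.1 then y i bt.2 else y' i bt.2) p).
- by move=> c; exact/jet_eq_refl/hol0_cst.
- exact/jet_eq_refl/hol0_cst.
- exact/jet_eq_refl/hol0_cst.
- by move=> u v; exact: jet_eqD.
- by move=> u v; exact: jet_eqM.
- exact: hy.
Qed.

Lemma jet_eq_dCn k j u v : jet_eq k u v -> (j <= k)%N -> dCn j u 0 = dCn j v 0.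
Proof. by case=> _ _; apply. Qed.

Lemma taylor_jet k u : hol0 u -> exists p : {poly C}, jet_eq k u (horner p).
Proof.
move=> hu; exists (\poly_(j < k.+1) (dCn j u 0 / j`!%:R)).
split; [exact: hu|exact: hol0_horner|] => j jk; rewrite dCn_horner horner_coef0 coef_derivn addn0 ffactnn.
have j0 : (j`!%:R : C) != 0 by rewrite pnatr_eq0 -lt0n fact_gt0.
by rewrite coef_poly ltnS jk -[RHS]mulr_natr -mulrA mulVf ?mulr1.
Qed.

Lemma jet_eq_horner k (p q : {poly C}) : (forall j, (j <= k)%N -> p`_j = q`_j) ->
  jet_eq k (horner p) (horner q).
Proof.
move=> H; split; [exact: hol0_horner|exact: hol0_horner|] => j jk.
by rewrite !dCn_horner !horner_coef0 !coef_derivn addn0 H.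
Qed.

(* P_j with (p / q)^(j) = P_j / q^(j+1). *)
Fixpoint quot_deriv (K : nzRingType) (p q : {poly K}) j : {poly K} :=
  if j is j'.+1 then
    (quot_deriv p q j')^`() * q - (quot_deriv p q j' * q^`()) *+ j'.+1
  else p.

(** This exhibits the derivatives of homogeneous coordinate ratios at 0 as polynomials in the
    coefficients of the curve over a power of [q.[0]], from which dependence on parameters is read
    off. *)
Lemma dCn_quotient (p q : {poly C}) j : q.[0] != 0 -> \forall t \near (0 : C),
  dCn j (fun s => p.[s] / q.[s]) t = (quot_deriv p q j).[t] / q.[t] ^+ j.+1.
Proof.
move=> q0; have hq := hol0_horner q; have nq := hol0_neq0 hq q0.
elim: j => [|j IH]; first by apply: near0W => t; rewrite expr1.
rewrite dCnSr; have E0 := dC_near IH.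
pose Q := quot_deriv p q j.
have hQ : hol0 (fun s : C => (q ^+ j.+1).[s]) by exact: hol0_horner.
have Q0 : (q ^+ j.+1).[0] != 0 by rewrite horner_exp expf_neq0.
have E1 := near_dCM (hol0_horner Q) (hol0V hQ Q0).
have E2 := near_dCV hQ Q0.
have EQ : (fun s => (quot_deriv p q j).[s] / q.[s] ^+ j.+1) = (fun s => Q.[s] * ((q ^+ j.+1).[s])^-1).
  by apply/funext => s; rewrite horner_exp.
rewrite EQ in E0; move: E0 (near0S2 (fun t a b => conj a b) E1 (near0S2 (fun t a b => conj a b) E2 nq)).
apply: near0S2 => t -> [<- [<- qt]].
rewrite !dC_horner deriv_exp horner_exp hornerMn hornerM horner_exp /=.
rewrite hornerD hornerM hornerN hornerMn hornerM -/Q.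
move: (q^`()).[t] (Q^`()).[t] Q.[t] q.[t] qt => a b c d d0.
exact: quotient_rule_identity.
Qed.

End HolomorphicGerms.

(** * Polynomial curves and their deformations *)

Section PolynomialCurves.
Variables (K : fieldType) (m : nat).
Implicit Types (F : mpoly m K) (X Y : 'I_m -> {poly K}).

Lemma mmap_morph (S A : comNzRingType) (f : K -> S) (h : 'I_m -> S) (g : {rmorphism S -> A}) F :
  g (mmap f h F) = mmap (fun c => g (f c)) (fun i => g (h i)) F.
Proof.
rewrite /mmap rmorph_sum; apply: eq_bigr => e _; rewrite rmorphM rmorph_prod.
by congr (_ * _); apply: eq_bigr => i _; rewrite rmorphXn.
Qed.

Lemma mmap_homog (A : comNzRingType) (f : K -> A) (h : 'I_m -> A) (a : A) F d :
  F \is ishomog1 d mdeg -> mmap f (fun i => a * h i) F = a ^+ d * mmap f h F.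
Proof.
move=> /dhomogP hF; rewrite /mmap big_distrr /=; apply: eq_big_seq => e eF.
have -> : d = (\sum_(i < m) e i)%N by rewrite -(hF e eF) -mdegE.
rewrite mulrCA; congr (_ * _); rewrite /mmap1.
rewrite -prodrXr -big_split /=; apply: eq_bigr => i _; exact: exprMn.
Qed.

Section Taylor.
Variables (A : comNzRingType) (f : {rmorphism K -> A}) (X W : 'I_m -> A) (s : A).

Let taylor F := exists B, mmap f (fun i => X i + s * W i) F =
  mmap f X F + s * (\sum_i mmap f X (mderiv i F) * W i) + s ^+ 2 * B.

Let taylorD F G : taylor F -> taylor G -> taylor (F + G).
Proof.
move=> [B EB] [B' EB']; exists (B + B').
under eq_bigr do rewrite mderivD mmapD mulrDl.
by rewrite !mmapD EB EB' big_split /=; ring.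
Qed.

Let taylorM F G : taylor F -> taylor G -> taylor (F * G).
Proof.
move=> [B EB] [B' EB'].
set sF := \sum_i _ in EB; set sG := \sum_i _ in EB'.
have E : \sum_i mmap f X (mderiv i (F * G)) * W i = sF * mmap f X G + mmap f X F * sG.
  rewrite /sF /sG big_distrl big_distrr -big_split; apply: eq_bigr => i _ /=.
  by rewrite mderivM mmapD !rmorphM /=; ring.
exists (sF * sG + mmap f X F * B' + B * mmap f X G + s * (sF * B' + B * sG) + s ^+ 2 * B * B').
by rewrite E !rmorphM /= EB EB'; ring.
Qed.

Let taylor_const c : taylor (mpolyC m c).
Proof.
exists 0; rewrite !mmapC big1 ?mulr0 ?addr0// => i _.
by rewrite mderivC mmap0 mul0r.
Qed.

Let taylor_var i : taylor (mpolyX K (mnm1 i)).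
Proof.
exists 0; rewrite !mmapX !mmap1U mulr0 addr0 (bigD1 i)//= big1 ?addr0.
  have -> : mderiv i (mpolyX K (mnm1 i)) = mpolyC m 1.
    rewrite mderivX mnm1E eqxx scale1r (_ : mnm_sub _ _ = mnm0) ?mpolyX0 ?mpolyC1//.
    by apply/mnmP => j; rewrite mnmBE mnm0E subnn.
  rewrite mmapC; symmetry; congr (_ + s * _); rewrite -[RHS]mul1r.
  by congr (_ * _); exact: (rmorph1 f).
by move=> j ji; rewrite mderivX mnm1E eq_sym (negbTE ji) scale0r mmap0 mul0r.
Qed.

(** The general ring allows two uses: [s] a power of the variable of the curve, and [s] an
    additional deformation variable. *)
Lemma mmap_taylor F : exists B, mmap f (fun i => X i + s * W i) F =
  mmap f X F + s * (\sum_i mmap f X (mderiv i F) * W i) + s ^+ 2 * B.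
Proof.
elim/mpolyind: F => [|c e F _ _ IH]; first by rewrite -mpolyC0; exact: taylor_const.
apply: (taylorD _ IH); rewrite -mul_mpolyC; apply: taylorM; first exact: taylor_const.
rewrite mpolyXE_id; apply: (@big_ind _ taylor); [|exact: taylorM|].
  by rewrite -mpolyC1; exact: taylor_const.
move=> i _; elim: (e i) => [|j IHj]; first by rewrite expr0 -mpolyC1; exact: taylor_const.
by rewrite exprS; apply: taylorM IHj; exact: taylor_var.
Qed.

End Taylor.

Definition curve_eval F X : {poly K} := mmap (@polyC K) X F.

Lemma horner_curve_eval F X t : (curve_eval F X).[t] = meval (fun l => (X l).[t]) F.
Proof.
rewrite /curve_eval /meval -[LHS]/(horner_eval t _) mmap_morph.
by congr (mmap _ _ F); apply/funext => c; exact: hornerC.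
Qed.

Lemma curve_eval_homog F X a d : F \is ishomog1 d mdeg ->
  curve_eval F (fun l => a * X l) = a ^+ d * curve_eval F X.
Proof. exact: mmap_homog. Qed.

Lemma meval_homog F (x : 'I_m -> K) a d : F \is ishomog1 d mdeg ->
  meval (fun l => a * x l) F = a ^+ d * meval x F.
Proof. exact: mmap_homog. Qed.

Definition differential F (x w : 'I_m -> K) := \sum_l meval x (mderiv l F) * w l.

(** The quadratic remainder starts in degree [j * 2 > j]. Hence the coefficient of order [j] can be
    prescribed without disturbing the lower ones, as in Hensel's lemma. *)
Lemma curve_eval_step F X (w : 'I_m -> K) c j : (0 < j)%N ->
  forall i, (i <= j)%N -> (curve_eval F (fun l => X l + (c * w l) *: 'X^j))`_i =
    (curve_eval F X)`_i + (if i == j then c * differential F (fun l => (X l).[0]) w else 0).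
Proof.
move=> j0 i ij.
have [B] := @mmap_taylor {poly K} (polyC : {rmorphism K -> {poly K}}) X (fun l => (c * w l)%:P) 'X^j F.
rewrite /curve_eval => E.
have -> : (fun l => X l + (c * w l) *: 'X^j) = (fun l => X l + 'X^j * (c * w l)%:P).
  by apply/funext => l; rewrite -mul_polyC [RHS]addrC addrC [in RHS]mulrC.
rewrite {}E !coefD -exprM !coefXnM ltn_neqAle ij andbT (_ : (i < j * 2)%N = true); last by lia.
rewrite addr0; case: eqVneq => [->|//]; rewrite subnn /=; congr (_ + _).
rewrite coef_sum /differential big_distrr /=; apply: eq_bigr => l _.
by rewrite coefMC -horner_coef0 horner_curve_eval mulrCA.
Qed.

(** Both sides are the coefficient of degree 1 in F((1 + X) x) = (1 + X)^d F(x). *)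
Lemma differential_euler F (x : 'I_m -> K) d : F \is ishomog1 d mdeg ->
  differential F x x = d%:R * meval x F.
Proof.
move=> hF; have := @curve_eval_step F (fun l => (x l)%:P) x 1 1%N isT 1%N isT.
have -> : (fun l => (x l)%:P + (1 * x l) *: 'X^1) = (fun l => (1 + 'X) * (x l)%:P).
  by apply/funext => l; rewrite mul1r expr1 mulrDl mul1r -mul_polyC ['X * _]mulrC.
rewrite (curve_eval_homog _ _ hF) eqxx mul1r.
have -> : curve_eval F (fun l => (x l)%:P) = (meval x F)%:P.
  rewrite /meval -[RHS]/((polyC : {rmorphism K -> {poly K}}) _) mmap_morph.
  by congr (mmap _ _ F); apply/funext.
rewrite coefMC coefC /= add0r.
have -> : (fun l => (x l)%:P.[0]) = x by apply/funext => l; rewrite hornerC.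
move=> <-; congr (_ * _); rewrite exprDn coef_sum.
under eq_bigr do rewrite expr1n mul1r coefMn coefXn.
case: d {hF} => [|d]; first by rewrite big_ord_recl big_ord0 /= mulr0n addr0.
rewrite (bigD1 (lift ord0 ord0))//= bin1 big1 ?addr0// => -[[|[|a]] al]//=.
by rewrite mul0rn.
Qed.

Lemma curve_eval_trunc F X Y k : (forall l j, (j <= k)%N -> (X l)`_j = (Y l)`_j) ->
  forall j, (j <= k)%N -> (curve_eval F X)`_j = (curve_eval F Y)`_j.
Proof.
move=> XY; pose P (u : bool -> {poly K}) := forall j, (j <= k)%N -> (u true)`_j = (u false)`_j.
apply: (@mmap_family_ind m K {poly K} bool P (@polyC K) (fun l b => if b then X l else Y l) F) => //.
  by move=> u v Hu Hv j jk; rewrite !coefD Hu// Hv.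
move=> u v Hu Hv j jk; rewrite !coefM; apply: eq_bigr => i _.
by rewrite Hu ?Hv//; have := ltn_ord i; lia.
Qed.

Section Families.
Variables (T : Type) (P : (T -> K) -> Prop).

(** Instances are [hol0], the congruence [hol0_cong] modulo a power of t, and continuity at a point;
    the closure lemmas below are proved once for all of them. *)
Definition fun_subring := [/\ forall c, P (fun=> c),
  forall u v, P u -> P v -> P (fun t => u t + v t) &
  forall u v, P u -> P v -> P (fun t => u t * v t)].

Definition coef_family (p : T -> {poly K}) := forall j, P (fun t => (p t)`_j).

Hypothesis sub : fun_subring.

Lemma coef_familyC c : coef_family (fun=> c).
Proof. by case: sub => P0 _ _ j; exact: P0. Qed.

Lemma coef_familyD p q : coef_family p -> coef_family q -> coef_family (fun t => p t + q t).
Proof.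
case: sub => _ PD _ pP qP j.
have -> : (fun t => (p t + q t)`_j) = (fun t => (p t)`_j + (q t)`_j).
  by apply/funext => t; rewrite coefD.
exact: PD.
Qed.

Lemma coef_familyM p q : coef_family p -> coef_family q -> coef_family (fun t => p t * q t).
Proof.
case: sub => P0 PD PM pP qP j.
have -> : (fun t => (p t * q t)`_j) = (fun t => \sum_(i < j.+1) (p t)`_i * (q t)`_(j - i)).
  by apply/funext => t; rewrite coefM.
by apply: (@family_sum_ind _ _ _ _ _ P (fun (i : 'I_j.+1) t => (p t)`_i * (q t)`_(j - i))) => // i; exact: PM.
Qed.

Lemma coef_familyMn p a : coef_family p -> coef_family (fun t => p t *+ a).
Proof.
case: sub => P0 PD PM pP j.
have -> : (fun t => (p t *+ a)`_j) = (fun t => (p t)`_j * a%:R).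
  by apply/funext => t; rewrite coefMn mulr_natr.
exact: PM.
Qed.

Lemma coef_familyN p : coef_family p -> coef_family (fun t => - p t).
Proof.
case: sub => P0 PD PM pP j.
have -> : (fun t => (- p t)`_j) = (fun t => (p t)`_j * -1).
  by apply/funext => t; rewrite coefN mulrN1.
exact: PM.
Qed.

Lemma coef_family_deriv p : coef_family p -> coef_family (fun t => (p t)^`()).
Proof.
case: sub => P0 PD PM pP j.
have -> : (fun t => (p t)^`()`_j) = (fun t => (p t)`_j.+1 * j.+1%:R).
  by apply/funext => t; rewrite coef_deriv mulr_natr.
exact: PM.
Qed.

Lemma coef_family_eval F (X : 'I_m -> T -> {poly K}) : (forall l, coef_family (X l)) ->
  coef_family (fun t => curve_eval F (X ^~ t)).
Proof.
move=> XP; apply: (@mmap_family_ind m K {poly K} T coef_family (@polyC K) X F) => //.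
- by move=> c; exact: coef_familyC.
- exact: coef_familyC.
- exact: coef_familyC.
- by move=> u v; exact: coef_familyD.
- by move=> u v; exact: coef_familyM.
Qed.

Lemma coef_family_quot p q j : coef_family p -> coef_family q ->
  coef_family (fun t => quot_deriv (p t) (q t) j).
Proof.
move=> pP qP; elim: j => [|j IH] //=; apply: coef_familyD.
  by apply: coef_familyM => //; exact: coef_family_deriv.
apply: coef_familyN; apply: coef_familyMn.
by apply: coef_familyM => //; exact: coef_family_deriv.
Qed.

End Families.

Lemma quot_derivZ (p q : {poly K}) a j :
  quot_deriv (a *: p) (a *: q) j = a ^+ j.+1 *: quot_deriv p q j.
Proof.
elim: j => [|j IH]; first by rewrite expr1.
rewrite /= IH !derivZ -!scalerAl -!scalerAr !scalerA -!exprSr scalerBr; congr (_ - _).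
by rewrite scalerMnr.
Qed.

Definition rescale (c : K) (p : {poly K}) := p \Po (c *: 'X).

Lemma coef_rescale c (p : {poly K}) j : (rescale c p)`_j = c ^+ j * p`_j.
Proof.
rewrite /rescale coef_comp_poly; under eq_bigr do rewrite exprZn coefZ coefXn.
have [jp|pj] := ltnP j (size p).
  rewrite (bigD1 (Ordinal jp))//= eqxx mulr1 big1 ?addr0 1?mulrC// => i ij.
  by rewrite [j == i](_ : _ = false) ?mulr0//; apply/negbTE; rewrite eq_sym -val_eqE in ij *.
rewrite big1 => [|i _]; first by rewrite nth_default ?mulr0.
by rewrite [j == i](_ : _ = false) ?mulr0//; apply/negbTE; have := ltn_ord i; lia.
Qed.

Lemma rescale_horner0 c (p : {poly K}) : (rescale c p).[0] = p.[0].
Proof. by rewrite horner_comp hornerZ hornerX mulr0. Qed.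

(** The factor [a] serves logarithmic derivatives, where differentiating a rescaled polynomial
    produces an extra [c]. *)
Lemma quot_deriv_rescale (p q : {poly K}) c a j :
  quot_deriv (a *: rescale c p) (rescale c q) j = (a * c ^+ j) *: rescale c (quot_deriv p q j).
Proof.
rewrite /rescale; elim: j => [|j IH]; first by rewrite expr0 mulr1.
have dcomp (r : {poly K}) : (r \Po (c *: 'X))^`() = c *: (r^`() \Po (c *: 'X)).
  by rewrite deriv_comp derivZ derivX alg_polyC mulrC mul_polyC.
rewrite /= IH derivZ !dcomp comp_polyB comp_polyM -!scaler_nat comp_polyZ comp_polyM.
rewrite -!scalerAl -!scalerAr !scalerA scalerBr !scalerA exprSr mulrA.
by congr (_ *: _ - _ *: _); [rewrite mulrA|rewrite -mulrA -mulrA mulrC].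
Qed.

Lemma curve_eval_rescale F X c : curve_eval F (fun l => rescale c (X l)) = rescale c (curve_eval F X).
Proof.
rewrite /curve_eval /rescale -[RHS]/(comp_poly (c *: 'X) _) mmap_morph.
by congr (mmap _ _ F); apply/funext => a; rewrite /= comp_polyC.
Qed.

End PolynomialCurves.

(** * Holomorphic families of curves keeping F constant to order k *)

Section Deformation.
Variables (R : realType) (m : nat).
Local Notation C := (complex_field R).
Implicit Types (F : mpoly m C) (X : 'I_m -> {poly C}) (v w : 'I_m -> C).

Lemma hol0_fun_subring : fun_subring (@hol0 R).
Proof. by split; [exact: hol0_cst|exact: hol0D|exact: hol0M]. Qed.

(** Congruence modulo t^p with holomorphic quotient, between the [true] and the [false] member of
    the pair. *)
Definition hol0_cong p (u : bool * C -> C) := [/\ hol0 (fun t => u (true, t)),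
  hol0 (fun t => u (false, t)) & exists2 r : C -> C, hol0 r &
  forall t, u (true, t) = u (false, t) + t ^+ p * r t].

Lemma hol0_cong_fun_subring p : fun_subring (hol0_cong p).
Proof.
split=> [c|u v [u1 u0 [r hr ru]] [v1 v0 [s hs sv]]|u v [u1 u0 [r hr ru]] [v1 v0 [s hs sv]]].
- split; [exact: hol0_cst|exact: hol0_cst|].
  by exists (fun=> 0) => [|t]; [exact: hol0_cst|rewrite mulr0 addr0].
- split; [exact: hol0D|exact: hol0D|].
  by exists (fun t => r t + s t) => [|t]; [exact: hol0D|rewrite ru sv; ring].
- split; [exact: hol0M|exact: hol0M|].
  exists (fun t => r t * v (true, t) + u (false, t) * s t) => [|t].
    by apply: hol0D; exact: hol0M.
  by rewrite ru !sv; ring.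
Qed.

Lemma hol0_pow p : hol0 (fun t : C => t ^+ p).
Proof. by apply: hol0X; exact: hol0_id. Qed.

(** The deformation parameter is first treated as the outer variable of [{poly {poly C}}] and then
    specialized to [t]; thus each remainder [r j] is a polynomial in [t]. *)
Lemma curve_eval_first_order F X v : exists r : nat -> C -> C, (forall j, hol0 (r j)) /\
  forall t j, (curve_eval F (fun l => X l + (t * v l)%:P))`_j = (curve_eval F X)`_j +
    t * (\sum_l (curve_eval (mderiv l F) X)`_j * v l) + t ^+ 2 * r j t.
Proof.
pose f : {rmorphism C -> {poly {poly C}}} := (polyC \o polyC)%FUN.
have [B EB] := @mmap_taylor C m {poly {poly C}} f (fun l => (X l)%:P) (fun l => (v l)%:P%:P) 'X F.
exists (fun j t => \sum_(i < size B) (B`_i)`_j * t ^+ i); split=> [j|t j].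
  by apply: hol0_sum => i; apply: hol0M; [exact: hol0_cst|exact: hol0_pow].
have ev (h : 'I_m -> {poly {poly C}}) G : horner_eval t%:P (mmap f h G) =
    curve_eval G (fun l => (h l).[t%:P]).
  rewrite mmap_morph; congr (mmap _ _ G); apply/funext => c.
  by rewrite /= /horner_eval hornerC.
have XE : (fun l => (X l)%:P.[t%:P]) = X by apply/funext => l; rewrite hornerC.
have ES : horner_eval t%:P (\sum_i mmap f (fun l => (X l)%:P) (mderiv i F) * (v i)%:P%:P) =
    \sum_i curve_eval (mderiv i F) X * (v i)%:P.
  rewrite /horner_eval horner_sum; apply: eq_bigr => l _.
  by rewrite hornerM hornerC -[X in X * _]/(horner_eval _ _) ev XE.
have := congr1 (horner_eval t%:P) EB.
rewrite !rmorphD !rmorphM /= !ev.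
have -> : horner_eval t%:P 'X = t%:P by rewrite /horner_eval hornerX.
have -> : (fun l => ((X l)%:P + 'X * ((v l)%:P)%:P).[t%:P]) = (fun l => X l + (t * v l)%:P).
  by apply/funext => l; rewrite hornerD hornerM hornerX !hornerC polyCM.
rewrite XE ES => ->; rewrite !coefD coefCM -polyCM coefCM expr2; congr (_ + _ * _ + _ * _).
  by rewrite coef_sum; apply: eq_bigr => l _; rewrite coefMC.
rewrite /horner_eval horner_coef coef_sum; apply: eq_bigr => i _.
by rewrite -polyC_exp coefMC.
Qed.

Lemma hol0_differential F (x : 'I_m -> C -> C) w : (forall l, hol0 (x l)) ->
  hol0 (fun t => differential F (x ^~ t) w).
Proof.
move=> hx; apply: hol0_sum => l; apply: hol0M; last exact: hol0_cst.
exact: hol0_meval.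
Qed.

(** The coefficients of order 1, ..., k are corrected one after the other along [w], each by solving
    a linear equation whose leading coefficient is nonzero for small t. An error of size t^p needs a
    correction of size t^p only, and the correction has no constant term, so the base point moves
    exactly along [v]. *)
Lemma deform_curve F X v w k p : (0 < p)%N ->
  differential F (fun l => (X l).[0]) w != 0 ->
  (forall j, (0 < j <= k)%N -> exists2 r, hol0 r &
    forall t, (curve_eval F (fun l => X l + (t * v l)%:P))`_j = t ^+ p * r t) ->
  exists c : C -> {poly C}, [/\ coef_family (@hol0 R) c, forall t, (c t)`_0 = 0,
    forall t, (size (c t) <= k.+1)%N &
    \forall t \near (0 : C), forall j, (0 < j <= k)%N ->
      (curve_eval F (fun l => X l + (t * v l)%:P + (t ^+ p * w l) *: c t))`_j = 0].
Proof.
move=> p0 dw; elim: k => [|k IH] He.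
  exists (fun=> 0); split=> [j|t|t|].
  - rewrite (_ : (fun t => _) = fun=> 0); first exact: hol0_cst.
    by apply/funext => t; rewrite coef0.
  - by rewrite coef0.
  - by rewrite size_poly0.
  - by apply: near0W => t [|j].
have [|c [hc c0 sc nc]] := IH.
  by move=> j jk; apply: He; lia.
have [r hr rE] := He k.+1 ltac:(lia).
(* With and without the corrections found so far: the two curves, hence their images under [F],
   agree modulo t^p. *)
pose Z (bt : bool * C) l := X l + (bt.2 * v l)%:P + if bt.1 then (bt.2 ^+ p * w l) *: c bt.2 else 0.
have [_ _ [s hs sE]] : hol0_cong p (fun bt => (curve_eval F (Z bt))`_k.+1).
  apply: (@coef_family_eval C m _ (hol0_cong p) (hol0_cong_fun_subring p) F (fun l bt => Z bt l)) => l j.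
  have h1 : hol0 (fun t => (X l)`_j + (t * v l) * (j == 0%N)%:R).
    apply: hol0D; first exact: hol0_cst.
    apply: hol0M; last exact: hol0_cst.
    by apply: hol0M; [exact: hol0_id|exact: hol0_cst].
  have h2 : hol0 (fun t => w l * (c t)`_j) by apply: hol0M; [exact: hol0_cst|exact: hc].
  have E0 t : (Z (false, t) l)`_j = (X l)`_j + (t * v l) * (j == 0%N)%:R.
    by rewrite /Z /= addr0 coefD coefC; case: eqP => _; rewrite ?mulr1 ?mulr0.
  have E1 t : (Z (true, t) l)`_j = (X l)`_j + (t * v l) * (j == 0%N)%:R + t ^+ p * (w l * (c t)`_j).
    by rewrite mulrA -coefZ -E0 -coefD /Z /= addr0.
  split.
  - rewrite (_ : (fun t => _) = fun t => (X l)`_j + (t * v l) * (j == 0%N)%:R + t ^+ p * (w l * (c t)`_j)).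
      by apply: (hol0D h1); apply: (hol0M _ h2); exact: hol0_pow.
    by apply/funext => t; exact: E1.
  - rewrite (_ : (fun t => _) = fun t => (X l)`_j + (t * v l) * (j == 0%N)%:R).
      exact: h1.
    by apply/funext => t; exact: E0.
  - by exists (fun t => w l * (c t)`_j) => [|t]; [exact: h2|rewrite E1 E0].
pose d t := differential F (fun l => (X l).[0] + t * v l) w.
have hd : hol0 d.
  apply: (@hol0_differential F (fun l t => (X l).[0] + t * v l)) => l.
  apply: hol0D; first exact: hol0_cst.
  by apply: hol0M; [exact: hol0_id|exact: hol0_cst].
have d0 : d 0 != 0.
  by rewrite /d (_ : (fun l => _) = fun l => (X l).[0])//; apply/funext => l; rewrite mul0r addr0.
(* The coefficient of order [k.+1] is now t^p (r + s); adding [eta] along [w] contributes t^p [eta]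
   [d]. *)
pose eta t := - ((r t + s t) / d t).
have heta : hol0 eta.
  rewrite /eta (_ : (fun t => _) = fun t => -1 * ((r t + s t) * (d t)^-1)).
    by apply: hol0M; [exact: hol0_cst|apply: hol0M; [exact: hol0D|exact: hol0V]].
  by apply/funext => t; rewrite mulN1r.
exists (fun t => c t + eta t *: 'X^(k.+1)); split=> [j|t|t|].
- rewrite (_ : (fun t => _) = fun t => (c t)`_j + eta t * (j == k.+1)%:R).
    exact: (hol0D (hc j) (hol0M heta (hol0_cst _))).
  by apply/funext => t; rewrite coefD coefZ coefXn.
- by rewrite coefD c0 coefZ coefXn mulr0 addr0.
- rewrite (leq_trans (size_polyD _ _))// geq_max (leq_trans (sc t))//=.
  by rewrite (leq_trans (size_scale_leq _ _))// size_polyXn.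
move: nc (hol0_neq0 hd d0); apply: near0S2 => t nc dt j jk.
have -> : (fun l => X l + (t * v l)%:P + (t ^+ p * w l) *: (c t + eta t *: 'X^(k.+1))) =
   (fun l => Z (true, t) l + (t ^+ p * eta t * w l) *: 'X^(k.+1)).
  by apply/funext => l; rewrite /Z /= scalerDr scalerA addrA mulrAC.
rewrite curve_eval_step//; last by lia.
case: eqVneq => [->|jk'].
  rewrite sE /Z /=.
  have -> : (fun l => X l + (t * v l)%:P + 0) = (fun l => X l + (t * v l)%:P).
    by apply/funext => l; rewrite addr0.
  rewrite rE.
  have -> : (fun l => (X l + (t * v l)%:P + (t ^+ p * w l) *: c t).[0]) =
      (fun l => (X l).[0] + t * v l).
    by apply/funext => l; rewrite !hornerD hornerC hornerZ (horner_coef0 (c t)) c0 mulr0 addr0.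
  rewrite -/(d t) /eta; move: (d t) (r t) (s t) (t ^+ p) dt => a b e f a0.
  by field.
by rewrite addr0 nc//; lia.
Qed.

End Deformation.

(** * Log jet differentials as functions on jets of lifted curves *)

Section ProjectiveCurves.
Variables (R : realType) (n : nat).
Local Notation C := (complex_field R).
Local Notation Pn := (projective_space C n).

Lemma hol0P (f : C -> C) : hol0 f <-> \forall t \near (0 : C), differentiable f t.
Proof.
Transparent hol0.
by split; apply: near0S => t; rewrite derivable1_diffP.
Opaque hol0.
Qed.

Lemma differentiable_row (y : 'I_n -> C -> C) t : (forall j, differentiable (y j) t) ->
  differentiable (fun u => \row_j y j u) t.
Proof.
move=> dy; have -> : (fun u => \row_j y j u) = \sum_(j < n) (fun u => y j u *: delta_mx 0 j).
  apply/funext => u; rewrite fct_sumE; apply/rowP => j.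
  rewrite mxE summxE (bigD1 j)//= !mxE !eqxx mulr1 big1 ?addr0// => l lj.
  by rewrite !mxE eqxx eq_sym (negbTE lj) mulr0.
by apply: differentiable_sum => j; exact: differentiableZl.
Qed.

Lemma near0_open_row (y : 'I_n -> C -> C) (V : set 'rV[C]_n) : (forall j, hol0 (y j)) ->
  open V -> V (\row_j y j 0) -> \forall t \near (0 : C), V (\row_j y j t).
Proof.
move=> hy oV V0; have cy : {for (0 : C), continuous (fun u => \row_j y j u)}.
  apply: differentiable_continuous; apply: differentiable_row => j.
  by have /hol0P/nbhs_singleton := hy j.
by apply: cy; apply: open_nbhs_nbhs; split.
Qed.

Lemma hol0_comp_row (y : 'I_n -> C -> C) (V : set 'rV[C]_n) (a : 'rV[C]_n -> C) :
  (forall j, hol0 (y j)) -> open V -> V (\row_j y j 0) ->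
  (forall x, V x -> differentiable a x) -> hol0 (fun t => a (\row_j y j t)).
Proof.
move=> hy oV V0 da; apply/hol0P.
have hy' : \forall t \near (0 : C), forall j, differentiable (y j) t.
  apply: (@filter_forall C 'I_n (fun j t => differentiable (y j) t) _ (nbhs_filter (0 : C))) => j.
  by have /hol0P := hy j.
move: hy' (near0_open_row hy oV V0); apply: near0S2 => t dyt Vt.
apply: (@differentiable_comp _ _ _ _ (fun u => \row_j y j u) a); last exact: da.
exact: differentiable_row.
Qed.

(** The replacement at 0 makes the spanned line one-dimensional in all cases, so that [to_Pn] is
    total. *)
Definition nonzero_row (v : 'rV[C]_n.+1) : 'rV[C]_n.+1 := if v == 0 then const_mx 1 else v.

Lemma dim_line_rV (v : 'rV[C]_n.+1) : \dim <[nonzero_row v]>%VS == 1%N.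
Proof.
rewrite dim_vline (_ : nonzero_row v != 0)//; rewrite /nonzero_row.
case: (eqVneq v 0) => [_|//]; apply/negP => /eqP/rowP/(_ 0).
by rewrite !mxE => /eqP; rewrite oner_eq0.
Qed.

(* The point with homogeneous coordinates v; junk for v = 0. *)
Definition to_Pn (v : 'rV[C]_n.+1) : Pn := exist _ <[nonzero_row v]>%VS (dim_line_rV v).

Lemma hcoord_to_Pn (v : 'rV[C]_n.+1) : v != 0 ->
  exists2 c : C, c != 0 & forall l, hcoord (to_Pn v) l = c * v 0 l.
Proof.
move=> v0; rewrite /hcoord /to_Pn /= /nonzero_row (negbTE v0).
have /vlineP[c E] : vpick <[v]>%VS \in <[v]>%VS by exact: memv_pick.
exists c; last by move=> l; rewrite E mxE.
apply: contraNneq v0 => c0; have : vpick <[v]>%VS == 0 by rewrite E c0 scale0r.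
rewrite vpick0 => /eqP V0; have := memv_line v; rewrite V0 memv0.
by [].
Qed.

End ProjectiveCurves.

(** * Local sections evaluated on lifted jets *)

Section LocalSections.
Variables (R : realType) (n delta k m : nat).
Local Notation C := (complex_field R).
Local Notation Pn := (projective_space C n).
Variable F : mpoly n.+1 C.
Hypothesis F_homog : F \is ishomog1 delta mdeg.
Hypothesis delta_gt0 : (0 < delta)%N.
Implicit Types (X Y : 'I_n.+1 -> {poly C}) (i : 'I_n.+1) (f : C -> Pn).

Lemma near_neq0_base X i : (X i).[0] != 0 -> \forall t \near (0 : C), (X i).[t] != 0.
Proof. by move=> xi; apply: (@hol0_neq0 R (horner (X i))) => //; exact: hol0_horner. Qed.

Definition ratio X i l (t : C) := (X l).[t] / (X i).[t].

Lemma hol0_ratio X i l : (X i).[0] != 0 -> hol0 (ratio X i l).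
Proof.
move=> xi; apply: hol0M; first exact: hol0_horner.
by apply: (@hol0V R (horner (X i))) => //; exact: hol0_horner.
Qed.

Definition base_chart X i : 'rV[C]_n := \row_j ((X (lift i j)).[0] / (X i).[0]).

(** In the case [None] this is the derivative of order [j.+1] at 0 of - delta log X_i. It requires
    only that X_i does not vanish at 0, and so makes sense over the divisor. *)
Definition jet_value X i (j : nat) (v : option 'I_n) : C := match v with
  | Some l => (quot_deriv (X (lift i l)) (X i) j.+1).[0] / (X i).[0] ^+ j.+2
  | None => - (delta%:R * ((quot_deriv (X i)^`() (X i) j).[0] / (X i).[0] ^+ j.+1))
  end.

Definition local_value X i (a : exponents n k m -> 'rV[C]_n -> C) : C :=
  \sum_(e : exponents n k m | weight e == m) a e (base_chart X i) *
    \prod_(jv : 'I_k * option 'I_n) jet_value X i jv.1 jv.2 ^+ e jv.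

Lemma local_value_congr X Y i a : base_chart X i = base_chart Y i ->
  (forall j v, jet_value X i j v = jet_value Y i j v) ->
  local_value X i a = local_value Y i a.
Proof.
move=> E H.
have P (e : exponents n k m) : a e (base_chart X i) *
      \prod_(jv : 'I_k * option 'I_n) jet_value X i jv.1 jv.2 ^+ e jv =
    a e (base_chart Y i) * \prod_(jv : 'I_k * option 'I_n) jet_value Y i jv.1 jv.2 ^+ e jv :> C.
  rewrite E; apply: (f_equal (GRing.mul _)); apply: eq_bigr => jv _.
  by rewrite (H jv.1 jv.2).
by apply: eq_bigr => e _; exact: P.
Qed.

(** The coefficient of order 0 is unrestricted, so jets based on the divisor are included. *)
Definition unit_jet X := forall j, (0 < j <= k)%N -> (curve_eval F X)`_j = 0.

Definition form_at X := meval (fun l => (X l).[0]) F.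

Section Comparison.
Variables (f : C -> Pn) (X : 'I_n.+1 -> {poly C}) (i : 'I_n.+1).
Hypothesis Xi0 : (X i).[0] != 0.
Hypothesis jetX : unit_jet X.
Hypothesis FX0 : form_at X != 0.
Hypothesis fX : forall l, jet_eq k (fun t => hcoord (f t) l / hcoord (f t) i) (ratio X i l).

Lemma log_jet_component j l : (j < k)%N -> log_jet F i f j (Some l) 0 = jet_value X i j (Some l).
Proof.
move=> jk; rewrite /log_jet derive1n_dCn.
have -> : (fun u => chart i (f u) 0 l) = (fun u => hcoord (f u) (lift i l) / hcoord (f u) i).
  by apply/funext => u; rewrite mxE.
rewrite (jet_eq_dCn (fX (lift i l)) jk).
exact: (nbhs_singleton (dCn_quotient (X (lift i l)) j.+1 Xi0)).
Qed.

(** By homogeneity the local equation along the curve is F(X) / X_i^delta, and F(X) is constant to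
    order [k]. *)
Lemma local_equation_jet :
  jet_eq k (fun t => local_equation F i (f t)) (fun t => form_at X / ((X i).[t]) ^+ delta).
Proof.
have XiP : hol0 (fun t => ((X i).[t] ^+ delta)^-1).
  by apply: hol0V; [apply: hol0X; exact: hol0_horner|rewrite expf_neq0].
have E1 := @jet_eq_meval R k n.+1 F (fun l t => hcoord (f t) l / hcoord (f t) i) (ratio X i) fX.
apply: (jet_eq_trans E1).
have E2 : jet_eq k (horner (curve_eval F X)) (horner (form_at X)%:P).
  apply: jet_eq_horner => -[|j] jk; last by rewrite coefC jetX.
  by rewrite coefC /= -horner_coef0 horner_curve_eval.
have E3 := jet_eqM E2 (jet_eq_refl k XiP).
apply: jet_eq_near E3; last by apply: near0W => t; rewrite hornerC.
apply: near0W => t; rewrite horner_curve_eval mulrC -exprVn -(meval_homog _ _ F_homog).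
by congr (meval _ F); apply/funext => l; rewrite mulrC.
Qed.

Lemma log_jet_equation j : (j < k)%N -> log_jet F i f j None 0 = jet_value X i j None.
Proof.
move=> jk; rewrite /log_jet derive1n_dCn.
pose g t := local_equation F i (f t).
change (dCn j (fun u => dC g u / g u) 0 = jet_value X i j None).
(* A logarithmic derivative costs one order: jets equal to order [k'.+1] give logarithmic
   derivatives equal to order [k']. *)
case: k jk local_equation_jet => [//|k'] jk' Hg.
have [h hE] : exists h : C -> C, h = (fun t => form_at X / ((X i).[t]) ^+ delta) by eexists.
rewrite -hE in Hg.
have h0 : h 0 != 0 by rewrite hE mulf_neq0// invr_eq0 expf_neq0.
have [hg hh g0 Hg'] := (jet_eqS _ _ _).1 Hg.
have gn0 : g 0 != 0 by rewrite /g g0.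
have E1 : jet_eq k' (fun u => dC g u / g u) (fun u => dC h u / h u).
  exact: (jet_eqM Hg' (jet_eqV gn0 (jet_eqW (leqnSn k') Hg))).
rewrite (jet_eq_dCn E1 jk').
pose q : {poly C} := X i ^+ delta.
have hq : hol0 (horner q) by exact: hol0_horner.
have Xn0 := near_neq0_base Xi0.
(* The product of [h] and X_i^delta is constant; differentiating it gives h'/h = - delta
   X_i'/X_i. *)
have Ec : \forall t \near (0 : C), dC (fun t => h t * q.[t]) t = 0.
  have Ec0 : \forall t \near (0 : C), h t * q.[t] = ((form_at X)%:P).[t].
    move: Xn0; apply: near0S => t Xt.
    by rewrite hornerC hE /q horner_exp divfK// expf_neq0.
  by move: (dC_near Ec0); apply: near0S => t ->; rewrite dC_horner derivC horner0.
have Ehq := near_dCM hh hq.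
have E2 : \forall t \near (0 : C), dC h t / h t = (- (delta%:R *: (X i)^`())).[t] / (X i).[t].
  have nh := hol0_neq0 hh h0.
  move: (near0S2 (fun t a b => conj a b) Ec Ehq) (near0S2 (fun t a b => conj a b) Xn0 nh).
  apply: near0S2 => t [-> E] [Xt ht].
  have {}E : dC h t * q.[t] = - (h t * dC (horner q) t).
    by apply/eqP; rewrite -addr_eq0 E.
  have qt : q.[t] != 0 by rewrite /q horner_exp expf_neq0.
  have -> : dC h t = - (h t * dC (horner q) t) / q.[t] by rewrite -E mulfK.
  rewrite dC_horner /q deriv_exp hornerMn hornerM !horner_exp hornerN hornerZ.
  rewrite -[delta]prednK// [in _ ^+ _.+1]exprS.
  have := expf_neq0 delta.-1 Xt.
  move: (h t) (X i).[t] ((X i)^`()).[t] ht Xt => a b c a0 b0; rewrite /=.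
  move: (b ^+ delta.-1) => d d0; rewrite -[c * d *+ _]mulr_natl.
  move: (delta.-1.+1%:R) => N.
  by field; rewrite a0 b0 d0.
have := nbhs_singleton (dCn_near j E2); rewrite /= => ->.
have := nbhs_singleton (dCn_quotient (- (delta%:R *: (X i)^`())) j Xi0); rewrite /= => ->.
(* Linearity in the numerator is the case [c = 1] of [quot_deriv_rescale]. *)
have -> : quot_deriv (- (delta%:R *: (X i)^`())) (X i) j = - (delta%:R *: quot_deriv (X i)^`() (X i) j).
  rewrite -scaleNr; have resc (c : C) (p : {poly C}) : rescale 1 p = p.
    by apply/polyP => l; rewrite coef_rescale expr1n mul1r.
  have := quot_deriv_rescale (X i)^`() (X i) 1 (- delta%:R) j.
  by rewrite !(resc 0) expr1n mulr1 => ->; rewrite scaleNr.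
by rewrite hornerN hornerZ mulNr mulrA.
Qed.

Lemma base_chartE : base_chart X i = chart i (f 0).
Proof.
apply/rowP => l; rewrite !mxE; have [_ _ /(_ 0%N (leq0n k)) /= E] := fX (lift i l).
by rewrite [RHS]E.
Qed.

Lemma local_valueE a : local_value X i a = \sum_(e : exponents n k m | weight e == m)
  a e (chart i (f 0)) * \prod_(jv : 'I_k * option 'I_n) log_jet F i f jv.1 jv.2 0 ^+ e jv.
Proof.
apply: eq_bigr => e _; rewrite base_chartE; congr (_ * _); apply: eq_bigr => -[j [l|]] _.
  by congr (_ ^+ _); symmetry; exact: log_jet_component.
by congr (_ ^+ _); symmetry; exact: log_jet_equation.
Qed.

End Comparison.

Lemma form_at_neq0 X : form_at X != 0 -> exists i, (X i).[0] != 0.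
Proof.
move=> FX; apply: contrapT => H; move/negP: FX; apply.
have E : (fun l => (X l).[0]) = (fun l => 0 * (X l).[0]).
  apply/funext => l; rewrite mul0r; apply/eqP; apply: contrapT => /negP h.
  by apply: H; exists l.
by rewrite /form_at E (meval_homog _ _ F_homog) expr0n gtn_eqF// mul0r.
Qed.

Definition projective_curve X (t : C) : Pn := to_Pn (\row_l (X l).[t]).

Lemma hcoord_ratio X i t : (X i).[t] != 0 ->
  hcoord (projective_curve X t) i != 0 /\
  forall l, hcoord (projective_curve X t) l / hcoord (projective_curve X t) i = ratio X i l t.
Proof.
move=> xi; have v0 : \row_l (X l).[t] != 0.
  by apply: contraNneq xi => /rowP/(_ i); rewrite !mxE => ->.
have [c c0 H] := hcoord_to_Pn v0.
rewrite /projective_curve !H mxE mulf_neq0//; split=> // l.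
by rewrite /ratio !H !mxE -mulf_div divff// mul1r.
Qed.

Lemma near_hcoord_ratio X i l : (X i).[0] != 0 -> \forall t \near (0 : C),
  ratio X i l t = hcoord (projective_curve X t) l / hcoord (projective_curve X t) i.
Proof.
by move=> /near_neq0_base; apply: near0S => t /hcoord_ratio[_ H]; rewrite H.
Qed.

Lemma projective_curve_off_divisor X : form_at X != 0 ->
  holomorphic_germ_off_divisor F (projective_curve X).
Proof.
move=> FX; have [i xi] := form_at_neq0 FX; split; last first.
  have hF : hol0 (fun t => meval (fun l => (X l).[t]) F).
    by apply: hol0_meval => l; exact: hol0_horner.
  move: (near_neq0_base xi) (hol0_neq0 hF FX); apply: near0S2 => t xt Ft.
  have v0 : \row_l (X l).[t] != 0.
    by apply: contraNneq xt => /rowP/(_ i); rewrite !mxE => ->.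
  have [c c0 H] := hcoord_to_Pn v0; rewrite /divisor /projective_curve.
  have -> : hcoord (to_Pn (\row_l (X l).[t])) = (fun l => c * (X l).[t]).
    by apply/funext => l; rewrite H mxE.
  rewrite (meval_homog _ _ F_homog); apply/eqP; rewrite mulf_neq0//.
  by rewrite expf_neq0.
exists i; split; first by move: (near_neq0_base xi); apply: near0S => t /hcoord_ratio[].
have hr : \forall t \near (0 : C), forall j, differentiable (ratio X i (lift i j)) t.
  apply: (@filter_forall C 'I_n (fun j t => differentiable (ratio X i (lift i j)) t) _
     (nbhs_filter (0 : C))) => j.
  by have /hol0P := hol0_ratio (lift i j) xi.
have := near0_near (near_neq0_base xi); move: hr; apply: near0S2 => t dr nt.
apply/derivable1_diffP; apply: (@near_eq_derivable _ _ _ (fun u => \row_j ratio X i (lift i j) u)).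
  apply: filterS nt => u /hcoord_ratio[_ H]; apply/rowP => j.
  by rewrite !mxE H.
by apply/derivable1_diffP; exact: differentiable_row.
Qed.

End LocalSections.

(** * The global function on jets *)

Section ValueFunction.
Variables (R : realType) (n delta k m : nat).
Local Notation C := (complex_field R).
Local Notation Pn := (projective_space C n).
Variable F : mpoly n.+1 C.
Hypothesis F_homog : F \is ishomog1 delta mdeg.
Hypothesis delta_gt0 : (0 < delta)%N.
Hypothesis F_smooth : forall x : 'I_n.+1 -> C, (exists l, x l != 0) ->
  exists w, differential F x w != 0.
Variable Q : curve_operator C n.
Hypothesis Q_global : global_log_jet_differential F k m Q.
Implicit Types (X Y : 'I_n.+1 -> {poly C}) (i : 'I_n.+1) (f : C -> Pn).
Local Notation local_value := (@local_value R n delta k m).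
Local Notation unit_jet := (@unit_jet R n k F).

Definition local_datum i (V : set 'rV[C]_n) (a : exponents n k m -> 'rV[C]_n -> C) :=
  [/\ open V, (forall e x, V x -> differentiable (a e) x) &
    forall f : C -> Pn, holomorphic_germ_off_divisor F f ->
      in_chart i (f 0) -> V (chart i (f 0)) ->
      \forall t \near (0 : C),
        Q f t = \sum_(e : exponents n k m | weight e == m)
          a e (chart i (f t)) *
          \prod_(jv : 'I_k * option 'I_n) log_jet F i f jv.1 jv.2 t ^+ e jv].

Lemma local_datum_exists i z : exists V a, V z /\ local_datum i V a.
Proof. by have [V [a [? ? ? ?]]] := Q_global i z; exists V, a. Qed.

Lemma operator_local_value f X i V a : local_datum i V a ->
  holomorphic_germ_off_divisor F f -> in_chart i (f 0) ->
  (X i).[0] != 0 -> unit_jet X -> form_at F X != 0 ->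
  (forall l, jet_eq k (fun t => hcoord (f t) l / hcoord (f t) i) (ratio X i l)) ->
  V (base_chart X i) -> Q f 0 = local_value X i a.
Proof.
move=> [oV da HQ] hf fi Xi0 uX FX fX VX.
rewrite (local_valueE F_homog delta_gt0 Xi0 uX FX fX).
by rewrite (base_chartE fX) in VX; have := nbhs_singleton (HQ f hf fi VX).
Qed.

(** The left side mentions neither chart nor coefficients; off the divisor this settles independence
    of the local data. *)
Lemma local_value_off_divisor X i V a : local_datum i V a ->
  (X i).[0] != 0 -> unit_jet X -> form_at F X != 0 -> V (base_chart X i) ->
  Q (projective_curve X) 0 = local_value X i a.
Proof.
move=> Hd Xi0 uX FX VX; have Hf := projective_curve_off_divisor F_homog delta_gt0 FX.
apply: (operator_local_value Hd Hf (hcoord_ratio Xi0).1 Xi0 uX FX _ VX) => l.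
apply: jet_eq_near (jet_eq_refl k (hol0_ratio l Xi0)); first exact: near_hcoord_ratio.
by apply: near0W => t.
Qed.

Section Family.
Variables (Xt : C -> 'I_n.+1 -> {poly C}) (i : 'I_n.+1) (V : set 'rV[C]_n)
  (a : exponents n k m -> 'rV[C]_n -> C).
Hypothesis hX : forall l, coef_family (@hol0 R) (fun t => Xt t l).
Hypothesis Xi0 : (Xt 0 i).[0] != 0.
Hypothesis Hd : local_datum i V a.
Hypothesis VX : V (base_chart (Xt 0) i).

Let hol_base l : hol0 (fun t => (Xt t l).[0]).
Proof.
rewrite (_ : (fun t => _) = fun t => (Xt t l)`_0); first exact: hX.
by apply/funext => t; rewrite horner_coef0.
Qed.

Let hol_base_chart j : hol0 (fun t => (Xt t (lift i j)).[0] / (Xt t i).[0]).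
Proof. exact: (hol0M (hol_base _) (hol0V (hol_base i) Xi0)). Qed.

Lemma near_family_chart : \forall t \near (0 : C), (Xt t i).[0] != 0 /\ V (base_chart (Xt t) i).
Proof.
have [oV _ _] := Hd.
exact: (near0S2 (fun t a b => conj a b) (hol0_neq0 (hol_base i) Xi0) (near0_open_row hol_base_chart oV VX)).
Qed.

Lemma hol0_local_value : hol0 (fun t => local_value (Xt t) i a).
Proof.
have [oV da _] := Hd.
have hq p q j : coef_family (@hol0 R) p -> coef_family (@hol0 R) q ->
    hol0 (fun t => (quot_deriv (p t) (q t) j).[0]).
  move=> hp hq; rewrite (_ : (fun t => _) = fun t => (quot_deriv (p t) (q t) j)`_0).
    exact: (coef_family_quot (hol0_fun_subring R) j hp hq).
  by apply/funext => t; rewrite horner_coef0.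
have hden j : hol0 (fun t => ((Xt t i).[0] ^+ j)^-1).
  by apply: (hol0V (hol0X j (hol_base i))); rewrite expf_neq0.
have hjet j v : hol0 (fun t => jet_value delta (Xt t) i j v).
  case: v => [l|] /=; first exact: (hol0M (hq (fun t => Xt t (lift i l)) (fun t => Xt t i) j.+1 (hX _) (hX i)) (hden j.+2)).
  rewrite (_ : (fun t => _) = fun t => (- delta%:R) *
     ((quot_deriv (Xt t i)^`() (Xt t i) j).[0] * ((Xt t i).[0] ^+ j.+1)^-1)).
    have hd := hq (fun t => (Xt t i)^`()) (fun t => Xt t i) j
      (coef_family_deriv (hol0_fun_subring R) (hX i)) (hX i).
    exact: (hol0M (hol0_cst (- delta%:R)) (hol0M hd (hden j.+1))).
  by apply/funext => t; rewrite mulNr.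
apply: hol0_sum => e; apply: hol0M.
  exact: (hol0_comp_row hol_base_chart oV VX (da e)).
by apply: hol0_prod => jv; apply: hol0X; exact: hjet.
Qed.

End Family.

Lemma near0_punctured_limit (u : C -> C) : hol0 u ->
  (\forall t \near (0 : C), t != 0 -> u t = 0) -> u 0 = 0.
Proof.
move=> /hol0_continuous/continuous_nrmP cu /nbhs_nrmP[r r0 H].
apply/eqP; rewrite -nrm_eq0; apply/eqP; apply: le_anti; rewrite nrm_ge0 andbT leNgt.
apply/negP => u0; have [s s0 K] := cu _ u0.
pose t := rc (Num.min r s / 2).
have rs : 0 < Num.min r s by rewrite lt_min r0.
have tn : nrm t = Num.min r s / 2 by rewrite nrm_rc ger0_norm// divr_ge0// ltW.
have t0 : t != 0 by rewrite -nrm_gt0 tn; lra.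
have mr : Num.min r s <= r by rewrite ge_min lexx.
have ms : Num.min r s <= s by rewrite ge_min lexx orbT.
have ut : u t = 0 by apply: H => //; rewrite subr0 tn; lra.
have := K t; rewrite subr0 tn ut sub0r nrmN ltxx => /(_ ltac:(lra)).
by [].
Qed.

Lemma hol0_affine (b v : C) : hol0 (fun t => b + t * v).
Proof. exact: (hol0D (hol0_cst b) (hol0M (hol0_id R) (hol0_cst v))). Qed.

Lemma coef_family_deformed X v w p (c : C -> {poly C}) l : coef_family (@hol0 R) c ->
  coef_family (@hol0 R) (fun t => X l + (t * v l)%:P + (t ^+ p * w l) *: c t).
Proof.
move=> hc j; rewrite (_ : (fun t => _) = fun t => ((X l)`_j + t * (v l * (j == 0%N)%:R)) +
    (t ^+ p * w l) * (c t)`_j).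
  apply: (hol0D (hol0_affine _ _)); apply: (hol0M _ (hc j)).
  exact: (hol0M (hol0_pow R p) (hol0_cst _)).
apply/funext => t; rewrite !coefD coefC coefZ mulrA.
by case: (j == 0%N); rewrite ?mulr1 ?mulr0.
Qed.

(** Over the divisor the jet is deformed through unit jets in a direction [w] transversal to it. For
    small t other than 0 the deformed jets lie off the divisor, where both expressions equal the
    operator, and continuity gives t = 0. *)
Lemma local_value_unique X i i' V V' a a' : unit_jet X ->
  local_datum i V a -> (X i).[0] != 0 -> V (base_chart X i) ->
  local_datum i' V' a' -> (X i').[0] != 0 -> V' (base_chart X i') ->
  local_value X i a = local_value X i' a'.
Proof.
move=> uX Hd xi VX Hd' xi' VX'.
have [FX|FX] := eqVneq (form_at F X) 0; last first.
  by rewrite -(local_value_off_divisor Hd xi uX FX VX) (local_value_off_divisor Hd' xi' uX FX VX').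
have [|w dw] := F_smooth (x := fun l => (X l).[0]); first by exists i.
have [r [hr rE]] := curve_eval_first_order F X w.
have [|c [hc c0 _ nc]] := @deform_curve R n.+1 F X w w k 1 isT dw.
  move=> j jk; exists (fun t => (\sum_l (curve_eval (mderiv l F) X)`_j * w l) + t * r j t).
    exact: (hol0D (hol0_cst _) (hol0M (hol0_id R) (hr j))).
  by move=> t; rewrite rE uX// add0r expr1 mulrDr expr2 mulrA.
pose Xt t l := X l + (t * w l)%:P + (t ^+ 1 * w l) *: c t.
have hX l : coef_family (@hol0 R) (fun t => Xt t l) by exact: coef_family_deformed.
have X0 : Xt 0 = X.
  by apply/funext => l; rewrite /Xt !mul0r addr0 scale0r addr0.
have xi0 : (Xt 0 i).[0] != 0 by rewrite X0.
have xi'0 : (Xt 0 i').[0] != 0 by rewrite X0.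
have V0 : V (base_chart (Xt 0) i) by rewrite X0.
have V'0 : V' (base_chart (Xt 0) i') by rewrite X0.
have hL := hol0_local_value hX xi0 Hd V0.
have hL' := hol0_local_value hX xi'0 Hd' V'0.
apply/eqP; rewrite -subr_eq0; apply/eqP.
have := @near0_punctured_limit (fun t => local_value (Xt t) i a - local_value (Xt t) i' a').
rewrite /= X0; apply.
  exact: hol0B.
(* The value of [F] at the base point of [Xt t] is [t * d t]. *)
pose d t := differential F (fun l => (X l).[0]) w + t * r 0%N t.
have hd : hol0 d by exact: (hol0D (hol0_cst _) (hol0M (hol0_id R) (hr 0%N))).
have d0 : d 0 != 0 by rewrite /d mul0r addr0.
move: (near0S2 (fun t a b => conj a b) (near_family_chart hX xi0 Hd V0)
  (near_family_chart hX xi'0 Hd' V'0))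
  (near0S2 (fun t a b => conj a b) nc (hol0_neq0 hd d0)).
apply: near0S2 => t [[xt Vt] [xt' Vt']] [ut dt] t0.
have Ft : form_at F (Xt t) != 0.
  have -> : form_at F (Xt t) = (curve_eval F (fun l => X l + (t * w l)%:P))`_0.
    rewrite -horner_coef0 horner_curve_eval; congr (meval _ F); apply/funext => l.
    by rewrite /Xt !hornerD !hornerC hornerZ horner_coef0 (horner_coef0 (c t)) c0 mulr0 addr0.
  rewrite rE -horner_coef0 horner_curve_eval -/(form_at F X) FX add0r.
  have -> : \sum_l (curve_eval (mderiv l F) X)`_0 * w l = differential F (fun l => (X l).[0]) w.
    by apply: eq_bigr => l _; rewrite -horner_coef0 horner_curve_eval.
  by rewrite expr2 -mulrA -mulrDr mulf_neq0.
rewrite -(local_value_off_divisor Hd xt ut Ft Vt).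
by rewrite -(local_value_off_divisor Hd' xt' ut Ft Vt') subrr.
Qed.

Definition is_value X (v : C) := exists i V a, [/\ local_datum i V a, (X i).[0] != 0,
  V (base_chart X i) & v = local_value X i a].

(** The function G of the overview. On unit jets with nonzero base point the choice is immaterial by
    [valueE]; the default 0 occurs only when the base point is 0. *)
Definition value X : C := xget 0 [set v | is_value X v].

Lemma valueE X i V a : unit_jet X -> local_datum i V a -> (X i).[0] != 0 ->
  V (base_chart X i) -> value X = local_value X i a.
Proof.
move=> uX Hd xi VX; rewrite /value.
have /(xgetPex 0) : [set v | is_value X v] !=set0.
  by exists (local_value X i a), i, V, a.
move=> [i' [V' [a' [Hd' xi' VX' E]]]]; rewrite [LHS]E.
exact: (local_value_unique uX Hd' xi' VX' Hd xi VX).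
Qed.

Lemma value_local X i : (X i).[0] != 0 -> unit_jet X ->
  exists V a, [/\ local_datum i V a, V (base_chart X i) & value X = local_value X i a].
Proof.
move=> xi uX; have [V [a [VX Hd]]] := local_datum_exists i (base_chart X i).
by exists V, a; split => //; exact: (valueE uX Hd).
Qed.

Lemma jet_valueZ X i (c : C) j v : c != 0 ->
  jet_value delta (fun l => c *: X l) i j v = jet_value delta X i j v.
Proof.
move=> c0; case: v => [l|]; rewrite /jet_value ?derivZ quot_derivZ !hornerZ exprMn.
  by rewrite -mulf_div divff ?mul1r// expf_neq0.
by rewrite -mulf_div divff ?mul1r// expf_neq0.
Qed.

Lemma base_chartZ X i (c : C) : c != 0 -> base_chart (fun l => c *: X l) i = base_chart X i.
Proof. by move=> c0; apply/rowP => l; rewrite !mxE !hornerZ -mulf_div divff// mul1r. Qed.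

Lemma valueZ X (c : C) : c != 0 -> unit_jet X -> (exists i, (X i).[0] != 0) ->
  unit_jet (fun l => c *: X l) /\ value (fun l => c *: X l) = value X.
Proof.
move=> c0 uX [i xi].
have uZ : unit_jet (fun l => c *: X l).
  move=> j jk; have -> : (fun l => c *: X l) = (fun l => c%:P * X l).
    by apply/funext => l; rewrite mul_polyC.
  by rewrite (curve_eval_homog _ _ F_homog) -polyC_exp coefCM uX// mulr0.
split; [exact: uZ|]; have [V [a [Hd VX ->]]] := value_local xi uX.
have cxi : (c *: X i).[0] != 0 by rewrite hornerZ mulf_neq0.
rewrite (valueE uZ Hd cxi); last by rewrite base_chartZ.
by apply: local_value_congr => [|j v]; [exact: base_chartZ|exact: jet_valueZ].
Qed.

Lemma jet_value_rescale X i (c : C) j v :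
  jet_value delta (fun l => rescale c (X l)) i j v = c ^+ j.+1 * jet_value delta X i j v.
Proof.
case: v => [l|]; rewrite /jet_value rescale_horner0.
  have := quot_deriv_rescale (X (lift i l)) (X i) c 1 j.+1.
  by rewrite scale1r mul1r => ->; rewrite hornerZ rescale_horner0 mulrA.
have -> : (rescale c (X i))^`() = c *: rescale c (X i)^`().
  by rewrite /rescale deriv_comp derivZ derivX alg_polyC mulrC mul_polyC.
rewrite quot_deriv_rescale hornerZ rescale_horner0 -exprS mulrN; congr (- _).
by rewrite -mulrA mulrCA.
Qed.

(** Reparametrization by c t multiplies a derivative of order j by c^j, and every monomial has
    weight [m]. The case [c = 0] is included: for positive [m] it gives the value 0 on constant
    jets. *)
Lemma value_rescale X (c : C) : unit_jet X -> (exists i, (X i).[0] != 0) ->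
  unit_jet (fun l => rescale c (X l)) /\ value (fun l => rescale c (X l)) = c ^+ m * value X.
Proof.
move=> uX [i xi].
have uZ : unit_jet (fun l => rescale c (X l)).
  by move=> j jk; rewrite curve_eval_rescale coef_rescale uX// mulr0.
split; [exact: uZ|]; have [V [a [Hd VX ->]]] := value_local xi uX.
have cE : base_chart (fun l => rescale c (X l)) i = base_chart X i.
  by apply/rowP => l; rewrite !mxE !rescale_horner0.
rewrite (valueE uZ Hd); [|by rewrite rescale_horner0|by rewrite cE].
rewrite /local_value cE big_distrr; apply: eq_bigr => e /eqP we /=.
rewrite mulrCA; congr (_ * _); rewrite -[in c ^+ _]we /weight.
rewrite -prodrXr -big_split; apply: eq_bigr => jv _ /=.
by rewrite jet_value_rescale exprMn exprM.
Qed.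

Lemma hol0_value (Xt : C -> 'I_n.+1 -> {poly C}) i :
  (forall l, coef_family (@hol0 R) (fun t => Xt t l)) -> (Xt 0 i).[0] != 0 ->
  (\forall t \near (0 : C), unit_jet (Xt t)) -> hol0 (fun t => value (Xt t)).
Proof.
move=> hX xi ut; have [V [a [Hd VX _]]] := value_local xi (nbhs_singleton ut).
apply: hol0_near (hol0_local_value hX xi Hd VX).
move: ut (near_family_chart hX xi Hd VX); apply: near0S2 => t ut [xt Vt].
by rewrite (valueE ut Hd xt Vt).
Qed.

(** Truncated, this is a power of F(p) with exponent -1/delta, found without taking a root:
    multiplying by 1 + c X^(k+1) moves the jet along its own base point x, and there dF(x) x = delta
    F(x) is nonzero by Euler's identity. *)
Lemma unit_jet_normalization (p : 'I_n.+1 -> {poly C}) : form_at F p != 0 ->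
  exists mu : {poly C}, mu.[0] = 1 /\ unit_jet (fun l => mu * p l).
Proof.
move=> Fp; rewrite /unit_jet; elim: k => [|k' [mu [mu0 IH]]].
  by exists 1; split=> [|j]; [rewrite hornerC|case: j].
pose X l := mu * p l.
have X0 : (fun l => (X l).[0]) = (fun l => (p l).[0]).
  by apply/funext => l; rewrite hornerM mu0 mul1r.
have FX : meval (fun l => (X l).[0]) F != 0 by rewrite X0.
have dF0 : delta%:R * meval (fun l => (X l).[0]) F != 0.
  by rewrite mulf_neq0// pnatr_eq0 -lt0n.
pose c := - ((curve_eval F X)`_(k'.+1) / (delta%:R * meval (fun l => (X l).[0]) F)).
exists ((1 + c *: 'X^(k'.+1)) * mu); split.
  by rewrite hornerM hornerD hornerC hornerZ hornerXn expr0n mulr0 addr0 mul1r.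
move=> j /andP[j0 jk].
rewrite (@curve_eval_trunc _ _ F _ (fun l => X l + (c * (X l).[0]) *: 'X^(k'.+1)) k'.+1)//.
  rewrite curve_eval_step// (differential_euler _ F_homog).
  case: eqVneq => [->|jk']; first by rewrite /c mulNr divfK// subrr.
  by rewrite addr0 IH// j0; lia.
move=> l i ik; rewrite -mulrA mulrDl mul1r !coefD; congr (_ + _).
rewrite -scalerAl !coefZ coefXn coefXnM -/(X l) horner_coef0.
case: ltngtP ik => // [ik _|-> _]; first by rewrite !mulr0.
by rewrite subnn mulr1.
Qed.

(** Taylor polynomials of the coordinate ratios, normalized and then truncated. Multiplying by a
    common factor changes no ratio, and truncation changes nothing up to order [k]. *)
Lemma jet_lift f : holomorphic_germ_off_divisor F f -> exists i X,
  [/\ in_chart i (f 0), (forall l, (size (X l) <= k.+1)%N), (X i).[0] != 0 /\ unit_jet X,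
    form_at F X != 0 &
    forall l, jet_eq k (fun t => hcoord (f t) l / hcoord (f t) i) (ratio X i l)].
Proof.
move=> [[i [fi df]] fD]; pose y l (t : C) := hcoord (f t) l / hcoord (f t) i.
have yi : \forall t \near (0 : C), 1 = y i t.
  by move: fi; apply: near0S => t ft; rewrite /y divff.
have hy l : hol0 (y l).
  case: (unliftP i l) => [j ->|->]; last exact: hol0_near yi (hol0_cst 1).
  apply/hol0P; move: df; apply: near0S => t dt.
  have := differentiable_comp dt (@differentiable_coord C 1 n (chart i (f t)) 0 j).
  by rewrite (_ : _ \o _ = y (lift i j))//; apply/funext => u; rewrite /= mxE.
have /choice[p pP] : forall l, exists p : {poly C}, jet_eq k (y l) (horner p).
  by move=> l; exact: taylor_jet.
have p0 l : (p l).[0] = y l 0 by have [_ _ /(_ 0%N (leq0n k)) /= ->] := pP l.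
have fi0 := nbhs_singleton fi.
have Fp : form_at F p != 0.
  rewrite /form_at; have -> : (fun l => (p l).[0]) = (fun l => (hcoord (f 0) i)^-1 * hcoord (f 0) l).
    by apply/funext => l; rewrite p0 mulrC.
  rewrite (meval_homog _ _ F_homog) mulf_neq0 ?expf_neq0 ?invr_eq0//.
  by apply/eqP; exact: (nbhs_singleton fD).
have [mu [mu0 umu]] := unit_jet_normalization Fp.
pose X l := take_poly k.+1 (mu * p l).
have XE l j : (j <= k)%N -> (X l)`_j = (mu * p l)`_j.
  by move=> jk; rewrite coef_take_poly ltnS jk.
have X0 l : (X l).[0] = (p l).[0].
  by rewrite !horner_coef0 XE// -horner_coef0 hornerM mu0 mul1r -horner_coef0.
have yi0 : y i 0 = 1 by rewrite /y divff.
exists i, X; split.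
- exact: fi0.
- by move=> l; exact: size_take_poly.
- split; first by rewrite X0 p0 yi0 oner_eq0.
  by move=> j jk; rewrite (curve_eval_trunc _ XE) ?umu//; case/andP: jk.
- by rewrite /form_at (_ : (fun l => _) = fun l => (p l).[0])//; apply/funext.
move=> l; have pi0 : (p i).[0] != 0 by rewrite p0 yi0 oner_eq0.
have mpi0 : (mu * p i).[0] != 0 by rewrite hornerM mu0 mul1r.
have XJ l' : jet_eq k (horner (mu * p l')) (horner (X l')).
  by apply: jet_eq_horner => j jk; rewrite XE.
have J1 := jet_eqM (XJ l) (jet_eqV mpi0 (XJ i)).
have yi0' : y i 0 != 0 by rewrite yi0 oner_eq0.
have J2 := jet_eqM (pP l) (jet_eqV yi0' (pP i)).
apply: jet_eq_trans (jet_eq_near _ _ J2) (jet_eq_near _ _ J1).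
- by move: yi; apply: near0S => t <-; rewrite invr1 mulr1.
- apply: near0W => t; exact: erefl.
- have mun : \forall t \near (0 : C), mu.[t] != 0.
    by apply: (@hol0_neq0 R (horner mu)); [exact: hol0_horner|rewrite mu0 oner_eq0].
  move: mun; apply: near0S => t mut.
  by rewrite !hornerM -mulf_div divff// mul1r.
- apply: near0W => t; exact: erefl.
Qed.

Lemma near_shift (P : C -> Prop) t : (\forall s \near t, P s) ->
  \forall u \near (0 : C), P (t + u).
Proof.
move=> /nbhs_nrmP[r r0 H]; apply/nbhs_nrmP; exists r => // u; rewrite subr0 => ur.
by apply: H; rewrite addrAC subrr add0r.
Qed.

Transparent dC.
Lemma dC_shift (h : C -> C) t : dC (fun u => h (t + u)) = fun u => dC h (t + u).
Proof. by apply/funext => u; rewrite /dC /derive1; under eq_fun do rewrite addrCA. Qed.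
Opaque dC.

Lemma derive1n_shift (h : C -> C) t j : derive1n j (fun u => h (t + u)) 0 = derive1n j h t.
Proof.
rewrite !derive1n_dCn; elim: j h => [|j IH] h /=; first by rewrite addr0.
by rewrite dC_shift; exact: IH.
Qed.

Transparent dC.
Lemma log_jet_shift i f j v t : log_jet F i (fun u => f (t + u)) j v 0 = log_jet F i f j v t.
Proof.
case: v => [l|]; rewrite /log_jet.
  exact: (derive1n_shift (fun u => chart i (f u) 0 l)).
pose g u := local_equation F i (f u).
transitivity (derive1n j (fun u => dC g (t + u) / g (t + u)) 0).
  exact (congr1 (fun d : C -> C => derive1n j (fun u => d u / g (t + u)) 0) (dC_shift g t)).
exact: (derive1n_shift (fun u => dC g u / g u)).
Qed.
Opaque dC.

(** Jets give [Q f 0 = 0] for every germ, whereas vanishing near 0 is claimed. The operator is not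
    assumed to commute with translations; the local formula links [Q f t] to the value at 0 of the
    operator on the translated germ. *)
Lemma operator_eq0 : (forall X, (forall l, (size (X l) <= k.+1)%N) -> unit_jet X ->
   (exists i, (X i).[0] != 0) -> value X = 0) ->
  zero_operator F Q.
Proof.
move=> H0; have H f : holomorphic_germ_off_divisor F f -> Q f 0 = 0.
  move=> hf; have [i [X [fi sX [xi uX] FX fX]]] := jet_lift hf.
  have [V [a [Hd VX E]]] := value_local xi uX.
  rewrite (operator_local_value Hd hf fi xi uX FX fX VX) -E; apply: H0 => //.
  by exists i.
move=> f hf; have [[i [fi df]] fD] := hf.
have [V [a [VX [oV da HQ]]]] := local_datum_exists i (chart i (f 0)).
have cV : \forall t \near (0 : C), V (chart i (f t)).
  have : {for (0 : C), continuous (chart i \o f)}.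
    by apply: differentiable_continuous; exact: (nbhs_singleton df).
  by apply; apply: open_nbhs_nbhs; split.
have Qf := HQ f hf (nbhs_singleton fi) VX.
move: (near0S2 (fun t a b => conj a b) (near0_near fi) (near0_near df))
  (near0S2 (fun t a b => conj a b) (near0_near fD) (near0S2 (fun t a b => conj a b) cV Qf)).
apply: near0S2 => t [fit dft] [fDt [Vt ->]].
pose g u := f (t + u).
have hg : holomorphic_germ_off_divisor F g.
  split; last exact: (near_shift fDt).
  exists i; split; first exact: (near_shift fit).
  move: (near_shift dft); apply: near0S => u du.
  have ds : differentiable (fun u : C => t + u) u.
    apply/derivable1_diffP; apply: (@derivable_shift R id).
    exact: derivable_id.
  exact: (@differentiable_comp _ _ _ _ (fun u => t + u) (chart i \o f) u ds du).
have g0 : g 0 = f t by rewrite /g addr0.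
have gi : in_chart i (g 0) by rewrite g0; exact: (nbhs_singleton fit).
have gV : V (chart i (g 0)) by rewrite g0.
(* The same coefficients, valid at [f 0], serve the translated germ, because [f t] remains in
   [V]. *)
have := nbhs_singleton (HQ g hg gi gV); rewrite /= (H g hg) g0 => E.
rewrite [RHS]E; apply: eq_bigr => e _; congr (_ * _); apply: eq_bigr => jv _.
by rewrite log_jet_shift.
Qed.

End ValueFunction.

(** * Maximum over a compact set of jets *)

Section ContinuousFamilies.
Variables (R : realType) (T : topologicalType) (x0 : T).
Local Notation C := (complex_field R).
Implicit Types (u v : T -> C).

Definition continuous_here (u : T -> C) : Prop :=
  forall e : R, 0 < e -> \forall x \near x0, nrm (u x - u x0) < e.

Lemma continuous_hereP u : continuous_here u <-> {for x0, continuous u}.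
Proof. by have := @cvg_nrmP R T (nbhs x0) (nbhs_filter x0) u (u x0) => E; split=> [/E.2|/E.1]. Qed.

Lemma continuous_here_fun_subring : fun_subring continuous_here.
Proof.
split=> [c|u v /continuous_hereP cu /continuous_hereP cv|u v /continuous_hereP cu /continuous_hereP cv].
- by move=> e e0; apply: filterE => x; rewrite subrr nrm0.
- by apply/continuous_hereP; exact: (continuousD cu cv).
- by apply/continuous_hereP; exact: (continuousM cu cv).
Qed.

Lemma continuous_hereV u : continuous_here u -> u x0 != 0 -> continuous_here (fun x => (u x)^-1).
Proof.
move=> /continuous_hereP cu u0; apply/continuous_hereP.
exact: (continuousV u0 cu).
Qed.

Lemma continuous_here_neq0 u : continuous_here u -> u x0 != 0 -> \forall x \near x0, u x != 0.
Proof.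
move=> cu; rewrite -nrm_gt0 => u0; apply: filterS (cu _ u0) => x.
by case: eqVneq => // ->; rewrite sub0r nrmN ltxx.
Qed.

Lemma continuous_row n (y : 'I_n -> T -> C) : (forall j, continuous_here (y j)) ->
  {for x0, continuous (fun x => \row_j y j x)}.
Proof.
move=> cy A [P HP PA].
have : \forall x \near x0, forall j, P 0 j (y j x).
  apply: filter_forall => j; have /continuous_hereP := cy j; apply.
  by have := HP 0 j; rewrite mxE.
by apply: filterS => x Px; apply: PA => i j; rewrite ord1 mxE.
Qed.

Lemma continuous_comp_row n (y : 'I_n -> T -> C) (a : 'rV[C]_n -> C) :
  (forall j, continuous_here (y j)) -> {for \row_j y j x0, continuous a} ->
  continuous_here (fun x => a (\row_j y j x)).
Proof.
move=> cy ca; apply/continuous_hereP.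
exact: (@continuous_comp _ _ _ (fun x => \row_j y j x) a x0 (continuous_row cy) ca).
Qed.

Section LocalValue.
Variables (n delta k m : nat) (Xt : T -> 'I_n.+1 -> {poly C}) (i : 'I_n.+1).
Variables (a : exponents n k m -> 'rV[C]_n -> C).
Hypothesis cX : forall l, coef_family continuous_here (fun t => Xt t l).
Hypothesis Xi0 : (Xt x0 i).[0] != 0.
Hypothesis ca : forall e, {for base_chart (Xt x0) i, continuous (a e)}.

Let cbase l : continuous_here (fun t => (Xt t l).[0]).
Proof.
rewrite (_ : (fun t => _) = fun t => (Xt t l)`_0); first exact: cX.
by apply/funext => t; rewrite horner_coef0.
Qed.

Let PC := let: And3 h _ _ := continuous_here_fun_subring in h.
Let PD := let: And3 _ h _ := continuous_here_fun_subring in h.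
Let PM := let: And3 _ _ h := continuous_here_fun_subring in h.

Lemma continuous_here_base_chart j :
  continuous_here (fun t => (Xt t (lift i j)).[0] / (Xt t i).[0]).
Proof. exact: (PM (cbase _) (continuous_hereV (cbase i) Xi0)). Qed.

Lemma continuous_here_local_value : continuous_here (fun t => local_value delta (Xt t) i a).
Proof.
have cq p q j : coef_family continuous_here p -> coef_family continuous_here q ->
    continuous_here (fun t => (quot_deriv (p t) (q t) j).[0]).
  move=> hp hq; rewrite (_ : (fun t => _) = fun t => (quot_deriv (p t) (q t) j)`_0).
    exact: (coef_family_quot continuous_here_fun_subring j hp hq).
  by apply/funext => t; rewrite horner_coef0.
have cden j : continuous_here (fun t => ((Xt t i).[0] ^+ j)^-1).
  apply: continuous_hereV; last by rewrite expf_neq0.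
  exact: (@family_exp_ind C T continuous_here _ j (PC 1) PM (cbase i)).
have cjet j (v : option 'I_n) : continuous_here (fun t => jet_value delta (Xt t) i j v).
  case: v => [l|] /=.
    exact: (PM (cq (fun t => Xt t (lift i l)) (fun t => Xt t i) j.+1 (cX _) (cX i)) (cden j.+2)).
  rewrite (_ : (fun t => _) = fun t => (- delta%:R) *
     ((quot_deriv (Xt t i)^`() (Xt t i) j).[0] * ((Xt t i).[0] ^+ j.+1)^-1)).
    have hd := cq (fun t => (Xt t i)^`()) (fun t => Xt t i) j
      (coef_family_deriv continuous_here_fun_subring (cX i)) (cX i).
    exact: (PM (PC (- delta%:R)) (PM hd (cden j.+1))).
  by apply/funext => t; rewrite mulNr.
have cprod (e : exponents n k m) : continuous_here (fun t =>
    \prod_(jv : 'I_k * option 'I_n) jet_value delta (Xt t) i jv.1 jv.2 ^+ e jv).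
  apply: (@family_prod_ind C T _ _ _ continuous_here
    (fun (jv : 'I_k * option 'I_n) t => jet_value delta (Xt t) i jv.1 jv.2 ^+ e jv) (PC 1) PM) => jv.
  exact: (@family_exp_ind C T continuous_here _ _ (PC 1) PM (cjet (jv.1 : nat) jv.2)).
have cterm (e : exponents n k m) : continuous_here (fun t => a e (base_chart (Xt t) i) *
    \prod_(jv : 'I_k * option 'I_n) jet_value delta (Xt t) i jv.1 jv.2 ^+ e jv).
  have c1 : continuous_here (fun t => a e (base_chart (Xt t) i)).
    exact: (@continuous_comp_row n (fun j t => (Xt t (lift i j)).[0] / (Xt t i).[0]) (a e)
      continuous_here_base_chart (@ca e)).
  exact: (PM c1 (cprod e)).
exact: (@family_sum_ind C T _ _ _ continuous_here _ (PC 0) PD cterm).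
Qed.

End LocalValue.
End ContinuousFamilies.

Section Compactness.
Variable R : realType.
Local Notation C := (complex_field R).

Lemma compact_complex_square (b : R) : exists2 K : set C, compact K &
  forall z, nrm z <= b -> K z.
Proof.
pose f (p : R * R) : C := Complex p.1 p.2.
exists (f @` (`[- b, b] `*` `[- b, b])).
  apply: continuous_compact; last by apply: compact_setX; exact: segment_compact.
  apply: continuous_subspaceT => p; apply/(@cvg_nrmP R _ (nbhs p) (nbhs_filter p) f (f p)) => e e0.
  have e2 : 0 < e / 2 by lra.
  have c1 : \forall q \near p, `|p.1 - q.1| < e / 2.
    by have /cvgrPdist_lt/(_ _ e2) : (fun q : R * R => q.1) @ p --> p.1 by exact: cvg_fst.
  have c2 : \forall q \near p, `|p.2 - q.2| < e / 2.
    by have /cvgrPdist_lt/(_ _ e2) : (fun q : R * R => q.2) @ p --> p.2 by exact: cvg_snd.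
  apply: filterS2 c1 c2 => q q1 q2; apply: le_lt_trans (nrm_le_reim _) _.
  by rewrite reB imB /= distrC [X in _ + X]distrC; lra.
move=> z zb; exists (re z, im z); last by apply: re_im_eq.
have := le_trans (nrm_re z) zb; have := le_trans (nrm_im z) zb.
by rewrite !ler_norml /= !in_itv /=.
Qed.

Lemma compact_row_box N (b : R) : exists2 K : set 'rV[C]_N, compact K &
  forall v : 'rV[C]_N, (forall i, nrm (v 0 i) <= b) -> K v.
Proof.
have [K cK KP] := compact_complex_square b.
exists [set v | forall i, K (v ord0 i)]; first exact: (@rV_compact _ N (fun=> K) (fun=> cK)).
by move=> v vb i; apply: KP; exact: vb.
Qed.

End Compactness.

Opaque value local_value nrm rc re im.

Lemma nrm_dist (R : realType) (z w : complex_field R) : `|nrm z - nrm w| <= nrm (w - z).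
Proof.
rewrite ler_norml; apply/andP.
have := nrm_triangle w z 0; have := nrm_triangle z w 0.
by rewrite !subr0 (nrmC z w) => ? ?; split; lra.
Qed.

Lemma pow_eq0_transfer (R : realType) (a b s : R) p : (0 < p)%N ->
  a ^+ p = b ^+ p * s -> b = 0 -> a = 0.
Proof.
move=> p0 E b0; apply/eqP; have : a ^+ p == 0.
  by rewrite E b0 expr0n gtn_eqF// mul0r.
by rewrite expf_eq0 p0.
Qed.

Lemma pow_le_transfer (R : realType) (a b g s : R) p :
  a ^+ p = b ^+ p * s -> 0 <= b -> b <= g -> 0 <= s -> a ^+ p <= g ^+ p * s.
Proof.
move=> -> b0 bg s0; apply: ler_wpM2r => //.
by apply: lerXn2r; rewrite ?nnegrE// (le_trans b0).
Qed.

(** * Normalized jets and a maximum *)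

Section Maximum.
Variables (R : realType) (n delta k m : nat).
Local Notation C := (complex_field R).
Variable F : mpoly n.+1 C.
Hypothesis F_homog : F \is ishomog1 delta mdeg.
Hypothesis delta_gt0 : (0 < delta)%N.
Hypothesis F_smooth : forall x : 'I_n.+1 -> C, (exists l, x l != 0) ->
  exists w, differential F x w != 0.
Variable Q : curve_operator C n.
Hypothesis Q_global : global_log_jet_differential F k m Q.
Hypothesis m_gt0 : (0 < m)%N.
Implicit Types (X Y : 'I_n.+1 -> {poly C}).
Local Notation value := (@value R n delta k m F Q).
Local Notation unit_jet := (@unit_jet R n k F).

(** Index [j] stands for order [j.+1], as in ['I_k]. The factorial makes the quotient exact for
    [j < k]. *)
Definition jet_exponent j := ((m * k`!) %/ j.+1)%N.

Lemma jet_exponentE j : (j < k)%N -> (j.+1 * jet_exponent j)%N = (m * k`!)%N.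
Proof.
move=> jk; rewrite mulnC divnK// dvdn_mull// dvdn_fact//.
Qed.

Lemma jet_exponent_gt0 j : (j < k)%N -> (0 < jet_exponent j)%N.
Proof.
move=> jk; have := jet_exponentE jk; have : (0 < m * k`!)%N by rewrite muln_gt0 m_gt0 fact_gt0.
by case: (jet_exponent j) => // ; rewrite muln0 => /[swap] <-.
Qed.

Definition base_norm2 X : R := \sum_l nrm ((X l)`_0) ^+ 2.

Definition jet_energy X : R :=
  \sum_(j < k) \sum_l nrm ((X l)`_j.+1) ^+ (2 * jet_exponent j).

(** The energy of the multiple of [X] whose base point has norm 1 ([jet_energyZ]), extended as an
    expression in [X] itself. *)
Definition scaled_energy X : R :=
  \sum_(j < k) \sum_l nrm ((X l)`_j.+1) ^+ (2 * jet_exponent j) / base_norm2 X ^+ jet_exponent j.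

Definition admissible X := (forall l, (size (X l) <= k.+1)%N) /\ unit_jet X.

Definition normalized X := [/\ admissible X, base_norm2 X = 1 & jet_energy X = 1].

Lemma base_norm2_ge0 X : 0 <= base_norm2 X.
Proof. by apply: sumr_ge0 => l _; rewrite exprn_ge0// nrm_ge0. Qed.

Lemma base_norm2_gt0 X : (exists l, (X l).[0] != 0) -> 0 < base_norm2 X.
Proof.
move=> [l xl]; rewrite lt_def base_norm2_ge0 andbT psumr_neq0.
  by apply/hasP; exists l; rewrite ?mem_index_enum//= exprn_gt0// nrm_gt0 -horner_coef0.
by move=> j _; rewrite exprn_ge0// nrm_ge0.
Qed.

Lemma base_norm2_neq0 X : base_norm2 X != 0 -> exists l, (X l).[0] != 0.
Proof.
move=> H; apply: contrapT => N; move/negP: H; apply; apply/eqP; apply: big1 => l _.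
apply/eqP; rewrite expf_eq0 /= nrm_eq0 -horner_coef0; apply: contrapT => /negP h.
by apply: N; exists l.
Qed.

Lemma scaled_energy_ge0 X : 0 <= scaled_energy X.
Proof.
apply: sumr_ge0 => j _; apply: sumr_ge0 => l _.
by rewrite divr_ge0// exprn_ge0// ?nrm_ge0// base_norm2_ge0.
Qed.

Lemma jet_energyZ X (r : R) : 0 < r -> r ^+ 2 = (base_norm2 X)^-1 ->
  jet_energy (fun l => rc r *: X l) = scaled_energy X.
Proof.
move=> r0 rE; apply: eq_bigr => j _; apply: eq_bigr => l _.
by rewrite coefZ nrmM nrm_rc gtr0_norm// exprMn [r ^+ _]exprM rE exprVn mulrC.
Qed.

Lemma jet_energy_rescale X (c : C) :
  jet_energy (fun l => rescale c (X l)) = nrm c ^+ (2 * (m * k`!)) * jet_energy X.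
Proof.
rewrite /jet_energy big_distrr; apply: eq_bigr => j _; rewrite /= big_distrr; apply: eq_bigr => l _.
rewrite /= coef_rescale nrmM nrmX exprMn -exprM; congr (_ ^+ _ * _).
by rewrite -(jet_exponentE (ltn_ord j)) mulnCA mulnA.
Qed.

Lemma size_rescale (c : C) (p : {poly C}) : (size p <= k.+1)%N -> (size (rescale c p) <= k.+1)%N.
Proof.
move=> /leq_sizeP H; apply/leq_sizeP => j jk.
by rewrite coef_rescale H// mulr0.
Qed.

Lemma rescale0_jet Y : (forall l, (size (Y l) <= k.+1)%N) -> jet_energy Y = 0 ->
  (fun l => rescale 0 (Y l)) = Y.
Proof.
move=> sY A0; apply/funext => l; apply/polyP => -[|j]; rewrite coef_rescale ?expr0 ?mul1r//.
rewrite expr0n mul0r; have [jk|kj] := ltnP j k; last by rewrite nth_default// (leq_trans (sY l)).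
move: A0 => /eqP; rewrite psumr_eq0; last first.
  by move=> i _; apply: sumr_ge0 => l' _; rewrite exprn_ge0// nrm_ge0.
move=> /allP/(_ (Ordinal jk) (mem_index_enum _)) /=; rewrite psumr_eq0; last first.
  by move=> l' _; rewrite exprn_ge0// nrm_ge0.
by move=> /allP/(_ l (mem_index_enum _)) /=; rewrite expf_eq0 nrm_eq0 => /andP[_ /eqP ->].
Qed.

Lemma normalize X : admissible X -> (exists l, (X l).[0] != 0) -> value X != 0 ->
  exists X', normalized X' /\
    nrm (value X) ^+ (2 * k`!) = nrm (value X') ^+ (2 * k`!) * scaled_energy X.
Proof.
move=> [sX uX] x0 vX; have b0 := base_norm2_gt0 x0.
pose r := Num.sqrt (base_norm2 X)^-1.
have r0 : 0 < r by rewrite sqrtr_gt0 invr_gt0.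
have rE : r ^+ 2 = (base_norm2 X)^-1 by rewrite sqr_sqrtr// invr_ge0 ltW.
have rc0 : rc r != 0 by rewrite -nrm_gt0 nrm_rc gtr0_norm.
have [uZ vZ] := valueZ F_homog delta_gt0 F_smooth Q_global rc0 uX x0.
set Y := fun l => rc r *: X l in uZ vZ.
have sY l : (size (Y l) <= k.+1)%N by apply: leq_trans (size_scale_leq _ _) (sX l).
have bY : base_norm2 Y = 1.
  transitivity ((base_norm2 X)^-1 * base_norm2 X); last exact: (mulVf (lt0r_neq0 b0)).
  rewrite {2}/base_norm2 big_distrr /=; apply: eq_bigr => l _.
  by rewrite coefZ nrmM nrm_rc (gtr0_norm r0) exprMn rE.
have y0 : exists l, (Y l).[0] != 0.
  by apply: base_norm2_neq0; rewrite bY oner_neq0.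
have AE : jet_energy Y = scaled_energy X by exact: jet_energyZ.
(* Zero energy means a constant jet, fixed by reparametrization with c = 0; its value is then 0
   because [m] is positive. *)
have A0 : scaled_energy X != 0.
  apply: contraNneq vX => A0; rewrite -vZ.
  have YE : (fun l => rescale 0 (Y l)) = Y.
    by apply: (rescale0_jet sY); rewrite AE.
  have [_ vR] := value_rescale F_homog delta_gt0 F_smooth Q_global 0 uZ y0.
  rewrite -YE vR expr0n gtn_eqF; first by rewrite mulr0n mul0r.
  exact: m_gt0.
have A1 : 0 < scaled_energy X by rewrite lt_def A0; exact: scaled_energy_ge0.
have E0 : (0 < 2 * (m * k`!))%N by rewrite muln_gt0 muln_gt0 m_gt0 fact_gt0.
pose c : C := (2 * (m * k`!))%N.-root (rc (scaled_energy X)^-1).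
have cE : nrm c ^+ (2 * (m * k`!)) = (scaled_energy X)^-1.
  rewrite -nrmX /c (rootCK E0) nrm_rc ger0_norm; first exact: erefl.
  by rewrite invr_ge0; exact: ltW.
have [uR vR] := value_rescale F_homog delta_gt0 F_smooth Q_global c uZ y0.
exists (fun l => rescale c (Y l)); split.
  split; first by split=> [l|]; [exact: size_rescale (sY l)|exact: uR].
    rewrite -bY /base_norm2; apply: eq_bigr => l _.
    by rewrite coef_rescale expr0 mul1r.
  by rewrite jet_energy_rescale AE cE; exact: mulVf.
rewrite vR vZ nrmM nrmX exprMn -exprM mulnCA cE mulrAC (mulVf A0).
exact/esym/mul1r.
Qed.

(** Jets as row vectors, to use the topology and the compactness of spaces of rows. *)
Definition jet_of_row (M : 'rV[C]_(k.+1 * n.+1)) (l : 'I_n.+1) : {poly C} :=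
  \poly_(j < k.+1) M 0 (mxvec_index (inord j : 'I_k.+1) l).

Definition row_of_jet X : 'rV[C]_(k.+1 * n.+1) := mxvec (\matrix_(j < k.+1, l < n.+1) (X l)`_j).

Lemma jet_of_row_ge X : (forall l, (size (X l) <= k.+1)%N) -> jet_of_row (row_of_jet X) = X.
Proof.
move=> sX; apply/funext => l; apply/polyP => j; rewrite coef_poly.
case: ltnP => jk; first by rewrite mxvecE mxE inordK.
by rewrite nth_default// (leq_trans (sX l)).
Qed.

Lemma coef_family_jet_of_row M0 l :
  coef_family (continuous_here M0) (fun M => jet_of_row M l).
Proof.
move=> j; have [jk|kj] := ltnP j k.+1.
  rewrite (_ : (fun M => _) = fun M : 'rV[C]_(k.+1 * n.+1) => M 0 (mxvec_index (inord j : 'I_k.+1) l)).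
    by apply/continuous_hereP; exact: coord_continuous.
  by apply/funext => M; rewrite coef_poly jk.
rewrite (_ : (fun M => _) = fun=> 0).
  by have [PC _ _] := continuous_here_fun_subring R M0; exact: PC.
by apply/funext => M; rewrite coef_poly ltnNge kj.
Qed.

Lemma closed_zero_set (T : topologicalType) (u : T -> C) :
  (forall x, continuous_here x u) -> closed [set x | u x = 0].
Proof.
move=> cu; rewrite -openC openE => x /= ux.
have ux0 : u x != 0 by apply/eqP.
by apply: filterS (continuous_here_neq0 (cu x) ux0) => y /eqP.
Qed.

Lemma continuous_here_nrm (T : topologicalType) (x0 : T) (u : T -> C) :
  continuous_here x0 u -> continuous_here x0 (fun x => rc (nrm (u x))).
Proof.
move=> cu e e0; apply: filterS (cu e e0) => x; apply: le_lt_trans.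
by rewrite -rcB nrm_rc distrC; exact: nrm_dist.
Qed.

Definition normalized_rows : set 'rV[C]_(k.+1 * n.+1) := [set M | normalized (jet_of_row M)].

Lemma closed_normalized_rows : closed normalized_rows.
Proof.
have cont M0 (p : nat) l j :
    continuous_here M0 (fun M => rc (nrm ((jet_of_row M l)`_j)) ^+ p).
  have [PC _ PM] := continuous_here_fun_subring R M0.
  exact: (@family_exp_ind C _ (continuous_here M0) _ p (PC 1) PM
    (continuous_here_nrm (coef_family_jet_of_row M0 l j))).
(* Every condition becomes the vanishing of a complex-valued function, real moduli being embedded by
   [rc], so that the closure lemmas for continuous families apply. *)
have -> : normalized_rows = (\bigcap_(j in [set: 'I_k])
    [set M | (curve_eval F (jet_of_row M))`_j.+1 = 0]) `&`
  ([set M | \sum_l rc (nrm ((jet_of_row M l)`_0)) ^+ 2 + (-1) = 0] `&`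
   [set M | \sum_(j < k) \sum_l rc (nrm ((jet_of_row M l)`_j.+1)) ^+ (2 * jet_exponent j) + (-1) = 0]).
  have E1 M : \sum_l rc (nrm ((jet_of_row M l)`_0)) ^+ 2 = rc (base_norm2 (jet_of_row M)).
    by rewrite /base_norm2 rc_sum; apply: eq_bigr => l _; rewrite rcX.
  have E2 M : \sum_(j < k) \sum_l rc (nrm ((jet_of_row M l)`_j.+1)) ^+ (2 * jet_exponent j) =
      rc (jet_energy (jet_of_row M)).
    rewrite /jet_energy rc_sum; apply: eq_bigr => j _; rewrite rc_sum; apply: eq_bigr => l _.
    by rewrite rcX.
  apply/seteqP; split=> M /=.
    move=> [[_ u] b e]; rewrite E1 E2 b e subrr; split => // j _ /=.
    by apply: u => /=; exact: ltn_ord.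
  move=> [u]; rewrite E1 E2 => -[/eqP b /eqP e]; split; last 2 first.
  - by move: b; rewrite subr_eq0 -rc1 => /eqP/rc_inj.
  - by move: e; rewrite subr_eq0 -rc1 => /eqP/rc_inj.
  split=> [l|[//|j] jk]; first exact: size_poly.
  by have := u (Ordinal (jk : (j < k)%N)) I.
apply: closedI; last apply: closedI.
- apply: closed_bigI => j _; apply: closed_zero_set => M0.
  exact: (@coef_family_eval C n.+1 _ _ (continuous_here_fun_subring R M0) F
    (fun l M => jet_of_row M l) (coef_family_jet_of_row M0) j.+1).
- apply: closed_zero_set => M0; have [PC PD PM] := continuous_here_fun_subring R M0.
  apply: (PD _ _ _ (PC _)); exact: (@family_sum_ind C _ _ _ _ _ _ (PC 0) PD (fun l => cont M0 2%N l 0%N)).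
- apply: closed_zero_set => M0; have [PC PD PM] := continuous_here_fun_subring R M0.
  apply: (PD _ _ _ (PC _)); apply: (@family_sum_ind C _ _ _ _ _ _ (PC 0) PD) => j.
  exact: (@family_sum_ind C _ _ _ _ _ _ (PC 0) PD (fun l => cont M0 _ l j.+1)).
Qed.

Lemma compact_normalized_rows : compact normalized_rows.
Proof.
have [K cK KP] := @compact_row_box R (k.+1 * n.+1) 1.
apply: (subclosed_compact closed_normalized_rows cK) => M [_ b e]; apply: KP => i.
have sum_le (I : finType) (f : I -> R) i0 : (forall i, 0 <= f i) -> \sum_i f i = 1 -> f i0 <= 1.
  by move=> f0 <-; rewrite (bigD1 i0)//= lerDl sumr_ge0.
case/mxvec_indexP: i => j l.
have E : M 0 (mxvec_index j l) = (jet_of_row M l)`_j.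
  by rewrite coef_poly ltn_ord inord_val.
rewrite E; case: (unliftP ord0 j) => [j' ->|->]; last first.
  have := sum_le _ _ l (fun l => exprn_ge0 2 (nrm_ge0 ((jet_of_row M l)`_0))) b.
  by rewrite expr_le1// nrm_ge0.
have in0 (i : 'I_k) : 0 <= \sum_l nrm ((jet_of_row M l)`_i.+1) ^+ (2 * jet_exponent i).
  by apply: sumr_ge0 => l' _; rewrite exprn_ge0// nrm_ge0.
have le1 := sum_le _ _ j' in0 e.
have : nrm ((jet_of_row M l)`_j'.+1) ^+ (2 * jet_exponent j') <= 1.
  apply: le_trans le1; rewrite (bigD1 l)//= lerDl sumr_ge0// => i _.
  by rewrite exprn_ge0// nrm_ge0.
by rewrite expr_le1// ?nrm_ge0// muln_gt0 jet_exponent_gt0.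
Qed.

(** Near a given jet one chart and one set of coefficients compute the value of all normalized
    jets. *)
Lemma continuous_value_rows :
  {within normalized_rows, continuous (fun M => nrm (value (jet_of_row M)))}.
Proof.
apply/subspace_continuousP => M0 [[_ u0] b0 _].
have [i xi] : exists i, (jet_of_row M0 i).[0] != 0.
  by apply: base_norm2_neq0; rewrite b0 oner_neq0.
have [V [a [Hd VX _]]] := value_local F_homog delta_gt0 F_smooth Q_global xi u0.
have [oV da _] := Hd.
have ca e : {for base_chart (jet_of_row M0) i, continuous (a e)}.
  by apply: differentiable_continuous; exact: da.
have cL := @continuous_here_local_value R _ M0 n delta k m jet_of_row i a
  (coef_family_jet_of_row M0) xi ca.
have cb l : continuous_here M0 (fun M => (jet_of_row M l).[0]).
  rewrite (_ : (fun t => _) = fun t => (jet_of_row t l)`_0); first exact: coef_family_jet_of_row.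
  by apply/funext => t; rewrite horner_coef0.
have cch := @continuous_row R _ M0 n
  (fun j M => (jet_of_row M (lift i j)).[0] / (jet_of_row M i).[0])
  (continuous_here_base_chart (coef_family_jet_of_row M0) xi).
have nV : \forall M \near M0, V (base_chart (jet_of_row M) i).
  by apply: cch; apply: open_nbhs_nbhs; split.
apply/cvgrPdist_lt => e e0.
have ne := cL e e0; have nx := continuous_here_neq0 (cb i) xi.
rewrite /within /=; apply: filterS3 ne nx nV => M Me Mx MV [[_ uM] _ _].
change (`|nrm (value (jet_of_row M0)) - nrm (value (jet_of_row M))| < e).
rewrite (valueE F_homog delta_gt0 F_smooth uM Hd Mx MV).
rewrite (valueE F_homog delta_gt0 F_smooth u0 Hd xi VX).
exact: le_lt_trans (nrm_dist _ _) Me.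
Qed.

(** The maximum over the compact set of normalized jets, carried to all admissible jets by
    [normalize]: the homogeneous form can be tested on a disc that leaves the normalized set. *)
Lemma maximal_value X0 : admissible X0 -> (exists l, (X0 l).[0] != 0) -> value X0 != 0 ->
  exists X, [/\ normalized X, value X != 0 &
    forall Y, admissible Y -> (exists l, (Y l).[0] != 0) ->
      nrm (value Y) ^+ (2 * k`!) <= nrm (value X) ^+ (2 * k`!) * scaled_energy Y].
Proof.
move=> aX0 x0 v0; have [X1 [N1 E1]] := normalize aX0 x0 v0.
have rows X : normalized X -> normalized_rows (row_of_jet X).
  by move=> NX; rewrite /normalized_rows /= jet_of_row_ge//; case: NX => -[].
have ne : normalized_rows !=set0 by exists (row_of_jet X1); exact: rows.
have [M /set_mem NM Mmax] := compact_EVT_max ne compact_normalized_rows continuous_value_rows.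
have max X : normalized X -> nrm (value X) <= nrm (value (jet_of_row M)).
  move=> NX; have := Mmax (row_of_jet X) (mem_set (rows X NX)).
  by rewrite jet_of_row_ge//; case: NX => -[].
have k0 : (0 < 2 * k`!)%N by rewrite muln_gt0 fact_gt0.
have Z0 : (0 : R) ^+ (2 * k`!) = 0 by rewrite expr0n (gtn_eqF k0).
exists (jet_of_row M); split; first exact: NM.
  apply: contraNneq v0 => vM; have := max X1 N1; rewrite vM nrm0 => v1.
  have v1' : nrm (value X1) = 0 by apply: le_anti; rewrite v1 nrm_ge0.
  have := pow_eq0_transfer k0 E1 v1'.
  by move=> /eqP; rewrite nrm_eq0.
move=> Y aY y0; have [vY|vY] := eqVneq (value Y) 0.
  rewrite vY nrm0 Z0; apply: mulr_ge0; last exact: scaled_energy_ge0.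
  by apply: exprn_ge0; exact: nrm_ge0.
have [Y' [NY' E]] := normalize aY y0 vY.
exact: (pow_le_transfer E (nrm_ge0 _) (max Y' NY') (scaled_energy_ge0 Y)).
Qed.

End Maximum.

Transparent nrm rc re im.

(** * Discs violating the maximum principle *)

Section InteriorMaximum.
Variable R : realType.
Local Notation C := (complex_field R).
Implicit Types (z w : C).

Definition cj z : C := Complex (re z) (- im z).

Lemma sqr_nrmD z w : nrm (z + w) ^+ 2 = nrm z ^+ 2 + 2 * re (cj z * w) + nrm w ^+ 2.
Proof. by rewrite !sqr_nrm reD imD reM /=; ring. Qed.

Lemma re_sum I (r : seq I) (P : pred I) (f : I -> C) :
  re (\sum_(i <- r | P i) f i) = \sum_(i <- r | P i) re (f i).
Proof. exact: (big_morph (@re R) (@reD R) erefl). Qed.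

Lemma hol0_bounded (u : C -> C) : hol0 u ->
  exists2 K : R, 0 < K & \forall t \near (0 : C), nrm (u t) <= K.
Proof.
move=> /hol0_continuous/continuous_nrmP/(_ 1 ltr01)[r r0 H].
exists (nrm (u 0) + 1); first by have := nrm_ge0 (u 0); lra.
apply/nbhs_nrmP; exists r => // t /H h.
by have := nrm_triangle (u 0) (u t) 0; rewrite !subr0; lra.
Qed.

(** The terms linear in [y] cancel and - 4 y^2 is dropped. The terms with [p], [q] and [p * q]
    contribute at most 2, 2 and 1 times [w]. *)
Lemma perturbed_square_bound (y p q w : R) : `|y| <= 2^-1 -> 0 <= p -> p <= w -> 0 <= q ->
  q <= w -> w <= 1 -> (1 + 2 * y + p) * (1 - 2 * y + q) <= 1 + 5 * w.
Proof.
rewrite ler_norml => /andP[y1 y2] p0 pw q0 qw w1.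
have h1 : p * (1 - 2 * y) <= p * 2 by apply: ler_wpM2l => //; lra.
have h2 : q * (1 + 2 * y) <= q * 2 by apply: ler_wpM2l => //; lra.
have h3 : p * q <= w * 1 by apply: ler_pM => //; lra.
have h4 : 0 <= y * y by rewrite -expr2 sqr_ge0.
by lra.
Qed.

(* A maximum of |phi|^N / (|h|^2 / (1 + s |t|^2)) at t = 0 along a disc on which h
   is constant to first order: such a negatively curved metric has no maximum. *)
Lemma no_interior_max (phi : C -> C) (I : finType) (h : I -> C) (theta : I -> C -> C)
  (s : R) (N : nat) : hol0 phi -> phi 0 != 0 -> (forall i, hol0 (theta i)) -> 0 < s ->
  \sum_i nrm (h i) ^+ 2 = 1 ->
  (\forall t \near (0 : C), nrm (phi t) ^+ N <= nrm (phi 0) ^+ N *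
     ((\sum_i nrm (h i + t ^+ 2 * theta i t) ^+ 2) / (1 + nrm t ^+ 2 * s))) -> False.
Proof.
move=> hphi phi0 htheta s0 h1 Hle.
(* The Hermitian product of the base vector with its variation, holomorphic in [t] because only the
   constants [h i] are conjugated. *)
pose B t := \sum_i cj (h i) * theta i t.
have hB : hol0 B by apply: hol0_sum => i; apply: hol0M; [exact: hol0_cst|exact: htheta].
pose Th t := \sum_i nrm (theta i t) ^+ 2.
have energy t : \sum_i nrm (h i + t ^+ 2 * theta i t) ^+ 2 =
    1 + 2 * re (t ^+ 2 * B t) + nrm t ^+ 4 * Th t.
  under eq_bigr do rewrite sqr_nrmD nrmM nrmX exprMn -exprM.
  rewrite !big_split /= h1; congr (_ + _ + _); last by rewrite -mulr_sumr.
  rewrite -mulr_sumr -re_sum /B mulr_sumr; congr (2 * re _).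
  by apply: eq_bigr => i _; rewrite mulrCA.
have [KB KB0 nB] := hol0_bounded hB.
have /choice[Kt KtP] : forall i, exists K : R, \forall t \near (0 : C), nrm (theta i t) <= K.
  by move=> i; have [K _ H] := hol0_bounded (htheta i); exists K.
pose K := 1 + KB + \sum_i `|Kt i| ^+ 2.
have Ks0 : 0 <= \sum_i `|Kt i| ^+ 2 by apply: sumr_ge0 => i _; rewrite exprn_ge0.
have K1 : 1 <= K by rewrite /K; lra.
have nTh : \forall t \near (0 : C), Th t <= K.
  have : \forall t \near (0 : C), forall i, nrm (theta i t) <= Kt i.
    exact: (@filter_forall C I (fun i t => nrm (theta i t) <= Kt i) _ (nbhs_filter (0 : C)) KtP).
  apply: near0S => t H; apply: (@le_trans _ _ (\sum_i `|Kt i| ^+ 2)); last by rewrite /K; lra.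
  apply: ler_sum => i _; apply: lerXn2r; rewrite ?nnegrE ?nrm_ge0//.
  exact: le_trans (H i) (ler_norm _).
(* The second factor has modulus |1 - b|^2 = 1 - 2 Re b + |b|^2 with b = t^2 B, which compensates
   the term 2 Re b of the energy. *)
pose psi t := (phi t / phi 0) ^+ N * (1 - t ^+ 2 * B t) ^+ 2.
have hpsi : hol0 psi.
  apply: hol0M; apply: hol0X; first exact: (hol0M hphi (hol0_cst _)).
  apply: (hol0B (hol0_cst 1)); apply: (hol0M _ hB).
  by apply: hol0X; exact: hol0_id.
have psi0 : psi 0 = 1 by rewrite /psi divff// expr1n expr0n mul0r subr0 expr1n mulr1.
Transparent hol0.
have [r0 r00 Hr] : exists2 r0 : R, 0 < r0 & forall t, nrm t < r0 ->
    [/\ derivable psi t 1, nrm (B t) <= K, Th t <= K &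
     nrm (phi t) ^+ N <= nrm (phi 0) ^+ N *
     ((\sum_i nrm (h i + t ^+ 2 * theta i t) ^+ 2) / (1 + nrm t ^+ 2 * s))].
  move: hpsi nB nTh Hle => /nbhs_nrmP[a a0 Ha] /nbhs_nrmP[b b0 Hb] /nbhs_nrmP[c c0 Hc] /nbhs_nrmP[d d0 Hd].
  exists (Num.min (Num.min a b) (Num.min c d)); first by rewrite !lt_min a0 b0 c0.
  move=> t; rewrite !lt_min => /andP[/andP[ta tb] /andP[tc td]]; split.
  - by apply: Ha; rewrite subr0.
  - by have := Hb t; rewrite subr0 => /(_ tb); rewrite /K; lra.
  - by apply: Hc; rewrite subr0.
  - by apply: Hd; rewrite subr0.
Opaque hol0.
have K0 : 0 < K by lra.
have K20 : 0 < K ^+ 2 by rewrite exprn_gt0.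
(* The second bound gives |b| <= 1/2 and r <= 1. The third gives 5 K^2 r^4 < r^2 s, so that on |t| =
   r the modulus of [psi] stays below a number smaller than [psi 0 = 1]. *)
pose r := Num.min (r0 / 2) (Num.min (2^-1 / K) (s / (10 * K ^+ 2))).
have rp : 0 < r by rewrite !lt_min !divr_gt0//; lra.
have r_r0 : r <= r0 / 2 by rewrite /r ge_min lexx.
have rK : r * K <= 2^-1 by rewrite -ler_pdivlMr// /r !ge_min lexx !orbT.
have rs : 10 * (K ^+ 2 * r) <= s.
  by rewrite mulrA mulrC -ler_pdivlMr ?mulr_gt0// /r !ge_min lexx !orbT.
have rK' : r <= r * K by rewrite ler_peMr// ltW.
have r2 : r ^+ 2 <= r by rewrite expr2 ler_piMr; lra.
(* A common bound for |b|^2 and for the quadratic term of the energy; the latter uses K >= 1. *)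
pose w := r ^+ 4 * K ^+ 2.
have wE : w = (r ^+ 2 * K) ^+ 2 by rewrite /w exprMn -exprM.
have r2K : r ^+ 2 * K <= 2^-1 by apply: le_trans rK; rewrite ler_pM2r.
have r2K0 : 0 <= r ^+ 2 * K by rewrite mulr_ge0// ?exprn_ge0// ltW.
have w1 : w <= 1 by rewrite wE expr_le1//; lra.
have wK : r ^+ 4 * K <= w.
  by rewrite /w ler_wpM2l ?exprn_ge0 ?(ltW rp)// expr2 ler_peMr// ltW.
have rho0 : 0 < 1 + r ^+ 2 * s.
  by have := mulr_gt0 (exprn_gt0 2 rp) s0; lra.
have := @maximum_principle R psi r0 r ((1 + 5 * w) / (1 + r ^+ 2 * s)).
rewrite psi0 => /(_ _ rp) H; suff : (1 + 5 * w) / (1 + r ^+ 2 * s) < 1.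
  have : re 1 <= (1 + 5 * w) / (1 + r ^+ 2 * s); last by rewrite /=; lra.
  apply: H => [z /Hr[]//||t tr]; first lra.
  have [_ Bt Tt Ht] := Hr t ltac:(lra).
  pose b := t ^+ 2 * B t.
  have bK : nrm b <= r ^+ 2 * K.
    by rewrite nrmM nrmX tr ler_wpM2l// exprn_ge0// ltW.
  have nb : nrm (1 - b) ^+ 2 = 1 - 2 * re b + nrm b ^+ 2.
    by rewrite sqr_nrmD nrmN nrm1 expr1n reM reN /=; ring.
  have p0 : 0 < nrm (phi 0) ^+ N by rewrite exprn_gt0// nrm_gt0.
  rewrite /psi -/b nrmM !nrmX nrmM nrmV exprMn exprVn nb.
  rewrite energy tr -/b in Ht.
  have Ht' : nrm (phi t) ^+ N / nrm (phi 0) ^+ N <=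
      (1 + 2 * re b + r ^+ 4 * Th t) / (1 + r ^+ 2 * s).
    by rewrite ler_pdivrMr// mulrC.
  have Th0 : 0 <= Th t by apply: sumr_ge0 => i _; rewrite exprn_ge0// nrm_ge0.
  have qb0 : 0 <= nrm b ^+ 2 by rewrite exprn_ge0// nrm_ge0.
  have nb0 : 0 <= 1 - 2 * re b + nrm b ^+ 2 by rewrite -nb exprn_ge0// nrm_ge0.
  apply: le_trans (ler_wpM2r nb0 Ht') _.
  rewrite mulrAC ler_pM2r ?invr_gt0//; apply: perturbed_square_bound w1.
  - by apply: le_trans (nrm_re b) _; lra.
  - by rewrite mulr_ge0// exprn_ge0// ltW.
  - by apply: le_trans wK; rewrite ler_wpM2l// exprn_ge0// ltW.
  - exact: qb0.
  - by rewrite wE; apply: lerXn2r; rewrite ?nnegrE ?nrm_ge0.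
rewrite ltr_pdivrMr// mul1r ltrD2l.
have -> : 5 * w = r ^+ 2 * (5 * (K ^+ 2 * r ^+ 2)).
  by rewrite /w; ring.
rewrite ltr_pM2l ?exprn_gt0//.
have := ler_wpM2l (ltW K20) r2; have := mulr_gt0 K20 rp; lra.
Qed.

End InteriorMaximum.

Opaque nrm rc re im.

(** * Vanishing of the function on jets *)

Section Vanishing.
Variables (R : realType) (n delta k m : nat).
Local Notation C := (complex_field R).
Variable F : mpoly n.+1 C.
Hypothesis F_homog : F \is ishomog1 delta mdeg.
Hypothesis delta_gt0 : (0 < delta)%N.
Hypothesis F_smooth : forall x : 'I_n.+1 -> C, (exists l, x l != 0) ->
  exists w, differential F x w != 0.
Variable Q : curve_operator C n.
Hypothesis Q_global : global_log_jet_differential F k m Q.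
Hypothesis m_gt0 : (0 < m)%N.
Hypothesis k_lt_n : (k < n)%N.
Implicit Types (X : 'I_n.+1 -> {poly C}).
Local Notation value := (@value R n delta k m F Q).
Local Notation unit_jet := (@unit_jet R n k F).

(* The k + 1 linear conditions leave a nonzero solution because k + 1 < n + 1. *)
Lemma tangent_direction X : exists v : 'I_n.+1 -> C, [/\ exists l, v l != 0,
  \sum_l cj ((X l)`_0) * v l = 0 &
  forall j, (0 < j <= k)%N -> \sum_l (curve_eval (mderiv l F) X)`_j * v l = 0].
Proof.
(* Column 0 holds the orthogonality to the base point, in the place of the unconstrained coefficient
   of order 0. *)
pose A := \matrix_(l < n.+1, j < k.+1)
  if j == 0 then cj ((X l)`_0) else (curve_eval (mderiv l F) X)`_j.
have kA : kermx A != 0.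
  rewrite kermx_eq0 /row_free; apply: contraTneq k_lt_n => rA.
  by rewrite -leqNgt -ltnS -rA rank_leq_col.
pose v := nz_row (kermx A).
have vA : v *m A = 0.
  by apply/eqP; rewrite -sub_kermx; exact: nz_row_sub.
have cond (j : 'I_k.+1) : \sum_l A l j * v 0 l = 0.
  have /rowP/(_ j) := vA; rewrite !mxE => E; rewrite -[RHS]E.
  by apply: eq_bigr => l _; rewrite mulrC.
exists (v 0); split.
- have : v != 0 by rewrite nz_row_eq0.
  by case/matrix0Pn => i [l]; rewrite ord1 => h; exists l.
- by have := cond 0; under eq_bigr do rewrite mxE eqxx.
move=> j /andP[j0 jk]; have := cond (Ordinal (jk : (j < k.+1)%N)).
under eq_bigr do rewrite mxE.
by rewrite -val_eqE /= gtn_eqF.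
Qed.

(** Passing from xi_j to its power keeps the shape constant + t^2 (holomorphic) that
    [no_interior_max] requires. *)
Lemma power_expansion (x y : C) (c : C -> {poly C}) j e : coef_family (@hol0 R) c ->
  exists2 theta : C -> C, hol0 theta &
  forall t, (x + t ^+ 2 * (y * (c t)`_j)) ^+ e = x ^+ e + t ^+ 2 * theta t.
Proof.
move=> hc; have hy : hol0 (fun t => y * (c t)`_j) by exact: (hol0M (hol0_cst y) (hc j)).
pose u (bt : bool * C) := if bt.1 then x + bt.2 ^+ 2 * (y * (c bt.2)`_j) else x.
have [PC _ PM] := hol0_cong_fun_subring R 2.
have Pu : hol0_cong 2 u.
  split; [exact: (hol0D (hol0_cst x) (hol0M (hol0_pow R 2) hy))|exact: hol0_cst|].
  by exists (fun t => y * (c t)`_j).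
have [_ _ [th hth thE]] := @family_exp_ind C _ (hol0_cong 2) u e (PC 1) PM Pu.
by exists th.
Qed.

(** A base norm at least 1 and exponents at least 1 allow a single common denominator for all
    orders. *)
Lemma scaled_energy_le (X : 'I_n.+1 -> {poly C}) : 1 <= base_norm2 X ->
  scaled_energy k m X <= (\sum_(jl : 'I_k * 'I_n.+1)
    nrm ((X jl.2)`_jl.1.+1 ^+ jet_exponent k m jl.1) ^+ 2) / base_norm2 X.
Proof.
move=> b1; rewrite /scaled_energy pair_bigA mulr_suml /=; apply: ler_sum => -[j l] _ /=.
have b0 : 0 < base_norm2 X by lra.
rewrite nrmX -exprM mulnC ler_wpM2l ?exprn_ge0 ?nrm_ge0// lef_pV2 ?posrE ?exprn_gt0//.
by apply: ler_eXnr => //; exact: jet_exponent_gt0.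
Qed.

Theorem value_eq0 X0 : admissible k F X0 -> (exists l, (X0 l).[0] != 0) -> value X0 = 0.
Proof.
move=> aX0 x0; apply/eqP; apply: contrapT => /negP v0.
have [X [[[sX uX] bX eX] vX Xmax]] := maximal_value F_homog delta_gt0 F_smooth Q_global m_gt0 aX0 x0 v0.
have [i xi] : exists l, (X l).[0] != 0 by apply: base_norm2_neq0; rewrite bX oner_neq0.
have [w dw] := F_smooth (x := fun l => (X l).[0]) (ex_intro _ i xi).
have [v [[l0 vl0] vx vj]] := tangent_direction X.
have [rr [hrr rrE]] := curve_eval_first_order F X v.
(* The choice of [v] kills the terms of order t in the coefficients 1, ..., k, so the correction is
   of order t^2. *)
have [|c [hc c0 sc nc]] := @deform_curve R n.+1 F X v w k 2 isT dw.
  move=> j jk; exists (rr j); first exact: hrr.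
  by move=> t; rewrite rrE (uX j jk) (vj j jk) mulr0 add0r add0r.
pose Xt t l := X l + (t * v l)%:P + (t ^+ 2 * w l) *: c t.
have hX l : coef_family (@hol0 R) (fun t => Xt t l) by exact: coef_family_deformed.
have Xt0 : Xt 0 = X.
  by apply/funext => l; rewrite /Xt !mul0r addr0 expr0n mul0r scale0r addr0.
have xi0 : (Xt 0 i).[0] != 0 by rewrite Xt0.
pose phi t := value (Xt t).
have hphi : hol0 phi := hol0_value F_homog delta_gt0 F_smooth Q_global hX xi0 nc.
have phi0 : phi 0 != 0 by rewrite /phi Xt0.
pose s : R := \sum_l nrm (v l) ^+ 2.
have s0 : 0 < s.
  rewrite /s (bigD1 l0)//=; apply: ltr_wpDr; last by rewrite exprn_gt0// nrm_gt0.
  by apply: sumr_ge0 => l _; rewrite exprn_ge0// nrm_ge0.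
(* An exact formula: the correction has no constant term, and orthogonality removes the cross
   term. *)
have baseXt t : base_norm2 (Xt t) = 1 + nrm t ^+ 2 * s.
  rewrite -bX /base_norm2 /s mulr_sumr -big_split /=.
  have E l : nrm ((Xt t l)`_0) ^+ 2 = nrm ((X l)`_0) ^+ 2 + nrm t ^+ 2 * nrm (v l) ^+ 2 +
      2 * re (t * (cj ((X l)`_0) * v l)).
    rewrite /Xt !coefD coefC coefZ c0 mulr0 addr0 /= sqr_nrmD nrmM exprMn [cj _ * _]mulrCA.
    exact: addrAC.
  under eq_bigr do rewrite E.
  rewrite big_split /= -mulr_sumr -re_sum -mulr_sumr vx mulr0.
  by rewrite [re 0](_ : _ = 0) ?mulr0 ?addr0.
have base1 t : 1 <= base_norm2 (Xt t).
  by rewrite baseXt lerDl mulr_ge0 ?exprn_ge0 ?nrm_ge0 ?(ltW s0).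
have coefXt t l j : (Xt t l)`_j.+1 = (X l)`_j.+1 + t ^+ 2 * (w l * (c t)`_j.+1).
  by rewrite /Xt !coefD coefC coefZ /= addr0 mulrA.
have /choice[theta thP] : forall jl : 'I_k * 'I_n.+1, exists th : C -> C, hol0 th /\
    forall t, (Xt t jl.2)`_jl.1.+1 ^+ jet_exponent k m jl.1 =
      (X jl.2)`_jl.1.+1 ^+ jet_exponent k m jl.1 + t ^+ 2 * th t.
  move=> [j l]; have [th hth thE] := power_expansion ((X l)`_j.+1) (w l) j.+1 (jet_exponent k m j) hc.
  by exists th; split=> [|t]; [exact: hth|rewrite coefXt thE].
(* The vector [h] consists of the powers xi_j^(E/j); its squared norm is the energy of [X], which is
   1. *)
apply: (@no_interior_max R phi _ (fun jl : 'I_k * 'I_n.+1 => (X jl.2)`_jl.1.+1 ^+ jet_exponent k m jl.1)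
  theta s (2 * k`!) hphi phi0 (fun jl => (thP jl).1) s0).
  rewrite -eX /jet_energy pair_bigA; apply: eq_bigr => -[j l] _ /=.
  by rewrite nrmX -exprM mulnC.
move: nc; apply: near0S => t ut.
have aXt : admissible k F (Xt t).
  split=> [l|]; last exact: ut.
  rewrite /Xt (leq_trans (size_polyD _ _))// geq_max; apply/andP; split; last first.
    exact: leq_trans (size_scale_leq _ _) (sc t).
  rewrite (leq_trans (size_polyD _ _))// geq_max sX /=.
  by apply: leq_trans (size_polyC_leq1 _) _.
have xt : exists l, (Xt t l).[0] != 0.
  by apply: base_norm2_neq0; rewrite gt_eqF// (lt_le_trans ltr01).
have := Xmax (Xt t) aXt xt; rewrite -{1}Xt0 => H.
apply: (le_trans H); apply: ler_wpM2l; first by apply: exprn_ge0; exact: nrm_ge0.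
apply: le_trans (scaled_energy_le (base1 t)) _.
rewrite baseXt; under eq_bigr do rewrite (thP _).2.
exact: lexx.
Qed.

End Vanishing.

(** * From the smoothness of the divisor to the theorem *)

Lemma differential_homog (K : fieldType) m (F : mpoly m K) d (x w : 'I_m -> K) (c : K) :
  F \is ishomog1 d mdeg ->
  differential F (fun l => c * x l) (fun l => c * w l) = c ^+ d * differential F x w.
Proof.
move=> hF.
have E1 := @curve_eval_step K m F (fun l => (x l)%:P) w 1 1%N isT 1%N isT.
have E2 := @curve_eval_step K m F (fun l => (c * x l)%:P) (fun l => c * w l) 1 1%N isT 1%N isT.
have C0 (y : 'I_m -> K) : (curve_eval F (fun l => (y l)%:P))`_1 = 0.
  have -> : curve_eval F (fun l => (y l)%:P) = (meval y F)%:P.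
    rewrite /meval -[RHS]/((polyC : {rmorphism K -> {poly K}}) _) mmap_morph.
    by congr (mmap _ _ F); apply/funext.
  by rewrite coefC.
have H0 (y : 'I_m -> K) : (fun l => (y l)%:P.[0]) = y by apply/funext => l; rewrite hornerC.
rewrite C0 eqxx add0r mul1r H0 in E1; rewrite C0 eqxx add0r mul1r H0 in E2.
rewrite -E1 -E2 (_ : (fun l => _) = fun l => c%:P * ((x l)%:P + (1 * w l) *: 'X^1)).
  by rewrite (curve_eval_homog _ _ hF) -polyC_exp coefCM.
by apply/funext => l; rewrite mulrDr -polyCM mul_polyC scalerA mulrCA.
Qed.

Lemma sum_scaled_delta (K : fieldType) m (f : 'I_m -> K) (c : K) l : c != 0 ->
  \sum_j f j * (c * (c^-1 * (j == l)%:R)) = f l.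
Proof.
move=> c0; rewrite (bigD1 l)//= eqxx mulr1 divff// mulr1 big1 ?addr0// => j /negbTE ->.
by rewrite !mulr0.
Qed.

(** Off the divisor Euler's identity provides [w = x]. On it the Jacobian criterion does, at the
    representative c x chosen by [hcoord]; homogeneity brings the result back to [x]. *)
Lemma smooth_form_differential (R : realType) n delta (F : mpoly n.+1 (complex_field R)) :
  F \is ishomog1 delta mdeg -> (0 < delta)%N -> smooth_form F ->
  forall x : 'I_n.+1 -> complex_field R, (exists l, x l != 0) ->
  exists w, differential F x w != 0.
Proof.
move=> hF d0 sF x [i xi]; have [Fx|Fx] := eqVneq (meval x F) 0; last first.
  by exists x; rewrite (differential_euler _ hF) mulf_neq0// pnatr_eq0 -lt0n.
have v0 : \row_l x l != 0 by apply: contraNneq xi => /rowP/(_ i); rewrite !mxE => ->.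
have [c c0 cE] := hcoord_to_Pn v0.
have hE : hcoord (to_Pn (\row_l x l)) = fun l => c * x l.
  by apply/funext => l; rewrite cE mxE.
have [|l] := sF (to_Pn (\row_l x l)).
  by rewrite /divisor hE (meval_homog _ _ hF) Fx mulr0.
rewrite hE => dl; exists (fun j => c^-1 * (j == l)%:R).
apply: contraNneq dl => dx; have := differential_homog x (fun j => c^-1 * (j == l)%:R) c hF.
by rewrite dx mulr0 /differential sum_scaled_delta// => ->.
Qed.

Theorem theorem4p2 (R : realType) (n delta : nat)
  (F : mpoly n.+1 (complex_field R)) :
  smooth_irreducible_divisor F delta ->
  (3 <= delta)%N ->
  forall m k : nat, (1 <= m)%N -> (1 <= k <= n - 1)%N ->
  forall Q : curve_operator (complex_field R) n,
    global_log_jet_differential F k m Q -> zero_operator F Q.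
Proof.
move=> [hF _ sF] d3 m k m1 kn Q hQ.
have d0 : (0 < delta)%N by apply: leq_trans d3.
have kn' : (k < n)%N by lia.
have sF' := smooth_form_differential hF d0 sF.
apply: (operator_eq0 hF d0 sF' hQ) => X sX uX x0.
exact: (value_eq0 hF d0 sF' hQ m1 kn' (conj sX uX) x0).
Qed.
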